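(* Let $q\in L^1[0,1]$ be real-valued, let $b\in(0,1)$, and let $\lambda_1<\lambda_2<\cdots$ be the eigenvalues of the problem $$-u''+q(x)u-\lambda u=0,\quad 0\le x\le1,\qquad u(0)=u(1)=0.$$ Let $m(n)$, $n=1,2,\dots$, be a sequence of pairwise distinct positive integers such that $$\frac{m(n)}{n}=\frac1\sigma(1+\varepsilon_n),\qquad \varepsilon_n\to0,\qquad \sigma>0.$$ If $\sigma>2b$, then the data $\{\lambda_{m(n)},\ n=1,2,\dots;\ q(x),\ b\le x\le1\}$ determine $q(x)$, $0\le x\le b$, uniquely. If $\sigma=2b$ and $\sum_{n=1}^\infty|\varepsilon_n|<\infty$, then the same data determine $q(x)$, $0\le x\le b$, uniquely.
   Context: ''The data determine $q$ uniquely'' means: if $q_1,q_2\in L^1[0,1]$ are real-valued, $q_1=q_2$ a.e. on $[b,1]$, and the $m(n)$-th Dirichlet eigenvalues of $q_1$ and $q_2$ coincide for all $n\ge1$, then $q_1=q_2$ a.e. on $[0,b]$. *)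

(* Defs.v *)
From HB Require Import structures.
From mathcomp Require Import all_boot all_order all_algebra.
From mathcomp Require Import all_classical all_reals all_analysis.

Set Implicit Arguments.
Unset Strict Implicit.
Unset Printing Implicit Defensive.

Import Order.TTheory GRing.Theory Num.Theory.
Import numFieldNormedType.Exports.

Local Open Scope classical_set_scope.
Local Open Scope ring_scope.

Definition L1_01 (R : realType) (q : R -> R) : Prop :=
  (@lebesgue_measure R).-integrable `[0, 1] (EFin \o q).

Definition ae_eq_on (R : realType) (D : set R) (f g : R -> R) : Prop :=
  {ae @lebesgue_measure R, forall x, D x -> f x = g x}.

Definition absolutely_continuous (R : realType) (a b : R) (f : R -> R) : Prop :=
  forall e : R, 0 < e -> exists2 d : R, 0 < d &
    forall (n : nat) (s t : 'I_n -> R),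
      (forall i, [/\ a <= s i, s i <= t i & t i <= b]) ->
      trivIset setT (fun i => `]s i, t i[%classic) ->
      \sum_(i < n) (t i - s i) < d ->
      \sum_(i < n) `|f (t i) - f (s i)| < e.

(* Solutions in the usual sense for q in L^1: u is C^1 on [0, 1], v = u' is
   absolutely continuous, and the equation holds almost everywhere. Since u is
   continuous on [0, 1] and v is too, requiring u' = v in the open interval
   gives the one-sided derivatives at 0 and 1. Values outside [0, 1] are
   irrelevant. *)
Definition schrodinger_solution (R : realType) (q : R -> R) (lambda : R)
    (u : R -> R) : Prop :=
  exists v : R -> R,
    [/\ {within `[0, 1], continuous u},
        forall x : R, 0 < x < 1 -> is_derive x 1 u (v x),
        absolutely_continuous 0 1 v &
        {ae @lebesgue_measure R, forall x : R, 0 < x < 1 ->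
           derivable v x 1 /\ - 'D_1 v x + q x * u x - lambda * u x = 0}].

Definition dirichlet_eigenvalue (R : realType) (q : R -> R) (lambda : R) : Prop :=
  exists u : R -> R,
    [/\ schrodinger_solution q lambda u, u 0 = 0, u 1 = 0 &
        exists2 x : R, 0 <= x <= 1 & u x != 0].

(* lambda n is the n-th eigenvalue for n >= 1; lambda 0 is a dummy value. *)
Definition dirichlet_spectrum (R : realType) (q : R -> R) (lambda : nat -> R) : Prop :=
  (forall i j : nat, (0 < i < j)%N -> lambda i < lambda j) /\
  (forall mu : R, dirichlet_eigenvalue q mu <->
     exists2 n : nat, (0 < n)%N & mu = lambda n).

(* Only the values m n with n >= 1 are used. *)
Definition data_determine_potential (R : realType) (b : R) (m : nat -> nat) : Prop :=
  forall (q1 q2 : R -> R) (lambda1 lambda2 : nat -> R),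
    L1_01 q1 -> L1_01 q2 ->
    dirichlet_spectrum q1 lambda1 -> dirichlet_spectrum q2 lambda2 ->
    ae_eq_on `[b, 1] q1 q2 ->
    (forall n : nat, (0 < n)%N -> lambda1 (m n) = lambda2 (m n)) ->
    ae_eq_on `[0, b] q1 q2.

(* Main.v *)
Require Import Defs.
From HB Require Import structures.
From mathcomp Require Import all_boot all_order all_algebra.
From mathcomp Require Import all_classical all_reals all_analysis.
From mathcomp Require Import measurable_realfun complex ring lra zify.

(** Let [phi_j] solve [u'' = (q_j - lam) u], [u 0 = 0], [u' 0 = 1]. Since [q1 = q2] on
    [[b, 1]], the common eigenvalues are zeros of
    [W lam = phi_1 b * phi_2' b - phi_1' b * phi_2 b], which is entire of order 1/2 and
    [O (e^(2b |Im (sqrt lam)|) / |lam|)]. Jensen's formula forbids a nonzero function of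
    this growth to have zeros [z_n] with [|z_n| <= (pi n / 2b)^2 e^(a_n)] and [a] summable,
    so [W] vanishes identically. Entire functions are replaced throughout by their polynomial
    approximants in [lam], for which a discrete Jensen inequality suffices.

    The Pruefer angle shows that [phi_1 b] has enough zeros, namely the Dirichlet
    eigenvalues of [[0, b]], to apply the same principle to [phi_1 b - phi_2 b] and, with
    [chi_j] the solutions normalised at [b], to [phi_1 x * chi_2 x - phi_2 x * chi_1 x].
    Hence both vanish identically, and [phi_1 x ^ 2 = phi_2 x ^ 2] by the Wronskians. For
    [lam] very negative [phi_j] is positive, so [phi_1 = phi_2] on [[0, b]] and the equation
    returns [q1 = q2]. *)

Set Implicit Arguments.
Unset Strict Implicit.
Unset Printing Implicit Defensive.

Import Order.TTheory GRing.Theory Num.Theory.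
Import numFieldNormedType.Exports.

Local Open Scope classical_set_scope.
Local Open Scope ring_scope.

(** The count of zeros is exactly critical, and this shapes the proof. At radius [r = pi N / (2b)],
    Jensen's inequality compares [r ^ (2N)] with the product of the first [N] zeros, which is at
    most a constant times [(pi / 2b) ^ (2N) N!^2]. The growth [e^(2b |Im (sqrt lam)|)] averages over
    [|lam| = r^2] to [e^(2N)], the mean of [|sin|] being [2 / pi], and cancels the [e^(-2N)] of
    Stirling's formula. What remains is a factor [N] against the decay [1 / r^2], hence
    [|W 0| = O(1 / N)]. The decay is decisive: [sin (2b sqrt lam) / sqrt lam] has all the zeros
    [(pi n / 2b)^2] and lacks only half a power of [lam]. It is obtained by expressing each function
    through differences of solutions for the two potentials, which are smaller than the solutions by
    a factor [sqrt lam]. This bounds the value at [0] alone; other points are reached by translating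
    [lam], that is, by subtracting a constant from the potentials. The functions treated after [W]
    have type [b] in place of [2b], so the Dirichlet eigenvalues of [[0, b]], near [(pi n / b)^2],
    are critical for them in the same way. *)

(** * Monotonicity of absolutely continuous functions from the sign of the derivative *)

Section AbsolutelyContinuousMonotone.
Context {R : realType}.
Implicit Types (F : R -> R) (O : set R) (l : seq (R * R)).
Notation mu := (@lebesgue_measure R).

(** The list runs from right to left, so that lengthening a chain at its right end is a cons. *)
Fixpoint chain a O (x : R) l : Prop :=
  if l is st :: l' then
    [/\ a <= st.1, st.1 <= st.2, st.2 <= x, `]st.1, st.2[%classic `<=` O &
        chain a O st.1 l']
  else True.

Lemma chain_le a O x y l : x <= y -> chain a O x l -> chain a O y l.
Proof. by case: l => //= st l xy [? ? /le_trans h ? ?]; split => //; exact: h. Qed.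

Lemma chain_nth a O x l i : chain a O x l -> (i < size l)%N ->
  let st := nth (0, 0) l i in
  [/\ a <= st.1, st.1 <= st.2, st.2 <= x & `]st.1, st.2[%classic `<=` O].
Proof.
elim: l i x => [|st l IH] [|i] x //= [h1 h2 h3 h4 h5] il //.
have [a1 a2 a3 a4] := IH i _ h5 il; split => //.
by rewrite (le_trans a3) // (le_trans h2).
Qed.

Lemma chain_disjoint a O x l i j : chain a O x l -> (i < j < size l)%N ->
  (nth (0, 0) l j).2 <= (nth (0, 0) l i).1.
Proof.
elim: l i j x => [|st l IH] [|i] [|j] x //=; rewrite ?andbF //.
- by move=> [_ _ _ _ h5] /= jl; have [] := chain_nth h5 jl.
- by move=> [_ _ _ _ h5] ij; exact: IH h5 ij.
Qed.

(** Cutting [O] at [x] makes the induction close: the head interval is disjoint from the part of [O]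
    below it, which carries the tail. *)
Lemma chain_length a O x l : open O -> chain a O x l ->
  ((\sum_(st <- l) (st.2 - st.1))%:E <= mu (O `&` `]-oo, x[%classic))%E.
Proof.
move=> oO; elim: l x => [|[s t] l IH] x /=; first by rewrite big_nil measure_ge0.
move=> [_ st tx stO /IH h]; rewrite big_cons /= EFinD.
have -> : (t - s)%:E = mu `]s, t[%classic.
  rewrite lebesgue_measure_itv /= lte_fin; move: st; rewrite le_eqVlt => /orP[/eqP ->|->]; last by rewrite EFinN -EFinD.
  by rewrite ltxx subrr.
have mO : measurable O by exact: open_measurable.
apply: le_trans (leeD2l _ h) _.
rewrite -measureU //; last 2 first.
- exact: measurableI.
- apply/seteqP; split => [z [/=]|//]; rewrite !in_itv /= => /andP[sz _] [_].
  by rewrite ltNge (ltW sz).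
apply: le_measure; rewrite ?inE.
- by apply: measurableU => //; exact: measurableI.
- exact: measurableI.
- move=> z [zst|[zO]].
    split; first exact: stO.
    by move: zst; rewrite /= !in_itv /= => /andP[_ /lt_le_trans]; apply.
  rewrite /= !in_itv /= => zs; split => //.
  by rewrite (lt_le_trans zs) // (le_trans st).
Qed.

Lemma absolutely_continuous_chain a c F e : absolutely_continuous a c F -> 0 < e ->
  exists2 d : R, 0 < d & forall O l, open O -> (mu O < d%:E)%E -> chain a O c l ->
    \sum_(st <- l) `|F st.2 - F st.1| < e.
Proof.
move=> acF e0; have [d d0 H] := acF _ e0; exists d => // O l oO Od ch.
have := H (size l) (fun i => (nth (0, 0) l i).1) (fun i => (nth (0, 0) l i).2).
have -> : \sum_(st <- l) `|F st.2 - F st.1| =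
    \sum_(i < size l) `|F (nth (0, 0) l i).2 - F (nth (0, 0) l i).1|.
  by rewrite (big_nth (0, 0)) big_mkord.
apply.
- by move=> i; have [] := chain_nth ch (ltn_ord i).
- move=> i j _ _; have [ij|ij|/ord_inj//] := ltngtP i j.
  + have ij' : (i < j < size l)%N by rewrite ij ltn_ord.
    move=> [z [/=]]; rewrite !in_itv /= => /andP[h1 _] /andP[_ h2].
    have := chain_disjoint ch ij'.
    by rewrite leNgt (lt_trans h1 h2).
  + have ij' : (j < i < size l)%N by rewrite ij ltn_ord.
    move=> [z [/=]]; rewrite !in_itv /= => /andP[_ h1] /andP[h2 _].
    have := chain_disjoint ch ij'.
    by rewrite leNgt (lt_trans h2 h1).
- have := chain_length oO ch; rewrite (big_nth (0, 0)) big_mkord => h.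
  rewrite -lte_fin; apply: le_lt_trans h (le_lt_trans _ Od).
  have mO : measurable O by exact: open_measurable.
  apply: le_measure; rewrite ?inE //; exact: measurableI.
Qed.

(** The straddle estimate: it controls increments across [x], not only those with an endpoint at
    [x], because the point from which a supremum is approached lies strictly before it. *)
Lemma derive_local_growth F (x df e : R) : is_derive x 1 F df -> df <= 0 -> 0 < e ->
  exists2 d : R, 0 < d & forall z y, x - d < z -> z <= x -> x <= y -> y < x + d ->
    F y - F z <= e * (y - z).
Proof.
move=> [/cvg_ex[l Fl] /= dF] df0 e0.
have ldf : l = df by rewrite -dF; apply/esym/cvg_lim.
move: Fl; rewrite ldf => /cvgrPdist_le /(_ _ e0) [d /= d0 H]; exists d => // z y h1 h2 h3 h4.
have key h : h != 0 -> `|h| < d -> h^-1 * (F (x + h) - F x) <= e.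
  move=> h0 hd; have /= := H h _ h0; rewrite sub0r normrN => /(_ hd).
  by rewrite /GRing.scale /= mulr1 (addrC h) ler_norml => /andP[k1 k2]; lra.
have k1 : F y - F x <= e * (y - x).
  have [->|yx] := eqVneq y x; first by rewrite !subrr mulr0.
  have yx0 : 0 < y - x by rewrite subr_gt0 lt_neqAle eq_sym yx.
  have := key (y - x) (lt0r_neq0 yx0); rewrite gtr0_norm // [x + _]addrC subrK.
  move=> /(_ _)/wrap[]; first by rewrite ltrBlDl.
  by rewrite mulrC ler_pdivrMr.
have k2 : F x - F z <= e * (x - z).
  have [->|zx] := eqVneq z x; first by rewrite !subrr mulr0.
  have zx0 : 0 < x - z by rewrite subr_gt0 lt_neqAle zx.
  have zx1 : z - x != 0 by rewrite subr_eq0.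
  have := key (z - x) zx1; rewrite distrC gtr0_norm // [x + _]addrC subrK.
  move=> /(_ _)/wrap[]; first lra.
  by rewrite -opprB invrN mulNr -mulrN opprB mulrC ler_pdivrMr.
lra.
Qed.

(** The null set on which the derivative is unknown is covered by an open [U] of measure below [d].
    Moving right from [a], the increase of [F] is charged to a chain inside [U] at points of [U],
    and to the slope [e] elsewhere; a supremum argument shows that [c] is reached. *)
Lemma absolutely_continuous_le a c F : a <= c -> absolutely_continuous a c F ->
  {ae mu, forall x, a < x < c -> exists2 df : R, is_derive x 1 F df & df <= 0} ->
  F c <= F a.
Proof.
move=> ac acF aeF; apply/ler_addgt0Pl => e0 e0_gt0.
(* The slope costs [e * (c - a)] and the chain costs [e]; together this is [e0]. *)
pose e := e0 / (1 + (c - a)).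
have ca : 0 < 1 + (c - a) by lra.
have e_gt0 : 0 < e by rewrite divr_gt0.
have [d d0 Hd] := absolutely_continuous_chain acF e_gt0.
have [N [mN N0 NE]] := aeF.
(* The endpoints join the null set, since the derivative is only given in the open interval. *)
have [U [oO NO Od]] : exists U : set R, [/\ open U, N `|` [set a; c] `<=` U &
    (mu U < d%:E)%E].
  pose N' := N `|` [set a; c].
  have mac : measurable [set a; c].
    by apply: measurableU; exact: measurable_set1.
  have mN' : measurable N' by exact: measurableU.
  have N'0 : mu N' = 0%E.
    apply/(negligibleP _ mN')/negligibleU; first exact/negligibleP.
    by apply: negligibleU; apply/negligibleP => //; exact: lebesgue_measure_set1.
  have N'y : (mu N' < +oo)%E by rewrite N'0 ltry.
  have [U [oO N'U Od]] := lebesgue_regularity_outer mN' N'y d0.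
  exists U; split => //.
  have mO : measurable U by exact: open_measurable.
  have -> : mu U = mu (U `\` N').
    rewrite -[in LHS](setDUK N'U) measureU //; try exact: measurableD.
      by rewrite -[RHS]add0e; congr (_ + _)%E.
    by apply/seteqP; split => // z [] ? [].
  exact: Od.
pose reach x := exists2 l, chain a U x l &
  F x - F a <= e * (x - a) + \sum_(st <- l) `|F st.2 - F st.1|.
have loc x : a <= x <= c -> exists2 r : R, 0 < r & forall z y, x - r < z ->
    a <= z -> z <= x -> x <= y -> y < x + r -> reach z -> reach y.
  move=> /andP[ax xc]; have [xO|xO] := pselect (U x).
    have [r /= r0 H] := (nbhs_ballP _ _).1 (open_nbhs_nbhs (conj oO xO)).
    exists r => // z y h1 az h2 h3 h4 [l ch hl]; exists ((z, y) :: l) => /=.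
      split => //; first exact: le_trans h2 h3.
      move=> w /=; rewrite in_itv /= => /andP[w1 w2]; apply: H.
      by rewrite /ball /= ltr_norml; apply/andP; split; lra.
    rewrite big_cons /=.
    have := ler_norm (F y - F z); have : 0 <= e * (y - z).
      by rewrite mulr_ge0 ?(ltW e_gt0) // subr_ge0 (le_trans h2).
    lra.
  have [df dF df0] : exists2 df : R, is_derive x 1 F df & df <= 0.
    have xN : ~ N x by move=> Nx; apply: xO; apply: NO; left.
    have xa : x != a by apply/eqP => xa; apply: xO; apply: NO; right; left.
    have xc' : x != c by apply/eqP => xc'; apply: xO; apply: NO; right; right.
    have axc : a < x < c by rewrite !lt_neqAle ax xc eq_sym xa xc'.
    by apply: contrapT => h; apply: xN; apply: NE => /= /(_ axc).
  have [r r0 Hr] := derive_local_growth dF df0 e_gt0.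
  exists r => // z y h1 az h2 h3 h4 [l ch hl]; exists l.
    by apply: chain_le ch; exact: le_trans h2 h3.
  have := Hr z y h1 h2 h3 h4; lra.
pose A := [set x | a <= x <= c /\ reach x].
have Aa : A a.
  split; first by rewrite lexx.
  by exists [::] => //=; rewrite big_nil !subrr mulr0 addr0.
have supA : has_sup A.
  by split; [exists a|exists c => x [/andP[]]].
have as_ : a <= sup A by apply: ub_le_sup => //; case: supA.
have sc : sup A <= c by apply: ge_sup => //; [exists a|move=> x [/andP[]]].
have [r r0 Hr] := loc (sup A) (introT andP (conj as_ sc)).
have [z [/andP[az zc] rz] zs] := sup_adherent r0 supA.
have zsup : z <= sup A by apply: ub_le_sup; [case: supA|split => //; rewrite az].
have rs : reach (sup A) by apply: (Hr z) => //; lra.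
have rc : reach c.
  have [->//|nsc] := eqVneq c (sup A).
  have slc : sup A < c by rewrite lt_neqAle eq_sym nsc.
  pose y := Num.min c (sup A + r / 2).
  have sy : sup A < y by rewrite lt_min slc /=; lra.
  have yc : y <= c by rewrite ge_min lexx.
  have : A y.
    split; first by rewrite yc andbT; lra.
    apply: (Hr (sup A)) => //; [lra|exact: ltW|].
    by rewrite gt_min; apply/orP; right; lra.
  move=> /(ub_le_sup (proj2 supA)); lra.
have [l ch hl] := rc.
have := Hd U l oO Od ch.
have : e * (c - a) + e = e0 by rewrite /e; field; lra.
lra.
Qed.

End AbsolutelyContinuousMonotone.

(** * Calculus of absolutely continuous functions paired with their derivatives *)

Section Calculus.
Context {R : realType}.
Implicit Types (F G f g : R -> R) (a c x y : R).
Notation mu := (@lebesgue_measure R).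

Definition aae a c (P : R -> Prop) : Prop := {ae mu, forall x, a < x < c -> P x}.

Lemma aae_imply2 a c (P Q S : R -> Prop) : aae a c P -> aae a c Q ->
  (forall x, a < x < c -> P x -> Q x -> S x) -> aae a c S.
Proof.
move=> hP hQ PQ; have := negligibleU hP hQ; apply: negligibleS => x /= nS.
by apply/not_andP => -[Px Qx]; apply: nS => xac; apply: PQ => //; [exact: Px|exact: Qx].
Qed.

Lemma aae_imply a c (P Q : R -> Prop) : aae a c P ->
  (forall x, a < x < c -> P x -> Q x) -> aae a c Q.
Proof. by move=> h PQ; apply: (aae_imply2 h h) => x xac Px _; exact: PQ. Qed.

Lemma aaeW a c (P : R -> Prop) : (forall x, a < x < c -> P x) -> aae a c P.
Proof. by move=> h; exact: aeW. Qed.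

Lemma aae_sub a c a' c' (P : R -> Prop) : a <= a' -> c' <= c -> aae a c P -> aae a' c' P.
Proof.
move=> aa cc; apply: negligibleS => x /= h h'; apply: h => /andP[ax xc]; apply: h'.
by rewrite (le_lt_trans aa) // (lt_le_trans xc).
Qed.

(** The working notion throughout: identities and inequalities are checked on the almost everywhere
    derivatives and transferred to the functions by monotonicity, which spares most manipulations of
    integrals. *)
Definition acd a c F f := absolutely_continuous a c F /\
  aae a c (fun x : R => is_derive x 1 F (f x)).

Lemma acd_sub a c a' c' F f : a <= a' -> c' <= c -> acd a c F f -> acd a' c' F f.
Proof.
move=> aa cc [acF dF]; split; last exact: aae_sub dF.
move=> e e0; have [d d0 H] := acF e e0; exists d => // n s t h1; apply: H => i.
by have [h ? h'] := h1 i; split => //; [exact: le_trans h|exact: le_trans cc].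
Qed.

Lemma absolutely_continuous_unif a c F e : absolutely_continuous a c F -> 0 < e ->
  exists2 d : R, 0 < d & forall x y, a <= x <= c -> a <= y <= c -> `|x - y| < d ->
   `|F x - F y| < e.
Proof.
move=> acF e0; have [d d0 H] := acF e e0; exists d => //.
suff key x y : a <= x -> x <= y -> y <= c -> y - x < d -> `|F y - F x| < e.
  move=> x y /andP[ax xc] /andP[ay yc].
  have [xy|yx] := leP x y.
    by rewrite distrC [in _ `|F _ - _|]distrC ger0_norm ?subr_ge0 // => /key; apply.
  by rewrite gtr0_norm ?subr_gt0 // => /key; apply => //; exact: ltW.
move=> ax xy yc xyd; have := H 1%N (fun=> x) (fun=> y); rewrite !big_ord1; apply => //.
by move=> i j _ _ _; rewrite !ord1.
Qed.

Lemma absolutely_continuous_within a c F : absolutely_continuous a c F ->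
  {within `[a, c], continuous F}.
Proof.
move=> acF; apply/subspace_continuousP => x /=; rewrite in_itv /= => xac.
apply/cvgrPdist_lt => e e0; have [d d0 H] := absolutely_continuous_unif acF e0.
exists d => // y /= xy; rewrite in_itv /= => yac; exact: H.
Qed.

Lemma within_bounded a c F : {within `[a, c], continuous F} ->
  exists2 M : R, 0 < M & forall x, a <= x <= c -> `|F x| <= M.
Proof.
move=> cF; have [ac|ca] := leP a c; last first.
  by exists 1 => // x /andP[/le_trans h /h]; rewrite leNgt ca.
have [p _ Hp] := EVT_max ac cF; have [p' _ Hp'] := EVT_min ac cF.
exists (1 + `|F p| + `|F p'|); first by rewrite -addrA ltr_pwDl // addr_ge0.
move=> x xac; have xi : x \in `[a, c] by rewrite in_itv.
have := Hp _ xi; have := Hp' _ xi; have := ler_norm (F p); have := ler_norm (- F p').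
rewrite normrN ler_norml => *; have := normr_ge0 (F p); have := normr_ge0 (F p').
by move=> *; apply/andP; split; lra.
Qed.

Lemma absolutely_continuous_bounded a c F : absolutely_continuous a c F ->
  exists2 M : R, 0 < M & forall x, a <= x <= c -> `|F x| <= M.
Proof. by move=> /absolutely_continuous_within /within_bounded. Qed.

Lemma absolutely_continuousD a c F G : absolutely_continuous a c F ->
  absolutely_continuous a c G -> absolutely_continuous a c (fun x => F x + G x).
Proof.
move=> acF acG e e0; have e2 : 0 < e / 2 by rewrite divr_gt0.
have [d1 d10 H1] := acF _ e2; have [d2 d20 H2] := acG _ e2.
exists (Num.min d1 d2); first by rewrite lt_min d10.
move=> n s t h1 h2; rewrite lt_min => /andP[h3 h4].
have k1 := H1 n s t h1 h2 h3; have k2 := H2 n s t h1 h2 h4.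
apply: le_lt_trans (_ : _ <= \sum_(i < n) `|F (t i) - F (s i)| +
  \sum_(i < n) `|G (t i) - G (s i)|) _; last lra.
rewrite -big_split /=; apply: ler_sum => i _.
by rewrite (_ : _ + _ - _ = (F (t i) - F (s i)) + (G (t i) - G (s i))) ?ler_normD //; ring.
Qed.

(* Covers products, scalar multiples and Lipschitz compositions at once. *)
Lemma absolutely_continuous_dom a c F G H (L : R) : 0 <= L -> absolutely_continuous a c F ->
  absolutely_continuous a c G ->
  (forall x y, a <= x <= c -> a <= y <= c ->
    `|H y - H x| <= L * (`|F y - F x| + `|G y - G x|)) ->
  absolutely_continuous a c H.
Proof.
move=> L0 acF acG HL e e0; have e2 : 0 < e / (2 * (L + 1)) by rewrite divr_gt0 //; lra.
have [d1 d10 H1] := acF _ e2; have [d2 d20 H2] := acG _ e2.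
exists (Num.min d1 d2); first by rewrite lt_min d10.
move=> n s t h1 h2; rewrite lt_min => /andP[h3 h4].
have k1 := H1 n s t h1 h2 h3; have k2 := H2 n s t h1 h2 h4.
apply: (@le_lt_trans _ _ (L * (\sum_(i < n) `|F (t i) - F (s i)| +
  \sum_(i < n) `|G (t i) - G (s i)|))).
  rewrite -big_split /= mulr_sumr; apply: ler_sum => i _.
  have [a1 a2 a3] := h1 i; apply: HL; apply/andP; split => //.
  - exact: le_trans a3.
  - exact: le_trans a2.
apply: (@le_lt_trans _ _ (L * (e / (2 * (L + 1)) + e / (2 * (L + 1))))).
  by rewrite ler_wpM2l // lerD // ltW.
have -> : L * (e / (2 * (L + 1)) + e / (2 * (L + 1))) = e * (L / (L + 1)) by field; lra.
rewrite gtr_pMr // ltr_pdivrMr; lra.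
Qed.


Lemma absolutely_continuous_cst a c (k : R) : absolutely_continuous a c (fun=> k).
Proof.
move=> e e0; exists 1 => // n s t _ _ _.
by under eq_bigr do rewrite subrr normr0; rewrite big1.
Qed.

Lemma absolutely_continuous_id a c : absolutely_continuous a c id.
Proof.
move=> e e0; exists e => // n s t h _; apply: le_lt_trans.
by apply: ler_sum => i _; rewrite ger0_norm // subr_ge0; have [] := h i.
Qed.

Lemma acd_cst a c (k : R) : acd a c (fun=> k) (fun=> 0).
Proof.
split; first exact: absolutely_continuous_cst.
by apply: aaeW => x _; exact: is_derive_cst.
Qed.

Lemma acd_id a c : acd a c id (fun=> 1).
Proof.
split; first exact: absolutely_continuous_id.
by apply: aaeW => x _; exact: is_derive_id.
Qed.

Lemma acd_congr a c F f g :
  aae a c (fun x => f x = g x) -> acd a c F f -> acd a c F g.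
Proof.
move=> fg [acF dF]; split => //.
by apply: (aae_imply2 fg dF) => x xac <-.
Qed.

Lemma acd_eq a c F f g : acd a c F f -> (forall x, a < x < c -> f x = g x) -> acd a c F g.
Proof. by move=> hF fg; apply: acd_congr hF; exact: aaeW. Qed.

Lemma acdD a c F G f g : acd a c F f -> acd a c G g ->
  acd a c (fun x => F x + G x) (fun x => f x + g x).
Proof.
move=> [acF dF] [acG dG]; split; first exact: absolutely_continuousD.
by apply: (aae_imply2 dF dG) => x xac hf hg; exact: is_deriveD.
Qed.

Lemma acdM a c F G f g : acd a c F f -> acd a c G g ->
  acd a c (fun x => F x * G x) (fun x => f x * G x + F x * g x).
Proof.
move=> [acF dF] [acG dG]; split.
  have [M1 M10 H1] := absolutely_continuous_bounded acF.
  have [M2 M20 H2] := absolutely_continuous_bounded acG.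
  apply: (@absolutely_continuous_dom a c F G _ (M1 + M2)) => //; first lra.
  move=> x y xac yac.
  rewrite (_ : F y * G y - F x * G x = (F y - F x) * G y + F x * (G y - G x)); last ring.
  apply: le_trans (ler_normD _ _) _; rewrite !normrM.
  have := ler_wpM2l (normr_ge0 (F y - F x)) (H2 _ yac).
  have := ler_wpM2r (normr_ge0 (G y - G x)) (H1 _ xac).
  have := mulr_ge0 (ltW M10) (normr_ge0 (F y - F x)).
  have := mulr_ge0 (ltW M20) (normr_ge0 (G y - G x)).
  lra.
apply: (aae_imply2 dF dG) => x xac hf hg.
apply: is_derive_eq (is_deriveM hf hg) _.
by rewrite /GRing.scale /= addrC mulrC [F x * _]mulrC [X in _ + X]mulrC; ring.
Qed.

Lemma acdZ a c F f (k : R) : acd a c F f -> acd a c (fun x => k * F x) (fun x => k * f x).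
Proof.
by move=> hF; apply: acd_eq (acdM (acd_cst a c k) hF) _ => x _; rewrite mul0r add0r.
Qed.

Lemma acdN a c F f : acd a c F f -> acd a c (fun x => - F x) (fun x => - f x).
Proof.
move=> /(acdZ (-1)); under eq_fun do rewrite mulN1r.
by move=> /acd_eq; apply => x _; rewrite mulN1r.
Qed.

Lemma acdB a c F G f g : acd a c F f -> acd a c G g ->
  acd a c (fun x => F x - G x) (fun x => f x - g x).
Proof. by move=> hF /acdN; exact: acdD. Qed.

Lemma acd_sum a c n (F f : 'I_n -> R -> R) : (forall i, acd a c (F i) (f i)) ->
  acd a c (fun x => \sum_(i < n) F i x) (fun x => \sum_(i < n) f i x).
Proof.
elim: n F f => [|n IH] F f h.
  under eq_fun do rewrite big_ord0.
  by apply: acd_eq (acd_cst a c 0) _ => x _; rewrite big_ord0.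
under eq_fun do rewrite big_ord_recr /=.
apply: acd_eq (acdD (IH _ _ (fun i => h (widen_ord (leqnSn n) i))) (h ord_max)) _.
by move=> x _; rewrite big_ord_recr.
Qed.

(** A locally Lipschitz outer function is enough, because [F] is bounded on the segment. *)
Lemma acd_comp a c F f (p dp : R -> R) : acd a c F f ->
  (forall y : R, is_derive y 1 p (dp y)) ->
  (forall M : R, exists2 L : R, 0 <= L & forall x y, `|x| <= M -> `|y| <= M ->
     `|p y - p x| <= L * `|y - x|) ->
  acd a c (fun x => p (F x)) (fun x => dp (F x) * f x).
Proof.
move=> [acF dF] dp_ lip; split.
  have [M1 M10 H1] := absolutely_continuous_bounded acF; have [L L0 H] := lip M1.
  apply: (@absolutely_continuous_dom a c F F _ L) => // x y xac yac.
  apply: le_trans (H _ _ (H1 _ xac) (H1 _ yac)) _.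
  by rewrite ler_wpM2l // lerDl.
apply: aae_imply dF _ => x xac hf.
exact: (is_derive1_comp (dp_ (F x)) hf).
Qed.

Lemma mvt_dist_le (p dp : R -> R) (x y L : R) : x <= y ->
  (forall z : R, x < z < y -> is_derive z 1 p (dp z)) -> {within `[x, y], continuous p} ->
  (forall z, x < z < y -> `|dp z| <= L) -> `|p y - p x| <= L * (y - x).
Proof.
rewrite le_eqVlt => /predU1P[-> *|xy hp cp hL]; first by rewrite !subrr normr0 mulr0.
have hp' (z : R) : z \in `]x, y[ -> is_derive z 1 p (dp z) by rewrite in_itv /= => /hp.
have [z] := MVT xy hp' cp; rewrite in_itv /= => zxy ->.
by rewrite normrM [`|y - x|]gtr0_norm ?subr_gt0 // ler_wpM2r ?hL // subr_ge0 ltW.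
Qed.

Lemma derive_lipschitz (p dp : R -> R) (x y L : R) :
  (forall z : R, is_derive z 1 p (dp z)) ->
  (forall z, (x <= z <= y) || (y <= z <= x) -> `|dp z| <= L) ->
  `|p y - p x| <= L * `|y - x|.
Proof.
move=> hp; wlog xy : x y / x <= y => [W|] hL.
  have [/W/(_ hL)//|/ltW /W yx] := leP x y.
  by rewrite distrC [`|y - x|]distrC; apply: yx => z; rewrite orbC; exact: hL.
rewrite [`|y - x|]ger0_norm ?subr_ge0 //; apply: mvt_dist_le => // [|z /andP[xz zy]].
  apply: continuous_subspaceT => z.
  by apply/differentiable_continuous/derivable1_diffP; have [] := hp z.
by apply: hL; rewrite (ltW xz) (ltW zy).
Qed.

Lemma acd_expR a c F f : acd a c F f ->
  acd a c (fun x => expR (F x)) (fun x => expR (F x) * f x).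
Proof.
move=> hF; apply: (acd_comp hF) => M.
exists (expR M); first exact: expR_ge0.
move=> x y /ler_normlW xM /ler_normlW yM.
apply: (@derive_lipschitz expR expR x y (expR M)) => z zxy.
rewrite ger0_norm ?expR_ge0 // ler_expR.
by case/orP: zxy => /andP[_ /le_trans]; apply.
Qed.

Lemma acd_sin a c F f : acd a c F f ->
  acd a c (fun x => sin (F x)) (fun x => cos (F x) * f x).
Proof.
move=> hF; apply: (acd_comp hF) => M.
exists 1 => // x y _ _.
by apply: (@derive_lipschitz sin cos x y 1) => z _; exact: cos_max.
Qed.

Lemma acd_cos a c F f : acd a c F f ->
  acd a c (fun x => cos (F x)) (fun x => - sin (F x) * f x).
Proof.
move=> hF; apply: (@acd_comp a c F f _ (fun y => - sin y)) => // M.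
exists 1 => // x y _ _.
apply: (@derive_lipschitz cos (fun y => - sin y) x y 1) => z _.
by rewrite normrN; exact: sin_max.
Qed.

Lemma acd_le a c F f : a <= c -> acd a c F f ->
  aae a c (fun x => f x <= 0) -> F c <= F a.
Proof.
move=> ac [acF dF] f0; apply: absolutely_continuous_le => //.
by apply: (aae_imply2 dF f0) => x xac h1 h2; exists (f x).
Qed.

Lemma acd_const a c F f : a <= c -> acd a c F f ->
  aae a c (fun x => f x = 0) -> F c = F a.
Proof.
move=> ac hF f0; apply/le_anti/andP; split.
  by apply: acd_le hF _ => //; apply: aae_imply f0 _ => x _ ->.
rewrite -lerN2; apply: acd_le (acdN hF) _ => //.
by apply: aae_imply f0 _ => x _ ->; rewrite oppr0.
Qed.

(** Gronwall's inequality by the integrating factor [expR (- A)]. The rate [h] may have either sign;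
    applied to [- F] with a negative rate, it gives lower bounds. *)
Lemma acd_gronwall a c F f A h : a <= c -> acd a c F f -> acd a c A h ->
  aae a c (fun x => f x <= h x * F x) ->
  F c * expR (- A c) <= F a * expR (- A a).
Proof.
move=> ac hF hA fh; apply: (acd_le ac (acdM hF (acd_expR (acdN hA)))).
apply: aae_imply fh _ => x xac h1.
rewrite (_ : _ + _ = expR (- A x) * (f x - h x * F x)); last by ring.
by rewrite pmulr_rle0 ?expR_gt0 // subr_le0.
Qed.

End Calculus.

(** * Indefinite Lebesgue integrals *)

Section Integration.
Context {R : realType}.
Implicit Types (F G f g : R -> R) (a c x y : R).
Notation mu := (@lebesgue_measure R).

Definition integ a c f := mu.-integrable `[a, c] (EFin \o f).

Definition prim a f x : R := \int[mu]_(t in `[a, x]) f t.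

Lemma integ_sub a c a' c' f : a <= a' -> c' <= c -> integ a c f -> integ a' c' f.
Proof.
move=> aa cc; apply: integrableS => //= x /=; rewrite !in_itv /= => /andP[h1 h2].
by rewrite (le_trans aa h1) (le_trans h2 cc).
Qed.

Lemma integ_patch a c f : integ a c f -> mu.-integrable setT (EFin \o (f \_ `[a, c])).
Proof.
by move=> intf; rewrite -restrict_EFin; apply/integrable_restrict => //=; rewrite setTI.
Qed.

Lemma prim_patch a c f x : x <= c -> prim a f x = prim a (f \_ `[a, c]) x.
Proof.
move=> xc; apply: eq_Rintegral => t; rewrite inE /= in_itv /= => /andP[h1 h2].
by rewrite patchE mem_set //= in_itv /= h1 (le_trans h2 xc).
Qed.

Lemma prim_diff a c f s t : integ a c f -> a <= s -> s <= t -> t <= c ->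
  prim a f t - prim a f s = \int[mu]_(x in `]s, t[) f x.
Proof.
move=> intf as_ st tc; rewrite /prim.
rewrite (Rintegral_itvB (integ_sub (lexx a) tc intf)) ?bnd_simp //.
rewrite -Rintegral_itv_bndo_bndc //; apply: integrableS intf => //= x /=.
by rewrite !in_itv /= => /andP[/ltW/(le_trans as_) -> /ltW /le_trans ->].
Qed.

(** Disjointness merges the increments into one integral of [|f|] over a union of small measure.
    Extension by zero makes [f] integrable on the line, where absolute continuity of the integral is
    available. *)
Lemma prim_ac a c f : integ a c f -> absolutely_continuous a c (prim a f).
Proof.
move=> intf e e0; pose g := f \_ `[a, c].
have intg : mu.-integrable setT (EFin \o g) := integ_patch intf.
have [d [d0 Hd]] := integral_normr_continuous intg e0; exists d => // n s t h1 h2 h3.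
pose I i := `]s i, t i[%classic; pose D := \big[setU/set0]_(i < n) I i.
have mI i : measurable (I i) by exact: measurable_itv.
have mD : measurable D by exact: bigsetU_measurable.
have muI i : mu (I i) = (t i - s i)%:E.
  rewrite /I lebesgue_measure_itv /= lte_fin; have [_ + _] := h1 i.
  by rewrite le_eqVlt => /orP[/eqP ->|->]; [rewrite ltxx subrr|rewrite EFinN -EFinD].
have muD : (mu D < d%:E)%E.
  rewrite /D measure_bigsetU_ord //.
  by rewrite (eq_bigr _ (fun i _ => muI i)) sumEFin lte_fin.
have fing A : measurable A -> (\int[mu]_(x in A) `|g x|)%:E = (\int[mu]_(x in A) `|g x|%:E)%E.
  move=> mA; rewrite /Rintegral fineK //; apply: integrable_fin_num => //.
  apply: (integrableS measurableT) => //.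
  exact: integrable_abse intg.
apply: le_lt_trans (Hd D mD muD); rewrite -lee_fin.
rewrite fing // /D ge0_integral_bigsetU //=; last 3 first.
- by rewrite /index_enum; case: index_enum_key => /=; rewrite -enumT enum_uniq.
- by apply: sub_trivIset h2.
- apply: measurable_funTS; apply/measurable_EFinP; apply: measurableT_comp => //.
  by case/integrableP : intg => /measurable_EFinP.
rewrite -sumEFin; apply: lee_sum => i _.
apply: (@le_trans _ _ (\int[mu]_(x in I i) `|g x|)%:E); last by rewrite (fing _ (mI i)).
rewrite lee_fin.
have [k1 k2 k3] := h1 i; rewrite (prim_diff intf) //.
have -> : \int[mu]_(x in `]s i, t i[) f x = \int[mu]_(x in I i) g x.
  apply: eq_Rintegral => x; rewrite inE /= in_itv /= => /andP[/ltW h4 /ltW h5].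
  by rewrite /g patchE mem_set //= in_itv /= (le_trans k1 h4) (le_trans h5 k3).
apply: le_normr_Rintegral; first exact: mI.
exact: (@integrableS _ _ R mu setT (I i) (EFin \o g) measurableT (mI i) (@subsetT _ _) intg).
Qed.

(** Lebesgue differentiation for the extension of [f] by zero, whose primitive agrees with that of
    [f] near every interior point. *)
Lemma acd_prim a c f : integ a c f -> acd a c (prim a f) f.
Proof.
move=> intf; split; first exact: prim_ac.
pose g := f \_ `[a, c].
have intg : mu.-integrable setT (EFin \o g) := integ_patch intf.
have h1 (y : R) : mu.-integrable [set` Interval (BLeft a) (BRight y)] (EFin \o g).
  exact: (integrableS measurableT).
have h2 : locally_integrable [set: R] g by exact: integrable_locally.
have := FTC1 h1 h2; apply: negligibleS => x /= h h'; apply: h => /andP[ax xc].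
have [|dF F'] := h'; first by rewrite lte_fin.
have gx : g x = f x by rewrite /g patchE mem_set //= in_itv /= !ltW.
have : is_derive x 1 (prim a g) (g x).
  by rewrite -F' derive1E; apply/derivableP.
rewrite gx; apply: near_eq_is_derive; near=> y.
apply/esym/prim_patch/ltW.
by near: y; exact: lt_nbhsl.
Unshelve. all: by end_near. Qed.

Lemma prim0 a f : prim a f a = 0.
Proof. by rewrite /prim set_itv1 Rintegral_set1. Qed.

Lemma measurable_within a c F : {within `[a, c], continuous F} ->
  measurable_fun `[a, c] F.
Proof. by move=> cF; exact: subspace_continuous_measurable_fun. Qed.

Lemma integMr a c f F : integ a c f -> measurable_fun `[a, c] F ->
  (exists M : R, forall x, a <= x <= c -> `|F x| <= M) -> integ a c (fun x => f x * F x).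
Proof.
move=> intf mF [M HM].
have bF : [bounded F x | x in `[a, c] : set R].
  exists M; split; first exact: num_real.
  move=> N MN x /=; rewrite in_itv /= => /HM /le_trans; apply; exact: ltW.
exact: (@integrableMl _ _ R mu `[a, c] (measurable_itv _) (EFin \o f) F intf mF bF).
Qed.

Lemma integM_within a c f F : integ a c f -> {within `[a, c], continuous F} ->
  integ a c (fun x => f x * F x).
Proof.
move=> intf cF; apply: integMr => //; first exact: measurable_within.
by have [M _ HM] := within_bounded cF; exists M.
Qed.

Lemma integ_within a c F : {within `[a, c], continuous F} -> integ a c F.
Proof.
by move=> cF; apply: continuous_compact_integrable => //; exact: segment_compact.
Qed.

Lemma integD a c f g : integ a c f -> integ a c g -> integ a c (fun x => f x + g x).
Proof. by move=> hf hg; exact: (@integrableD _ _ R mu `[a, c] (measurable_itv _) (EFin \o f) (EFin \o g) hf hg). Qed.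

Lemma integB a c f g : integ a c f -> integ a c g -> integ a c (fun x => f x - g x).
Proof. by move=> hf hg; exact: (@integrableB _ _ R mu `[a, c] (measurable_itv _) (EFin \o f) (EFin \o g) hf hg). Qed.

Lemma integ_norm a c f : integ a c f -> integ a c (fun x => `|f x|).
Proof. by move=> hf; exact: (@integrable_abse _ _ R mu `[a, c] (EFin \o f) hf). Qed.

Lemma integ_cst a c (k : R) : integ a c (fun=> k).
Proof. by apply: integ_within; apply: continuous_subspaceT => x; exact: cst_continuous. Qed.

Lemma acd_within a c F f : acd a c F f -> {within `[a, c], continuous F}.
Proof. by case=> /absolutely_continuous_within. Qed.

Lemma acd_C1 a c F f : {within `[a, c], continuous F} ->
  (forall x : R, a < x < c -> is_derive x 1 F (f x)) ->
  (exists M : R, forall x, a < x < c -> `|f x| <= M) -> acd a c F f.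
Proof.
move=> cF dF [M HM]; split; last exact: aaeW.
apply: (@absolutely_continuous_dom R a c id id F `|M|) => //;
  try exact: absolutely_continuous_id.
suff key x y : a <= x -> x <= y -> y <= c -> `|F y - F x| <= `|M| * (y - x).
  move=> x y /andP[ax xc] /andP[ay yc]; have [xy|/ltW yx] := leP x y.
    apply: le_trans (key x y ax xy yc) _; rewrite ler_wpM2l //.
    by have := ler_norm (y - x); lra.
  rewrite distrC; apply: le_trans (key y x ay yx xc) _; rewrite ler_wpM2l //.
  by have := ler_norm (- (y - x)); rewrite normrN; lra.
move=> ax xy yc; apply: (@mvt_dist_le R F f) => //.
- by move=> z /andP[xz zy]; apply: dF; rewrite (le_lt_trans ax xz) (lt_le_trans zy yc).
- apply: continuous_subspaceW cF => z /=; rewrite !in_itv /= => /andP[xz zy].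
  by rewrite (le_trans ax xz) (le_trans zy yc).
- move=> z /andP[xz zy]; apply: le_trans (HM z _) (ler_norm _).
  by rewrite (le_lt_trans ax xz) (lt_le_trans zy yc).
Qed.

Lemma prim_derive a c f x : a < x < c -> {within `[a, c], continuous f} ->
  is_derive x 1 (prim a f) (f x).
Proof.
move=> /andP[ax xc] cf.
have xcf : {for x, continuous f}.
  by move/(continuous_within_itvP _ (lt_trans ax xc)) : cf => [h _ _]; apply: h; rewrite in_itv /= ax.
have [dF F'] := continuous_FTC1_closed xc (integ_within cf) ax xcf.
by rewrite -F' derive1E; apply/derivableP.
Qed.

End Integration.

(** * Invariance under the reflection of [[0, l]] *)

Section Reflection.
Context {R : realType}.
Implicit Types (F G f g : R -> R) (l x y : R).
Notation mu := (@lebesgue_measure R).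

Definition reflection l : measurableTypeR R -> measurableTypeR R := fun x => l - x.

Lemma measurable_reflection l : measurable_fun setT (reflection l).
Proof. by apply: measurable_funB => //; exact: measurable_cst. Qed.

HB.instance Definition _ l := @isMeasurableFun.Build _ _ _ _ (reflection l)
  (measurable_reflection l).

Lemma reflection_itv l : reflection l @^-1` `[0, l] = `[0, l]%classic.
Proof.
rewrite /reflection; apply/seteqP.
by split => x /=; rewrite !in_itv /= => /andP[? ?]; apply/andP; split; lra.
Qed.

(** A half-open interval has a preimage of the same length, and the values on such intervals
    determine the measure. *)
Lemma lebesgue_measure_reflection l (A : set R) : measurable A ->
  pushforward mu (reflection l) A = mu A.
Proof.
move=> mA; apply/esym/lebesgue_measure_unique => //= _ [[a b]] _ <-.
rewrite /pushforward.
have -> : reflection l @^-1` `]a, b]%classic = `[l - b, l - a[%classic.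
  rewrite /reflection; apply/seteqP.
  by split => x /=; rewrite !in_itv /= => /andP[? ?]; apply/andP; split; lra.
rewrite !lebesgue_measure_itv /= !lte_fin.
have -> : (l - b < l - a) = (a < b) by rewrite ltrD2l ltrN2.
by case: ifP => // _; congr EFin; ring.
Qed.

Lemma aae_reflection l (P : R -> Prop) : aae 0 l P -> aae 0 l (fun x => P (l - x)).
Proof.
move=> [N [mN N0 NP]]; exists (reflection l @^-1` N); split.
- rewrite -[_ @^-1` _]setTI; exact: measurable_reflection.
- by rewrite -N0; exact: lebesgue_measure_reflection.
move=> x /= h; apply: NP => /= h'; apply: h => /andP[x0 xl]; apply: h'.
by apply/andP; rewrite /reflection; split; lra.
Qed.

Lemma integ_reflection l f : integ 0 l f -> integ 0 l (fun x => f (l - x)).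
Proof.
move=> /integrableP[/measurable_EFinP mf fy]; apply/integrableP; split.
  apply/measurable_EFinP.
  apply: (@measurable_comp _ _ _ _ _ _ `[0, l]%classic f _ (reflection l)) => //.
    move=> _ [x /= + <-]; rewrite !in_itv /= /reflection => /andP[? ?].
    by apply/andP; split; lra.
  exact: (measurable_funS measurableT (@subsetT _ _) (measurable_reflection l)).
have mI : measurable (`[0, l]%classic : set (measurableTypeR R)) by exact: measurable_itv.
have mf' : measurable_fun `[0, l]%classic (fun x : measurableTypeR R => `|(f x)%:E|%E).
  by apply: measurableT_comp => //; exact/measurable_EFinP.
have E1 := @ge0_integral_pushforward _ _ _ _ R (reflection l) (measurable_reflection l)
  mu `[0, l]%classic _ mI mf' (fun y _ => abse_ge0 _).
rewrite reflection_itv in E1.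
have E2 := @eq_measure_integral _ (measurableTypeR R) R `[0, l]%classic mu (pushforward mu (reflection l))
  (fun x => `|(f x)%:E|%E) (fun A mA _ => lebesgue_measure_reflection l mA).
have E : (\int[mu]_(x in `[0%R, l]) `|(EFin \o (fun x0 => f (l - x0)%R)) x| =
    \int[mu]_(x in `[0%R, l]) `|(EFin \o f) x|)%E.
  exact: (etrans (esym E1) (E2 (measurable_reflection l))).
by rewrite E.
Qed.

Lemma absolutely_continuous_reflection l F : absolutely_continuous 0 l F ->
  absolutely_continuous 0 l (fun x => F (l - x)).
Proof.
move=> acF e e0; have [d d0 H] := acF e e0; exists d => // n s t h1 h2 h3.
under eq_bigr do rewrite distrC.
apply: (H n (fun i => l - t i) (fun i => l - s i)).
- by move=> i; have [? ? ?] := h1 i; split; lra.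
- move=> i j _ _ [x [/=]]; rewrite !in_itv /= => /andP[? ?] /andP[? ?]; apply: h2 => //.
  by exists (l - x); split; rewrite /= in_itv /=; apply/andP; split; lra.
- by under eq_bigr do rewrite opprB addrC addrA subrK.
Qed.

Lemma acd_reflection l F f : acd 0 l F f ->
  acd 0 l (fun x => F (l - x)) (fun x => - f (l - x)).
Proof.
move=> [/absolutely_continuous_reflection acF /aae_reflection dF]; split => //.
apply: aae_imply dF _ => x xl h.
have h' : is_derive x 1 (fun y : R => l - y) (-1).
  apply: (is_derive_eq (is_deriveB (is_derive_cst l x 1) (is_derive_id x 1))); ring.
by have := @is_derive1_comp R F (fun y => l - y) x _ _ h h'; rewrite mulrN1.
Qed.

End Reflection.

(** * Picard series as a power series in the spectral parameter *)

Section Iteration.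
Context {R : realType}.
Implicit Types (F G f g q : R -> R) (l x y : R).

Lemma acd_eqF a c F G f : (forall x, a <= x <= c -> F x = G x) -> acd a c F f -> acd a c G f.
Proof.
move=> FG [acF dF]; split.
  move=> e e0; have [d d0 H] := acF e e0; exists d => // n s t h1 h2 h3.
  apply: le_lt_trans (H n s t h1 h2 h3); rewrite le_eqVlt; apply/orP; left; apply/eqP.
  apply: eq_bigr => i _; have [k1 k2 k3] := h1 i.
  by rewrite !FG // ?k1 ?k3 ?andbT //= (le_trans k1, le_trans k2).
apply: aae_imply dF _ => x /andP[ax xc]; apply: near_eq_is_derive; near=> y.
apply: FG; apply/andP; split; apply: ltW; near: y; [exact: lt_nbhsr|exact: lt_nbhsl].
Unshelve. all: by end_near. Qed.

(* At a fixed point the absolute values are realised by fixed signs, so the sum is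
   the value of one absolutely continuous function. *)
Lemma acd_sum_norm_le n a c (F f : 'I_n -> R -> R) (w : 'I_n -> R) G g : a <= c ->
  (forall i, acd a c (F i) (f i)) -> acd a c G g -> (forall i, 0 <= w i) ->
  \sum_(i < n) w i * `|F i a| <= G a ->
  aae a c (fun x => \sum_(i < n) w i * `|f i x| <= g x) ->
  \sum_(i < n) w i * `|F i c| <= G c.
Proof.
move=> ac hF hG w0 h0 hfg.
pose s i := Num.sg (F i c); pose S x := \sum_(i < n) w i * s i * F i x.
have hS : acd a c (fun x => S x - G x) (fun x => \sum_(i < n) w i * s i * f i x - g x).
  by apply: acdB hG; apply: acd_sum => i; exact: acdZ.
have Sc : S c = \sum_(i < n) w i * `|F i c|.
  by apply: eq_bigr => i _; rewrite -mulrA -normrEsg.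
have sle i y : w i * s i * y <= w i * `|y|.
  rewrite -mulrA ler_wpM2l // (le_trans (ler_norm _)) // normrM ler_piMl //.
  by rewrite normr_sg; case: (_ != _).
have Sa : S a <= G a by apply: le_trans h0; apply: ler_sum => i _; exact: sle.
suff : S c - G c <= S a - G a by rewrite Sc; lra.
apply: acd_le hS _ => //; apply: aae_imply hfg _ => x _; rewrite subr_le0; apply: le_trans.
by apply: ler_sum => i _; exact: sle.
Qed.

Lemma acd_norm_le a c F f G g : a <= c -> acd a c F f -> acd a c G g -> `|F a| <= G a ->
  aae a c (fun x => `|f x| <= g x) -> `|F c| <= G c.
Proof.
move=> ac hF hG h0 hfg.
have := @acd_sum_norm_le 1 a c (fun=> F) (fun=> f) (fun=> 1) G g ac (fun=> hF) hG.
rewrite !big_ord1 !mul1r; apply => //.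
by apply: aae_imply hfg _ => x _; rewrite big_ord1 mul1r.
Qed.

(* Expansion of the solution of [u'' = (q - lam) u], [u 0 = 0], [u' 0 = 1]: the [n]-th
   Picard iterate is a polynomial in [lam], and [cf q n i] is its coefficient of degree [i]. *)
Fixpoint cf q (n i : nat) : R -> R :=
  if n is n'.+1 then
    prim 0 (prim 0 (fun x => q x * cf q n' i x - if i is j.+1 then cf q n' j x else 0))
  else fun x => if i == 0%N then x else 0.

Definition rhs_cf q n i x : R := q x * cf q n i x - if i is j.+1 then cf q n j x else 0.

Definition dcf q (n i : nat) : R -> R :=
  if n is n'.+1 then prim 0 (rhs_cf q n' i) else fun=> (i == 0%N)%:R.

Lemma cfS q n i : cf q n.+1 i = prim 0 (dcf q n.+1 i).
Proof. by []. Qed.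

Section Coefficients.
Context q l (l0 : 0 < l) (intq : integ 0 l q).

Lemma integ_rhs_cf n i : (forall j, {within `[0, l], continuous (cf q n j)}) ->
  integ 0 l (rhs_cf q n i).
Proof.
move=> cc; apply: integB; first exact: integM_within.
by case: i => [|j]; [exact: integ_cst|exact: integ_within].
Qed.

Lemma cf_within n i : {within `[0, l], continuous (cf q n i)}.
Proof.
elim: n i => [|n IH] i /=.
  by case: i => [|i] /=; apply: continuous_subspaceT => x; [exact: id|exact: cst_continuous].
apply: (@acd_within R); apply: acd_prim; apply: integ_within.
apply: (@acd_within R); apply: acd_prim; exact: integ_rhs_cf.
Qed.

Lemma acd_dcf n i : acd 0 l (dcf q n.+1 i) (rhs_cf q n i).
Proof. by apply: acd_prim; apply: integ_rhs_cf => j; exact: cf_within. Qed.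

Lemma acd_cf n i : acd 0 l (cf q n i) (dcf q n i).
Proof.
case: n => [|n]; last by rewrite cfS; apply: acd_prim; apply: integ_within; exact: acd_within (acd_dcf n i).
by case: i => [|i]; [exact: acd_id|exact: acd_cst].
Qed.

End Coefficients.

Lemma prim_cst0 a x : prim a (fun=> 0 : R) x = 0.
Proof. by rewrite /prim Rintegral_cst // mul0r. Qed.

Lemma cf_gt q n i : (n < i)%N -> cf q n i = fun=> 0.
Proof.
elim: n i => [|n IH] [|i] // ni.
rewrite cfS /= (_ : rhs_cf _ _ _ = fun=> 0); last first.
  by apply/funext => x; rewrite /rhs_cf !IH ?mulr0 ?subrr // ltnW.
have -> : prim 0 (fun=> 0 : R) = fun=> 0 by apply/funext => y; exact: prim_cst0.
by apply/funext => y; exact: prim_cst0.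
Qed.

Lemma cf0 q n i : cf q n i 0 = 0.
Proof. by case: n => [|n]; [case: i|rewrite cfS prim0]. Qed.

Lemma dcf0 q n i : dcf q n i 0 = ((n == 0%N) && (i == 0%N))%:R.
Proof. by case: n => [|n] //=; rewrite prim0. Qed.


Lemma half_expn_ge0 n : 0 <= 2^-1 ^+ n :> R.
Proof. by rewrite exprn_ge0 // invr_ge0. Qed.

Section Smallness.
Context q l (l0 : 0 < l) (intq : integ 0 l q) (rho : R) (rho0 : 0 <= rho).

(** A Bielecki weight. One Picard step multiplies by [|q| + rho] and integrates twice, the outer
    integration costing at most [l]; the factor [2 * l] in the exponent makes each step a
    contraction by [1/2]. *)
Definition growth_weight x := expR (2 * l * prim 0 (fun y => `|q y| + rho) x).

Lemma acd_growth_weight : acd 0 l growth_weight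
  (fun x => growth_weight x * (2 * l * (`|q x| + rho))).
Proof.
apply: acd_expR; apply: acdZ; apply: acd_prim; apply: integD; last exact: integ_cst.
exact: integ_norm.
Qed.

Lemma growth_weight_le x y : 0 <= x -> x <= y -> y <= l -> growth_weight x <= growth_weight y.
Proof.
move=> x0 xy yl; rewrite -lerN2.
apply: (acd_le xy (acdN (acd_sub x0 yl acd_growth_weight))); apply: aaeW => z _.
rewrite oppr_le0 mulr_ge0 ?expR_ge0 // mulr_ge0 // ?addr_ge0 //; lra.
Qed.

Lemma growth_weight0 : growth_weight 0 = 1.
Proof. by rewrite /growth_weight prim0 mulr0 expR0. Qed.

(** The weighted sum of the coefficients bounds the series for all [|lam| <= rho] at once. The two
    bounds feed each other: [cf] is integrated from [dcf] of the same index, and [dcf] from [cf] of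
    the previous one. *)
Lemma sum_cf_le n :
  (forall x, 0 <= x <= l -> \sum_(i < n.+1) rho ^+ i * `|dcf q n i x| <=
     2^-1 ^+ n * growth_weight x) /\
  (forall x, 0 <= x <= l -> \sum_(i < n.+1) rho ^+ i * `|cf q n i x| <=
     l * (2^-1 ^+ n * growth_weight x)).
Proof.
have step m : (forall x, 0 <= x <= l -> \sum_(i < m.+1) rho ^+ i * `|dcf q m i x| <=
     2^-1 ^+ m * growth_weight x) ->
    forall x, 0 <= x <= l -> \sum_(i < m.+1) rho ^+ i * `|cf q m i x| <=
     l * (2^-1 ^+ m * growth_weight x).
  move=> h x /andP[x0 xl].
  have w0 : 0 <= 2^-1 ^+ m * growth_weight x by rewrite mulr_ge0 ?half_expn_ge0 ?expR_ge0.
  apply: (@le_trans _ _ (x * (2^-1 ^+ m * growth_weight x))); last by rewrite ler_wpM2r.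
  have hG : acd 0 x (fun y => y * (2^-1 ^+ m * growth_weight x))
      (fun y => 2^-1 ^+ m * growth_weight x).
    by apply: acd_eq (acdM (acd_id 0 x) (acd_cst 0 x _)) _ => y _; rewrite mul1r mulr0 addr0.
  apply: (acd_sum_norm_le x0 (fun i => acd_sub (lexx 0) xl (acd_cf intq m i)) hG).
  - by move=> i; exact: exprn_ge0.
  - by rewrite mul0r big1 // => i _; rewrite cf0 normr0 mulr0.
  - apply: aaeW => y /andP[y0 yx]; have yl : 0 <= y <= l by rewrite (ltW y0) (le_trans (ltW yx) xl).
    apply: le_trans (h y yl) _.
    by rewrite ler_wpM2l ?half_expn_ge0 // (growth_weight_le (ltW y0) (ltW yx) xl).
elim: n => [|n [_ IH]].
  have h0 x : 0 <= x <= l -> \sum_(i < 1) rho ^+ i * `|dcf q 0 i x| <=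
     2^-1 ^+ 0 * growth_weight x.
    move=> /andP[x0 xl]; rewrite big_ord1 /= !expr0 !mul1r normr1 -growth_weight0.
    exact: growth_weight_le.
  by split => //; exact: step.
suff h : forall x, 0 <= x <= l -> \sum_(i < n.+2) rho ^+ i * `|dcf q n.+1 i x| <=
     2^-1 ^+ n.+1 * growth_weight x by split => //; exact: step.
move=> x /andP[x0 xl].
apply: (acd_sum_norm_le x0 (fun i => acd_sub (lexx 0) xl (acd_dcf intq n i))
  (acd_sub (lexx 0) xl (acdZ (2^-1 ^+ n.+1) acd_growth_weight))).
- by move=> i; exact: exprn_ge0.
- rewrite big1 => [|i _]; first by rewrite mulr_ge0 ?half_expn_ge0 ?expR_ge0.
  by rewrite dcf0 normr0 mulr0.
apply: aaeW => y /andP[y0 yx].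
have yl : 0 <= y <= l by rewrite (ltW y0) (le_trans (ltW yx) xl).
(* Multiplying by [q] keeps the degree of a coefficient; multiplying by [lam] raises it by one,
   which costs a factor [rho]. *)
apply: (@le_trans _ _ ((`|q y| + rho) * \sum_(i < n.+1) rho ^+ i * `|cf q n i y|)).
  rewrite mulrDl {1}[\sum_(i < n.+1) _ in X in _ <= X + _](_ : _ =
    \sum_(i < n.+2) rho ^+ i * `|cf q n i y|); last first.
    by rewrite [RHS]big_ord_recr /= cf_gt //= normr0 mulr0 addr0.
  rewrite !mulr_sumr [X in _ <= _ + X](_ : _ =
    \sum_(i < n.+2) rho ^+ i * `|if (i : nat) is j.+1 then cf q n j y else 0|); last first.
    rewrite [RHS]big_ord_recl /= normr0 mulr0 add0r; apply: eq_bigr => i _.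
    by rewrite exprS mulrA.
  rewrite -big_split /=; apply: ler_sum => i _.
  rewrite /rhs_cf mulrCA -normrM -mulrDr ler_wpM2l ?exprn_ge0 //.
  exact: ler_normB.
have -> : 2^-1 ^+ n.+1 * (growth_weight y * (2 * l * (`|q y| + rho))) =
    (`|q y| + rho) * (l * (2^-1 ^+ n * growth_weight y)).
  by rewrite exprS; field.
by rewrite ler_wpM2l ?addr_ge0 // IH.
Qed.

End Smallness.

(** The sequence [re] stands for the powers of the spectral parameter: [lam ^+ i] at a real point,
    the real or the imaginary parts of the powers at a complex one. The analysis thus stays over the
    reals. *)
Definition level (F : nat -> R -> R) (re : nat -> R) n x := \sum_(i < n.+1) re i * F i x.

Section Levels.
Context q l (l0 : 0 < l) (intq : integ 0 l q).
Implicit Types (re : nat -> R).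

Lemma acd_level re n : acd 0 l (level (cf q n) re n) (level (dcf q n) re n).
Proof. by apply: acd_sum => i; apply: acdZ; exact: acd_cf. Qed.

(** Shifting [re] by one index is multiplication by the spectral parameter. *)
Lemma acd_dlevel re n : acd 0 l (level (dcf q n.+1) re n.+1)
  (fun x => q x * level (cf q n) re n x - level (cf q n) (fun i => re i.+1) n x).
Proof.
apply: acd_eq (acd_sum (fun i : 'I_n.+2 => acdZ (re i) (acd_dcf intq n i))) _ => x _.
rewrite /rhs_cf /level; under eq_bigr do rewrite mulrBr mulrCA.
rewrite sumrB -mulr_sumr big_ord_recr /= [in LHS]cf_gt // mulr0 addr0; congr (_ - _).
by rewrite big_ord_recl /= mulr0 add0r.
Qed.

Lemma level_small rho : 0 <= rho -> exists2 C : R, 0 < C & forall re n x,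
  (forall i, `|re i| <= rho ^+ i) -> 0 <= x <= l ->
  `|level (cf q n) re n x| <= C * 2^-1 ^+ n.
Proof.
move=> rho0; exists (l * growth_weight q l rho l); first by rewrite mulr_gt0 ?expR_gt0.
move=> re n x hre xl; apply: le_trans (ler_norm_sum _ _ _) _.
apply: (@le_trans _ _ (\sum_(i < n.+1) rho ^+ i * `|cf q n i x|)).
  by apply: ler_sum => i _; rewrite normrM ler_wpM2r.
have [_ /(_ x xl) h] := sum_cf_le intq rho0 n; apply: le_trans h _.
rewrite -mulrA ler_wpM2l ?(ltW l0) // mulrC ler_wpM2r ?half_expn_ge0 //.
by case/andP: xl => x0 xl; apply: growth_weight_le.
Qed.

Lemma level0 re n : level (cf q n) re n 0 = 0.
Proof. by apply: big1 => i _; rewrite cf0 mulr0. Qed.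

Lemma dlevel0 re n : level (dcf q n) re n 0 = if n is 0%N then re 0%N else 0.
Proof.
case: n => [|n]; first by rewrite /level big_ord1 /= mulr1.
by apply: big1 => i _; rewrite dcf0 mulr0.
Qed.

Definition apx re n x := \sum_(k < n) level (cf q k) re k x.
Definition dapx re n x := \sum_(k < n) level (dcf q k) re k x.

Lemma acd_apx re n : acd 0 l (apx re n) (dapx re n).
Proof. by apply: acd_sum => i; exact: acd_level. Qed.

(** The index drops from [n.+1] to [n]: a partial sum solves the equation up to its top term, which
    becomes the residual in the growth estimates. *)
Lemma acd_dapx re n : acd 0 l (dapx re n.+1)
  (fun x => q x * apx re n x - apx (fun i => re i.+1) n x).
Proof.
elim: n => [|n IH].
  have E x : 0 <= x <= l -> re 0%N = dapx re 1 x.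
    by rewrite /dapx big_ord1 /level big_ord1 /= mulr1.
  apply: acd_eqF E _; apply: acd_eq (acd_cst 0 l _) _ => x _.
  by rewrite /apx !big_ord0 mulr0 subrr.
apply: (@acd_eqF _ _ (fun x => dapx re n.+1 x + level (dcf q n.+1) re n.+1 x)).
  by move=> x _; rewrite [RHS]/dapx big_ord_recr.
apply: acd_eq (acdD IH (acd_dlevel re n)) _ => x _.
by rewrite /apx !big_ord_recr /=; ring.
Qed.

Lemma apx0 re n : apx re n 0 = 0.
Proof. by apply: big1 => i _; exact: level0. Qed.

Lemma dapx0 re n : dapx re n.+1 0 = re 0%N.
Proof.
by rewrite /dapx big_ord_recl /= dlevel0 big1 ?addr0 // => i _; rewrite dlevel0.
Qed.

End Levels.

End Iteration.

(** * Existence and uniqueness for the initial value problem *)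

Section CauchySolution.
Context {R : realType}.
Implicit Types (F G f g q u v : R -> R) (l x y lam : R).

Lemma half_expn_small (K e : R) : 0 < e -> \forall n \near \oo, K * 2^-1 ^+ n <= e.
Proof.
move=> e0; have : (fun n => K * 2^-1 ^+ n) @ \oo --> (0 : R).
  rewrite -(mulr0 K); apply: cvgMl_tmp; apply: cvg_expr.
  by rewrite ger0_norm ?invr_ge0 // invf_lt1 // ltr1n.
move=> /cvgrPdist_le /(_ e e0); apply: filterS => n; rewrite sub0r normrN.
exact: le_trans (ler_norm _).
Qed.

Lemma geometric_series_tail (a : nat -> R) (C : R) : 0 <= C ->
  (forall n, `|a n| <= C * 2^-1 ^+ n) ->
  forall n, `|lim ((fun m => \sum_(k < m) a k) @ \oo) - \sum_(k < n) a k| <= 2 * C * 2^-1 ^+ n.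
Proof.
move=> C0 ha n; pose S m := \sum_(k < m) a k.
have key m d : `|S (m + d)%N - S m| <= 2 * C * (2^-1 ^+ m - 2^-1 ^+ (m + d)%N).
  elim: d => [|d IH]; first by rewrite addn0 !subrr normr0 mulr0.
  rewrite addnS /S big_ord_recr /= -/(S (m + d)%N) addrAC exprS.
  apply: le_trans (ler_normD _ _) _.
  by have := ha (m + d)%N; move: IH; lra.
have key2 m d : `|S (m + d)%N - S m| <= 2 * C * 2^-1 ^+ m.
  apply: le_trans (key m d) _; rewrite ler_wpM2l ?mulr_ge0 //.
  by have := half_expn_ge0 (R := R) (m + d)%N; lra.
have cS : cvgn S.
  apply: cauchy_cvg; apply/cauchy_exP => e e0.
  have [m _ Hm] := @half_expn_small (2 * C) (e / 2) (divr_gt0 e0 (ltr0Sn _ 1)).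
  exists (S m); exists m => // j /= mj; rewrite /ball /= distrC -(subnKC mj).
  apply: le_lt_trans (key2 _ _) _; apply: le_lt_trans (Hm m (leqnn m)) _; lra.
apply/ler_addgt0Pr => e e0.
have [m _ Hm] := (iffLR (cvgrPdist_le _ _) cS) e e0.
have := Hm (m + n)%N (leq_addr _ _); have := key2 n m; rewrite addnC => h1 h2.
have := ler_distD (S (m + n)%N) (lim (S @ \oo)) (S n); lra.
Qed.

Definition phi q lam x : R := lim ((fun n => apx q (fun i => lam ^+ i) n x) @ \oo).

(** Defined by integrating the equation rather than as a limit, so the second-order part holds by
    construction; what has to be proved is that this is the derivative of [phi]. *)
Definition dphi q lam x : R := 1 + prim 0 (fun y => (q y - lam) * phi q lam y) x.

Lemma phi_approx q l rho : 0 < l -> integ 0 l q -> 0 <= rho ->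
  exists2 C : R, 0 < C & forall lam n x, `|lam| <= rho -> 0 <= x <= l ->
    `|phi q lam x - apx q (fun i => lam ^+ i) n x| <= C * 2^-1 ^+ n.
Proof.
move=> l0 intq rho0; have [C C0 HC] := level_small l0 intq rho0.
exists (2 * C); first by rewrite mulr_gt0.
move=> lam n x hlam xl.
apply: (@geometric_series_tail (fun k => level (cf q k) (fun i => lam ^+ i) k x) C (ltW C0)).
by move=> k; apply: HC => // i; rewrite normrX lerXn2r ?nnegrE.
Qed.

Lemma phi_within q l lam : 0 < l -> integ 0 l q -> {within `[0, l], continuous (phi q lam)}.
Proof.
move=> l0 intq; have [C C0 HC] := phi_approx l0 intq (normr_ge0 lam).
apply/subspace_continuousP => x /= xl; apply/cvgrPdist_lt => e e0.
have e4 : 0 < e / 4 by rewrite divr_gt0.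
have [n _ Hn] := @half_expn_small C (e / 4) e4.
have /subspace_continuousP /(_ x xl) /cvgrPdist_lt /(_ _ e4) :=
  acd_within (acd_apx intq (fun i => lam ^+ i) n).
have xl' : 0 <= x <= l by move: xl; rewrite in_itv.
move=> [d /= d0 Hd]; exists d => // y /= xy yl; have hy := Hd y xy yl.
have yl' : 0 <= y <= l by move: yl; rewrite in_itv.
have := HC lam n x (lexx _) xl'; have := HC lam n y (lexx _) yl'; have := Hn n (leqnn n).
move=> h1 h2 h3.
have := ler_distD (apx q (fun i => lam ^+ i) n x) (phi q lam x) (phi q lam y).
have := ler_distD (apx q (fun i => lam ^+ i) n y) (apx q (fun i => lam ^+ i) n x) (phi q lam y).
move: hy h2; rewrite [`|phi q lam y - _|]distrC => hy h2; lra.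
Qed.

Definition csol q lam l u v := acd 0 l u v /\ acd 0 l v (fun x => (q x - lam) * u x).

Lemma integ_potential q l lam u : integ 0 l q -> {within `[0, l], continuous u} ->
  integ 0 l (fun x => (q x - lam) * u x).
Proof. by move=> intq cu; apply: integM_within => //; apply: integB => //; exact: integ_cst. Qed.

Lemma acd_dphi q l lam : 0 < l -> integ 0 l q ->
  acd 0 l (dphi q lam) (fun x => (q x - lam) * phi q lam x).
Proof.
move=> l0 intq.
have h := acd_prim (integ_potential lam intq (@phi_within q l lam l0 intq)).
by apply: (acd_eq (acdD (acd_cst 0 l 1) h)) => x _; rewrite add0r.
Qed.

(** The derivatives of [dphi] and of the approximant differ by [q - lam] times the error of [apx],
    already bounded; integration gives the estimate. *)
Lemma dphi_approx q l rho : 0 < l -> integ 0 l q -> 0 <= rho ->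
  exists2 C : R, 0 < C & forall lam n x, `|lam| <= rho -> 0 <= x <= l ->
    `|dphi q lam x - dapx q (fun i => lam ^+ i) n.+1 x| <= C * 2^-1 ^+ n.
Proof.
move=> l0 intq rho0; have [C C0 HC] := phi_approx l0 intq rho0.
pose g y := `|q y| + rho.
have intg : integ 0 l g by apply: integD (integ_norm intq) (integ_cst _ _ _).
have hg := acd_prim intg.
have g0 y : 0 <= g y by rewrite addr_ge0.
have primg x : 0 <= x <= l -> prim 0 g x <= prim 0 g l.
  move=> /andP[x0 xl]; rewrite -lerN2; apply: (acd_le xl (acdN (acd_sub x0 (lexx l) hg))).
  by apply: aaeW => y _; rewrite oppr_le0.
exists (C * (1 + prim 0 g l)).
  by rewrite mulr_gt0 // ltr_pwDl //; have := primg 0; rewrite prim0 lexx (ltW l0); apply.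
move=> lam n x hlam xl; have /andP[x0 xl'] := xl.
have hd := acd_sub (lexx 0) xl'
  (acdB (@acd_dphi q l lam l0 intq) (acd_dapx intq (fun i => lam ^+ i) n)).
have := acd_norm_le x0 hd (acd_sub (lexx 0) xl' (acdZ (C * 2^-1 ^+ n) hg)).
rewrite /= {1}/dphi !prim0 addr0 dapx0 expr0 subrr normr0 mulr0 lexx => /(_ isT) h.
apply: le_trans (h _) _; last first.
  rewrite [leRHS]mulrAC ler_wpM2l //.
    by rewrite mulr_ge0 ?half_expn_ge0 // ltW.
  by have := primg x xl; lra.
apply: aaeW => y /andP[y0 yx].
have yl : 0 <= y <= l by rewrite (ltW y0) (le_trans (ltW yx) xl').
have -> : apx q (fun i => lam ^+ i.+1) n y = lam * apx q (fun i => lam ^+ i) n y.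
  rewrite /apx mulr_sumr; apply: eq_bigr => k _; rewrite /level mulr_sumr.
  by apply: eq_bigr => i _; rewrite exprS mulrA.
rewrite (_ : _ - _ = (q y - lam) * (phi q lam y - apx q (fun i => lam ^+ i) n y)); last by ring.
rewrite normrM mulrC ler_pM // ?HC // (le_trans (ler_normB _ _)) // lerD2l //.
Qed.

Lemma half_expn_eq0 (C y : R) : (forall n, `|y| <= C * 2^-1 ^+ n) -> y = 0.
Proof.
move=> h; apply/eqP; rewrite -normr_le0; apply/ler_addgt0Pl => e e0; rewrite addr0.
by have [n _ Hn] := half_expn_small C e0; apply: le_trans (h n) (Hn n (leqnn n)).
Qed.

(** [phi] and the primitive of [dphi] are limits of the same approximants, hence equal. *)
Lemma acd_phi q l lam : 0 < l -> integ 0 l q -> acd 0 l (phi q lam) (dphi q lam).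
Proof.
move=> l0 intq; have hd := acd_within (@acd_dphi q l lam l0 intq).
have [C C0 HC] := phi_approx l0 intq (normr_ge0 lam).
have [D D0 HD] := dphi_approx l0 intq (normr_ge0 lam).
apply: acd_eqF (acd_prim (integ_within hd)) => x xl; have /andP[x0 xl'] := xl.
apply/eqP; rewrite -subr_eq0; apply/eqP; apply: (@half_expn_eq0 (C + D * x)) => n.
have hP := acd_sub (lexx 0) xl' (acdB (acd_prim (integ_within hd))
  (acd_apx intq (fun i => lam ^+ i) n.+1)).
have hG : acd 0 x (fun y => D * 2^-1 ^+ n * y) (fun=> D * 2^-1 ^+ n).
  by apply: acd_eq (acdZ _ (acd_id 0 x)) _ => y _; rewrite mulr1.
have := acd_norm_le x0 hP hG; rewrite /= prim0 apx0 subrr normr0 mulr0 lexx => /(_ isT) h.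
have {}h : `|prim 0 (dphi q lam) x - apx q (fun i => lam ^+ i) n.+1 x| <= D * 2^-1 ^+ n * x.
  apply: h; apply: aaeW => y /andP[y0 yx]; apply: HD => //.
  by rewrite (ltW y0) (le_trans (ltW yx) xl').
have := HC lam n.+1 x (lexx _) xl; rewrite exprS distrC => h2.
have h3 : 0 <= C * 2^-1 ^+ n by rewrite mulr_ge0 ?half_expn_ge0 ?(ltW C0).
have := ler_distD (apx q (fun i => lam ^+ i) n.+1 x) (prim 0 (dphi q lam) x) (phi q lam x).
lra.
Qed.

Lemma csol_phi q l lam : 0 < l -> integ 0 l q -> csol q lam l (phi q lam) (dphi q lam).
Proof. by move=> l0 intq; split; [exact: acd_phi|exact: acd_dphi]. Qed.

Lemma phi0 q lam : phi q lam 0 = 0.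
Proof.
rewrite /phi (_ : (fun n => _) = fun=> 0); last by apply/funext => n; exact: apx0.
exact: lim_cst.
Qed.

Lemma dphi0 q lam : dphi q lam 0 = 1.
Proof. by rewrite /dphi prim0 addr0. Qed.

(** Gronwall's inequality for [u ^ 2 + v ^ 2], whose derivative [2 (1 + q - lam) u v] is at most
    [|q| + 1 + |lam|] times it. *)
Lemma csol_zero q l lam u v : integ 0 l q -> csol q lam l u v -> u 0 = 0 -> v 0 = 0 ->
  forall x, 0 <= x <= l -> u x = 0 /\ v x = 0.
Proof.
move=> intq [hu hv] u0 v0 x /andP[x0 xl].
pose g y := `|q y| + (1 + `|lam|).
have intg : integ 0 l g by apply: integD (integ_norm intq) (integ_cst _ _ _).
have hS := acdD (acdM hu hu) (acdM hv hv).
have := acd_gronwall x0 (acd_sub (lexx 0) xl hS) (acd_sub (lexx 0) xl (acd_prim intg)).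
rewrite /= u0 v0 !mul0r addr0 mul0r => h.
have {}h : (u x * u x + v x * v x) * expR (- prim 0 g x) <= 0.
  apply: h; apply: aaeW => y _; rewrite /g.
  have h1 := ler_norm (q y); have h2 := ler_norm (- q y).
  have h3 := ler_norm lam; have h4 := ler_norm (- lam).
  rewrite !normrN in h2 h4.
  have : (1 + q y - lam) * (2 * (u y * v y)) <= (`|q y| + (1 + `|lam|)) * (u y * u y + v y * v y).
    have k1 : - (u y * u y + v y * v y) <= 2 * (u y * v y) by have := sqr_ge0 (u y + v y); nra.
    have k2 : 2 * (u y * v y) <= u y * u y + v y * v y by have := sqr_ge0 (u y - v y); nra.
    set P := 2 * (u y * v y) in k1 k2 *; set S := u y * u y + v y * v y in k1 k2 *.
    have k3 : `|P| <= S by rewrite ler_norml k1.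
    apply: le_trans (ler_norm _) _; rewrite normrM ler_pM //.
    by rewrite ler_norml; apply/andP; split; lra.
  lra.
have {}h : u x * u x + v x * v x <= 0 by rewrite pmulr_lle0 ?expR_gt0 in h.
by have := sqr_ge0 (u x); have := sqr_ge0 (v x); rewrite !expr2 => *; split; nra.
Qed.

Lemma csol_unique q l lam u v : 0 < l -> integ 0 l q -> csol q lam l u v -> u 0 = 0 ->
  forall x, 0 <= x <= l -> u x = v 0 * phi q lam x /\ v x = v 0 * dphi q lam x.
Proof.
move=> l0 intq [hu hv] u0 x xl; have [hp hdp] := @csol_phi q l lam l0 intq.
have := @csol_zero q l lam (fun x => u x - v 0 * phi q lam x)
  (fun x => v x - v 0 * dphi q lam x) intq.
rewrite phi0 dphi0 u0 mulr0 subrr mulr1 subrr => /(_ _ erefl erefl x xl)/wrap[].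
  split; first by apply: acdB => //; exact: acdZ.
  by apply: acd_eq (acdB hv (acdZ _ hdp)) _ => y _; ring.
by case=> /eqP h1 /eqP h2; split; apply/eqP; rewrite -subr_eq0.
Qed.

End CauchySolution.

(** * Energy estimate at a complex spectral parameter, in real coordinates *)

Section Energy.
Context {R : realType}.
Implicit Types (F G f g q u v : R -> R) (l x y lam : R).

Lemma prim_le l g x y : integ 0 l g -> (forall z, 0 <= g z) -> 0 <= x -> x <= y -> y <= l ->
  prim 0 g x <= prim 0 g y.
Proof.
move=> intg g0 x0 xy yl; rewrite -lerN2.
apply: (acd_le xy (acdN (acd_sub x0 yl (acd_prim intg)))).
by apply: aaeW => z _; rewrite oppr_le0.
Qed.

Lemma prim_ge0 l g x : integ 0 l g -> (forall z, 0 <= g z) -> 0 <= x -> x <= l ->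
  0 <= prim 0 g x.
Proof. by move=> intg g0 x0 xl; rewrite -[leLHS](prim0 0 g); exact: (prim_le intg). Qed.

Definition energy (k u1 u2 v1 v2 : R) := v1 * v1 + v2 * v2 + k * (u1 * u1 + u2 * u2).

Lemma normr_mul_le (y z S : R) : 2 * z <= S -> - S <= 2 * z -> 2 * (y * z) <= `|y| * S.
Proof.
move=> h1 h2; rewrite mulrCA; apply: le_trans (ler_norm _) _; rewrite normrM ler_wpM2l //.
by rewrite ler_norml h2.
Qed.

(** Here [sqrt lam = w + i s], and the energy is [|v|^2 + |lam| |u|^2] for [u'' = (q - lam) u + f].
    The weight [|lam|] cancels the terms of order [|lam|] up to [4 s (s P + w Q)], at most [2 |s|]
    times the energy. So only the imaginary part of [sqrt lam] contributes to the growth rate, which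
    gives the sharp exponential type. *)
Lemma energy_derive_le (u1 u2 v1 v2 q w s f1 f2 g M : R) :
  1 <= w ^+ 2 + s ^+ 2 -> 0 <= g -> `|f1| <= g * M -> `|f2| <= g * M ->
  2 * v1 * (q * u1 - ((w ^+ 2 - s ^+ 2) * u1 - 2 * w * s * u2) + f1) +
  2 * v2 * (q * u2 - ((w ^+ 2 - s ^+ 2) * u2 + 2 * w * s * u1) + f2) +
  2 * (w ^+ 2 + s ^+ 2) * (u1 * v1 + u2 * v2) <=
  (2 * `|s| + `|q| + g) * energy (w ^+ 2 + s ^+ 2) u1 u2 v1 v2 + 2 * g * M ^+ 2.
Proof.
move=> k1 g0 hf1 hf2; set k := w ^+ 2 + s ^+ 2 in k1 *.
set S := energy k u1 u2 v1 v2.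
pose P := u1 * v1 + u2 * v2; pose Q := u2 * v1 - u1 * v2.
have hS : v1 * v1 + v2 * v2 + (u1 * u1 + u2 * u2) <= S.
  rewrite /S /energy lerD2l ler_peMl //.
  by have := sqr_ge0 u1; have := sqr_ge0 u2; rewrite !expr2; lra.
have a : 2 * (q * P) <= `|q| * S.
  apply: normr_mul_le; have := sqr_ge0 (v1 + u1); have := sqr_ge0 (v2 + u2);
  have := sqr_ge0 (v1 - u1); have := sqr_ge0 (v2 - u2); rewrite /P; nra.
have b : 2 * (s * (s * P + w * Q)) <= `|s| * S.
  apply: normr_mul_le.
    have := sqr_ge0 (v1 - s * u1 - w * u2); have := sqr_ge0 (v2 - s * u2 + w * u1).
    rewrite /S /energy /k /P /Q; nra.
  have := sqr_ge0 (v1 + s * u1 + w * u2); have := sqr_ge0 (v2 + s * u2 - w * u1).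
  rewrite /S /energy /k /P /Q; nra.
have c (v f : R) : `|f| <= g * M -> 2 * v * f <= g * (v * v) + g * M ^+ 2.
  move=> hf; apply: (@le_trans _ _ (2 * `|v| * (g * M))).
    rewrite -!mulrA ler_wpM2l //; apply: le_trans (ler_norm _) _.
    by rewrite normrM ler_wpM2l.
  have : 0 <= g * (`|v| - M) ^+ 2 by rewrite mulr_ge0 ?sqr_ge0.
  have -> : v * v = `|v| ^+ 2 by rewrite -normrX ger0_norm ?sqr_ge0.
  by rewrite sqrrB mulrDr; lra.
have c1 := c v1 f1 hf1; have c2 := c v2 f2 hf2.
have d : g * (v1 * v1 + v2 * v2) <= g * S.
  rewrite ler_wpM2l //; apply: le_trans hS; rewrite lerDl.
  by have := sqr_ge0 u1; have := sqr_ge0 u2; rewrite !expr2; lra.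
have -> : 2 * v1 * (q * u1 - ((w ^+ 2 - s ^+ 2) * u1 - 2 * w * s * u2) + f1) +
  2 * v2 * (q * u2 - ((w ^+ 2 - s ^+ 2) * u2 + 2 * w * s * u1) + f2) +
  2 * k * (u1 * v1 + u2 * v2) =
  2 * (q * P) + 2 * (2 * (s * (s * P + w * Q))) + 2 * v1 * f1 + 2 * v2 * f2.
  by rewrite /P /Q /k; ring.
lra.
Qed.

(** The forcing may itself grow like [e^(|s| x)], as it does for the difference of two solutions,
    where it contains one of the solutions; this leaves the exponential rate unchanged. *)
Lemma energy_bound l q g w s m u1 u2 v1 v2 f1 f2 :
  integ 0 l q -> integ 0 l g -> (forall x, 0 <= g x) -> 1 <= w ^+ 2 + s ^+ 2 ->
  acd 0 l u1 v1 -> acd 0 l u2 v2 ->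
  acd 0 l v1 (fun x => q x * u1 x - ((w ^+ 2 - s ^+ 2) * u1 x - 2 * w * s * u2 x) + f1 x) ->
  acd 0 l v2 (fun x => q x * u2 x - ((w ^+ 2 - s ^+ 2) * u2 x + 2 * w * s * u1 x) + f2 x) ->
  aae 0 l (fun x => `|f1 x| <= g x * (m * expR (`|s| * x))) ->
  aae 0 l (fun x => `|f2 x| <= g x * (m * expR (`|s| * x))) ->
  forall x, 0 <= x <= l ->
  energy (w ^+ 2 + s ^+ 2) (u1 x) (u2 x) (v1 x) (v2 x) <=
  expR (2 * `|s| * x) * (expR (prim 0 (fun y => `|q y| + g y) l) *
    (energy (w ^+ 2 + s ^+ 2) (u1 0) (u2 0) (v1 0) (v2 0) + 2 * m ^+ 2 * prim 0 g l)).
Proof.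
move=> intq intg g0 k1 hu1 hu2 hv1 hv2 hf1 hf2 x /andP[x0 xl].
set k := w ^+ 2 + s ^+ 2 in k1 *.
pose S y := energy k (u1 y) (u2 y) (v1 y) (v2 y).
have hS := acdD (acdD (acdM hv1 hv1) (acdM hv2 hv2))
  (acdZ k (acdD (acdM hu1 hu1) (acdM hu2 hu2))).
have intA : integ 0 l (fun y => `|q y| + g y) by apply: integD intg; exact: integ_norm.
have A0 z : 0 <= `|q z| + g z by rewrite addr_ge0.
pose A := prim 0 (fun y => `|q y| + g y).
have hB := acdD (acdZ (2 * `|s|) (acd_id 0 l)) (acd_prim intA).
have hF := acdB (acdM hS (acd_expR (acdN hB))) (acdZ (2 * m ^+ 2) (acd_prim intg)).
have := acd_le x0 (acd_sub (lexx 0) xl hF).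
rewrite /= !(prim0, mulr0, addr0, oppr0, expR0, mulr1) -/A => h.
have {}h : S x * expR (- (2 * `|s| * x + A x)) - 2 * m ^+ 2 * prim 0 g x <= S 0.
  apply: h.
  have [hf1' hf2'] := (aae_sub (lexx 0) xl hf1, aae_sub (lexx 0) xl hf2).
  apply: aae_imply2 hf1' hf2' _ => y /andP[y0 yx] h1 h2.
  have := energy_derive_le (u1 y) (u2 y) (v1 y) (v2 y) (q y) k1 (g0 y) h1 h2.
  rewrite -/k -/(S y); set D := (X in X <= _); set e := expR (- _) => hD.
  have e0 : 0 < e by exact: expR_gt0.
  rewrite (_ : _ - _ = e * (D - (2 * `|s| + `|q y| + g y) * S y) - 2 * m ^+ 2 * g y); last first.
    by rewrite /D /S /energy /k; ring.
  rewrite subr_le0.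
  apply: (@le_trans _ _ (e * (2 * g y * (m * expR (`|s| * y)) ^+ 2))).
    by rewrite ler_wpM2l ?(ltW e0) //; lra.
  rewrite (_ : e * _ = (2 * m ^+ 2 * g y) * (e * expR (`|s| * y) ^+ 2)); last by ring.
  have Ay : 0 <= A y.
    by apply: (prim_ge0 intA) => //; [exact: ltW|exact: le_trans (ltW yx) xl].
  have e1 : e * expR (`|s| * y) ^+ 2 <= 1.
    rewrite /e expr2 -!expRD -[leRHS]expR0 ler_expR -/A.
    by move: Ay; lra.
  by rewrite ler_piMr // mulr_ge0 // mulr_ge0 // sqr_ge0.
have g1 : prim 0 g x <= prim 0 g l by exact: (prim_le intg).
have A1 : A x <= A l by exact: (prim_le intA).
have S0 : 0 <= S 0.
  have k0 : 0 <= k by lra.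
  rewrite /S /energy -!expr2 addr_ge0 // ?addr_ge0 ?sqr_ge0 //.
  by rewrite mulr_ge0 // addr_ge0 ?sqr_ge0.
have {}h : S x * expR (- (2 * `|s| * x + A x)) <= S 0 + 2 * m ^+ 2 * prim 0 g l.
  have : 2 * m ^+ 2 * prim 0 g x <= 2 * m ^+ 2 * prim 0 g l.
    by rewrite ler_wpM2l // mulr_ge0 ?sqr_ge0.
  lra.
rewrite -/(S x) -/(S 0) mulrA -expRD.
apply: (@le_trans _ _ (expR (2 * `|s| * x + A x) * (S 0 + 2 * m ^+ 2 * prim 0 g l))).
  by rewrite mulrC -ler_pdivrMr ?expR_gt0 // -expRN.
have G0 : 0 <= prim 0 g l := prim_ge0 intg g0 (le_trans x0 xl) (lexx l).
rewrite ler_wpM2r ?ler_expR ?lerD2l //.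
by rewrite addr_ge0 // mulr_ge0 // mulr_ge0 // sqr_ge0.
Qed.

(** With [ic], the real and imaginary parts of the powers of [lam = r^2 e^(2it)]. *)
Definition rc (r t : R) i := (r ^+ 2) ^+ i * cos ((2 * t) *+ i).
Definition ic (r t : R) i := (r ^+ 2) ^+ i * sin ((2 * t) *+ i).

Lemma rcS r t i : rc r t i.+1 = r ^+ 2 * cos (2 * t) * rc r t i - r ^+ 2 * sin (2 * t) * ic r t i.
Proof. by rewrite /rc /ic mulrS cosD exprS; ring. Qed.

Lemma icS r t i : ic r t i.+1 = r ^+ 2 * cos (2 * t) * ic r t i + r ^+ 2 * sin (2 * t) * rc r t i.
Proof. by rewrite /rc /ic mulrS sinD exprS; ring. Qed.

Lemma rc_le r t i : `|rc r t i| <= (r ^+ 2) ^+ i.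
Proof.
have h : 0 <= (r ^+ 2) ^+ i by rewrite exprn_ge0 ?sqr_ge0.
by rewrite normrM (ger0_norm h) ler_piMr // cos_max.
Qed.

Lemma ic_le r t i : `|ic r t i| <= (r ^+ 2) ^+ i.
Proof.
have h : 0 <= (r ^+ 2) ^+ i by rewrite exprn_ge0 ?sqr_ge0.
by rewrite normrM (ger0_norm h) ler_piMr // sin_max.
Qed.

End Energy.

(** * Growth of the approximants on circles *)

Section ApproximantGrowth.
Context {R : realType}.
Implicit Types (F G f g q u v re im : R -> R) (l x y lam r t w s : R).

Lemma level_lin (F : nat -> R -> R) (re1 re im : nat -> R) (a b : R) n x :
  (forall i, re1 i = a * re i + b * im i) ->
  level F re1 n x = a * level F re n x + b * level F im n x.
Proof.
move=> h; rewrite /level !mulr_sumr -big_split /=; apply: eq_bigr => i _.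
by rewrite h; ring.
Qed.

Lemma apx_lin q (re1 re im : nat -> R) (a b : R) n x :
  (forall i, re1 i = a * re i + b * im i) ->
  apx q re1 n x = a * apx q re n x + b * apx q im n x.
Proof.
move=> h; rewrite /apx !mulr_sumr -big_split /=; apply: eq_bigr => k _.
exact: level_lin.
Qed.

Lemma cos_double t : cos (2 * t) = cos t ^+ 2 - sin t ^+ 2.
Proof. by rewrite mulr2n mulrDl mul1r cosD !expr2. Qed.

Lemma sin_double t : sin (2 * t) = 2 * cos t * sin t.
Proof. by rewrite mulr2n mulrDl mul1r sinD; ring. Qed.

(** With [ims], the real and imaginary parts of [lam - q] times the top term of the partial sum, the
    defect of the truncated series in the equation. *)
Definition res q r t n x := - (q x * level (cf q n) (rc r t) n x) +
  (r ^+ 2 * cos (2 * t) * level (cf q n) (rc r t) n x -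
   r ^+ 2 * sin (2 * t) * level (cf q n) (ic r t) n x).

Definition ims q r t n x := - (q x * level (cf q n) (ic r t) n x) +
  (r ^+ 2 * cos (2 * t) * level (cf q n) (ic r t) n x +
   r ^+ 2 * sin (2 * t) * level (cf q n) (rc r t) n x).

Section Residual.
Context q l (l0 : 0 < l) (intq : integ 0 l q).

Lemma acd_dapx_re r t n :
  acd 0 l (dapx q (rc r t) n.+1) (fun x => q x * apx q (rc r t) n.+1 x -
    (((r * cos t) ^+ 2 - (r * sin t) ^+ 2) * apx q (rc r t) n.+1 x - 2 * (r * cos t) * (r * sin t) * apx q (ic r t) n.+1 x) +
    res q r t n x).
Proof.
apply: acd_eq (acd_dapx intq (rc r t) n) _ => x _.
rewrite (@apx_lin q (fun i => rc r t i.+1) (rc r t) (ic r t) (r ^+ 2 * cos (2 * t)) (- (r ^+ 2 * sin (2 * t)))).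
  rewrite /res cos_double sin_double /apx !big_ord_recr /=; ring.
by move=> i; rewrite rcS; ring.
Qed.

Lemma acd_dapx_im r t n :
  acd 0 l (dapx q (ic r t) n.+1) (fun x => q x * apx q (ic r t) n.+1 x -
    (((r * cos t) ^+ 2 - (r * sin t) ^+ 2) * apx q (ic r t) n.+1 x + 2 * (r * cos t) * (r * sin t) * apx q (rc r t) n.+1 x) +
    ims q r t n x).
Proof.
apply: acd_eq (acd_dapx intq (ic r t) n) _ => x _.
rewrite (@apx_lin q (fun i => ic r t i.+1) (ic r t) (rc r t) (r ^+ 2 * cos (2 * t)) (r ^+ 2 * sin (2 * t))).
  rewrite /ims cos_double sin_double /apx !big_ord_recr /=; ring.
by move=> i; rewrite icS; ring.
Qed.

(** The bound is uniform in the angle [t] but keeps the factor [|q x| + 1]: [q] is merely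
    integrable, and this factor becomes part of the weight [g] of the energy bound. *)
Lemma residual_small r e : 1 <= r -> 0 < e -> \forall n \near \oo, forall t x, 0 <= x <= l ->
  `|res q r t n x| <= (`|q x| + 1) * e /\ `|ims q r t n x| <= (`|q x| + 1) * e.
Proof.
move=> r1 e0; have [C C0 HC] := level_small l0 intq (sqr_ge0 r).
have := @half_expn_small R (2 * r ^+ 2 * C) e e0; apply: filterS => n hn t x xl.
have r2 : 1 <= r ^+ 2 by rewrite exprn_ege1.
have ha : `|level (cf q n) (rc r t) n x| <= C * 2^-1 ^+ n by apply: HC => // i; exact: rc_le.
have hb : `|level (cf q n) (ic r t) n x| <= C * 2^-1 ^+ n by apply: HC => // i; exact: ic_le.
set D := C * 2^-1 ^+ n in ha hb.
have D0 : 0 <= D by rewrite mulr_ge0 ?half_expn_ge0 ?(ltW C0).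
have De : 2 * r ^+ 2 * D <= e by rewrite /D mulrA.
have key (c1 c2 a b : R) : `|a| <= D -> `|b| <= D -> `|c1| <= 1 -> `|c2| <= 1 ->
    `|- (q x * a) + (r ^+ 2 * c1 * a + r ^+ 2 * c2 * b)| <= (`|q x| + 1) * e.
  move=> aD bD c11 c21.
  have h1 : `|q x * a| <= `|q x| * e.
    rewrite normrM ler_wpM2l // (le_trans aD) //; nra.
  have h2 (c d : R) : `|c| <= 1 -> `|d| <= D -> `|r ^+ 2 * c * d| <= r ^+ 2 * D.
    move=> hc hd; rewrite -mulrA normrM ger0_norm ?sqr_ge0 // ler_wpM2l ?sqr_ge0 //.
    by rewrite normrM -[leRHS]mul1r ler_pM.
  apply: le_trans (ler_normD _ _) _; rewrite normrN mulrDl mul1r lerD //.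
  apply: le_trans (ler_normD _ _) _.
  by have := h2 _ _ c11 aD; have := h2 _ _ c21 bD; lra.
split; rewrite /res /ims.
  have := key (cos (2 * t)) (- sin (2 * t)) _ _ ha hb.
  by rewrite normrN mulrN mulNr; apply; [exact: cos_max|exact: sin_max].
by apply: key => //; [exact: cos_max|exact: sin_max].
Qed.

End Residual.

Lemma cos2Dsin2_scaled r t : (r * cos t) ^+ 2 + (r * sin t) ^+ 2 = r ^+ 2.
Proof. by rewrite !exprMn -mulrDr cos2Dsin2 mulr1. Qed.

Lemma expR_weight_ge1 r t x : 0 <= x -> 1 <= expR (`|r * sin t| * x).
Proof. by move=> x0; rewrite -expR0 ler_expR mulr_ge0. Qed.

(** The constant does not depend on [r]; only the index from which the bound holds does, since a
    partial sum is accurate only on bounded sets of [lam]. The initial energy is [1]. *)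
Lemma apx_growth q l : 0 < l -> integ 0 l q -> exists2 C : R, 1 <= C &
  forall r, 1 <= r -> \forall n \near \oo, forall t x, 0 <= x <= l ->
    energy (r ^+ 2) (apx q (rc r t) n.+1 x) (apx q (ic r t) n.+1 x)
      (dapx q (rc r t) n.+1 x) (dapx q (ic r t) n.+1 x) <=
    C * expR (2 * `|r * sin t| * x).
Proof.
move=> l0 intq; pose g (y : R) : R := `|q y| + 1.
have intg : integ 0 l g by apply: integD (integ_norm intq) (integ_cst _ _ _).
have g0 y : 0 <= g y by rewrite addr_ge0.
have inth : integ 0 l (fun y => `|q y| + g y) by apply: integD intg; exact: integ_norm.
have G0 := prim_ge0 intg g0 (ltW l0) (lexx l).
exists (expR (prim 0 (fun y => `|q y| + g y) l) * (1 + 2 * 1 ^+ 2 * prim 0 g l)).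
  rewrite -[leLHS]mul1r ler_pM //; last by rewrite expr1n lerDl mulr_ge0 // mulr_ge0.
  rewrite -expR0 ler_expR; apply: (prim_ge0 inth) => //; first by move=> z; rewrite addr_ge0.
  exact: ltW.
move=> r r1; have := residual_small l0 intq r1 ltr01; apply: filterS => n hn t x xl.
have := @energy_bound R l q g (r * cos t) (r * sin t) 1 _ _ _ _ _ _ intq intg g0 _
  (acd_apx intq (rc r t) n.+1) (acd_apx intq (ic r t) n.+1)
  (acd_dapx_re intq r t n) (acd_dapx_im intq r t n).
rewrite cos2Dsin2_scaled exprn_ege1 // => /(_ isT) h.
have {}h := h _ _ x xl; apply: le_trans (h _ _) _.
- apply: aaeW => y /andP[y0 yl]; have [|h1 _] := hn t y; first by rewrite !ltW.
  apply: le_trans h1 _; rewrite ler_wpM2l // mul1r; exact: expR_weight_ge1 (ltW y0).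
- apply: aaeW => y /andP[y0 yl]; have [|_ h1] := hn t y; first by rewrite !ltW.
  apply: le_trans h1 _; rewrite ler_wpM2l // mul1r; exact: expR_weight_ge1 (ltW y0).
rewrite mulrC; apply: ler_wpM2r; first exact: expR_ge0.
rewrite {1}/energy !apx0 !dapx0 /rc /ic !mulr0n !expr0 cos0 sin0.
by rewrite !(mulr0, mul0r, mulr1, addr0).
Qed.

(** The difference starts with zero energy and is driven by [(q1 - q2)] times the second solution,
    which is of size [e^(|s| x) / r]. Its energy therefore gains a factor [1 / r^2]; the residuals
    are taken below [1 / r] to match. *)
Lemma apx_growth_diff q1 q2 l : 0 < l -> integ 0 l q1 -> integ 0 l q2 ->
  exists2 C : R, 1 <= C & forall r, 1 <= r -> \forall n \near \oo, forall t x, 0 <= x <= l ->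
    energy (r ^+ 2) (apx q1 (rc r t) n.+1 x - apx q2 (rc r t) n.+1 x)
      (apx q1 (ic r t) n.+1 x - apx q2 (ic r t) n.+1 x)
      (dapx q1 (rc r t) n.+1 x - dapx q2 (rc r t) n.+1 x)
      (dapx q1 (ic r t) n.+1 x - dapx q2 (ic r t) n.+1 x) * r ^+ 2 <=
    C * expR (2 * `|r * sin t| * x).
Proof.
move=> l0 int1 int2; have [C C1 HC] := apx_growth l0 int2; have C0 : 0 <= C := le_trans ler01 C1.
pose g (y : R) : R := `|q1 y| + `|q2 y| + 2.
have int12 := integD (integ_norm int1) (integ_norm int2).
have intg : integ 0 l g by apply: integD int12 (integ_cst _ _ _).
have g0 y : 0 <= g y by rewrite !addr_ge0.
have inth : integ 0 l (fun y => `|q1 y| + g y) by apply: integD intg; exact: integ_norm.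
have G0 := prim_ge0 intg g0 (ltW l0) (lexx l).
pose K := expR (prim 0 (fun y => `|q1 y| + g y) l) * (2 * (C + 1) ^+ 2 * prim 0 g l).
have K0 : 0 <= K by rewrite mulr_ge0 ?expR_ge0 // mulr_ge0 // mulr_ge0 // sqr_ge0.
exists (1 + K); first by rewrite lerDl.
move=> r r1; have r0 : 0 < r by exact: lt_le_trans r1.
have ri : 0 < r^-1 by rewrite invr_gt0.
near=> n => t x xl.
have hn : forall t x, 0 <= x <= l ->
    energy (r ^+ 2) (apx q2 (rc r t) n.+1 x) (apx q2 (ic r t) n.+1 x)
      (dapx q2 (rc r t) n.+1 x) (dapx q2 (ic r t) n.+1 x) <=
    C * expR (2 * `|r * sin t| * x) by near: n; exact: HC.
have h1 : forall t x, 0 <= x <= l ->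
  `|res q1 r t n x| <= (`|q1 x| + 1) * r^-1 /\ `|ims q1 r t n x| <= (`|q1 x| + 1) * r^-1.
  by near: n; exact: residual_small.
have h2 : forall t x, 0 <= x <= l ->
  `|res q2 r t n x| <= (`|q2 x| + 1) * r^-1 /\ `|ims q2 r t n x| <= (`|q2 x| + 1) * r^-1.
  by near: n; exact: residual_small.
pose f1 y := (q1 y - q2 y) * apx q2 (rc r t) n.+1 y + res q1 r t n y - res q2 r t n y.
pose f2 y := (q1 y - q2 y) * apx q2 (ic r t) n.+1 y + ims q1 r t n y - ims q2 r t n y.
have hv1 := acdB (acd_dapx_re int1 r t n) (acd_dapx_re int2 r t n).
have hv2 := acdB (acd_dapx_im int1 r t n) (acd_dapx_im int2 r t n).
pose U1 y := apx q1 (rc r t) n.+1 y - apx q2 (rc r t) n.+1 y.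
pose U2 y := apx q1 (ic r t) n.+1 y - apx q2 (ic r t) n.+1 y.
pose w := r * cos t; pose s := r * sin t.
have hv1' : acd 0 l (fun x => dapx q1 (rc r t) n.+1 x - dapx q2 (rc r t) n.+1 x)
   (fun x => q1 x * U1 x - ((w ^+ 2 - s ^+ 2) * U1 x - 2 * w * s * U2 x) + f1 x).
  by apply: acd_eq hv1 _ => y _; rewrite /f1 /U1 /U2 /w /s; ring.
have hv2' : acd 0 l (fun x => dapx q1 (ic r t) n.+1 x - dapx q2 (ic r t) n.+1 x)
   (fun x => q1 x * U2 x - ((w ^+ 2 - s ^+ 2) * U2 x + 2 * w * s * U1 x) + f2 x).
  by apply: acd_eq hv2 _ => y _; rewrite /f2 /U1 /U2 /w /s; ring.
have k1 : 1 <= w ^+ 2 + s ^+ 2 by rewrite cos2Dsin2_scaled exprn_ege1.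
have key (a b1 b2 y : R) : 0 <= y <= l -> (r * a) ^+ 2 <= C * expR (2 * `|s| * y) ->
    `|b1| <= (`|q1 y| + 1) * r^-1 -> `|b2| <= (`|q2 y| + 1) * r^-1 ->
    `|(q1 y - q2 y) * a + b1 - b2| <= g y * ((C + 1) * r^-1 * expR (`|s| * y)).
  move=> /andP[y0 yl] ha hb1 hb2; have W1 := expR_weight_ge1 r t y0.
  set W := expR _ in W1 *.
  have ra : `|a| <= r^-1 * (C * W).
    rewrite mulrC ler_pdivlMr // mulrC -(ger0_norm (ltW r0)) -normrM.
    rewrite -(@ler_pXn2r _ 2) ?nnegrE //; last first.
      by rewrite mulr_ge0 ?expR_ge0.
    rewrite -normrX ger0_norm ?sqr_ge0 // [leRHS]exprMn; apply: le_trans ha _.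
    have -> : expR (2 * `|s| * y) = W ^+ 2 by rewrite /W expr2 -expRD; congr expR; ring.
    by rewrite ler_wpM2r ?sqr_ge0 // expr2 ler_peMl.
  apply: le_trans (ler_normB _ _) _.
  apply: le_trans (lerD (ler_normD _ _) hb2) _.
  have h3 : `|(q1 y - q2 y) * a| <= (`|q1 y| + `|q2 y|) * (r^-1 * (C * W)).
    by rewrite normrM ler_pM // ler_normB.
  have h4 : (`|q1 y| + 1) * r^-1 <= (`|q1 y| + 1) * (r^-1 * W).
    by rewrite ler_wpM2l ?addr_ge0 // ler_peMr // ltW.
  have h5 : (`|q2 y| + 1) * r^-1 <= (`|q2 y| + 1) * (r^-1 * W).
    by rewrite ler_wpM2l ?addr_ge0 // ler_peMr // ltW.
  have h6 : 0 <= 2 * (r^-1 * (C * W)).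
    by rewrite !mulr_ge0 ?expR_ge0 ?(ltW ri).
  have -> : g y * ((C + 1) * r^-1 * W) = (`|q1 y| + `|q2 y|) * (r^-1 * (C * W)) +
    (`|q1 y| + 1) * (r^-1 * W) + (`|q2 y| + 1) * (r^-1 * W) + 2 * (r^-1 * (C * W)).
    by rewrite /g; ring.
  lra.
have en y : 0 <= y <= l -> (r * apx q2 (rc r t) n.+1 y) ^+ 2 <= C * expR (2 * `|s| * y) /\
    (r * apx q2 (ic r t) n.+1 y) ^+ 2 <= C * expR (2 * `|s| * y).
  move=> yl; have := hn t y yl; rewrite /energy -/s.
  set a := apx q2 (rc r t) n.+1 y; set b := apx q2 (ic r t) n.+1 y.
  set c := dapx _ _ _ _; set d := dapx _ _ _ _ => h.
  have := sqr_ge0 (r * a); have := sqr_ge0 (r * b); have := sqr_ge0 c; have := sqr_ge0 d.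
  by rewrite !expr2 in h *; split; lra.
have := energy_bound int1 intg g0 k1
  (acdB (acd_apx int1 (rc r t) n.+1) (acd_apx int2 (rc r t) n.+1))
  (acdB (acd_apx int1 (ic r t) n.+1) (acd_apx int2 (ic r t) n.+1)) hv1' hv2'.
move=> /(_ ((C + 1) * r^-1)) h; have {}h := h _ _ x xl.
have {}h := h _ _; rewrite -(cos2Dsin2_scaled r t) -/w -/s.
apply: (@le_trans _ _ (expR (2 * `|s| * x) * K)); last first.
  by rewrite mulrC ler_wpM2r ?expR_ge0 // lerDr.
have rr : 0 <= w ^+ 2 + s ^+ 2 by lra.
apply: le_trans (ler_wpM2r rr (h _ _)) _.
- apply: aaeW => y /andP[y0 yl']; have yl : 0 <= y <= l by rewrite !ltW.
  by apply: key => //; [case: (en y yl)|case: (h1 t y yl)|case: (h2 t y yl)].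
- apply: aaeW => y /andP[y0 yl']; have yl : 0 <= y <= l by rewrite !ltW.
  by apply: key => //; [case: (en y yl)|case: (h1 t y yl)|case: (h2 t y yl)].
rewrite !apx0 !dapx0 !subrr /energy !mulr0 !addr0 mulr0 add0r cos2Dsin2_scaled /K.
rewrite le_eqVlt; apply/orP; left; apply/eqP; field.
by rewrite gt_eqF.
Unshelve. all: by end_near. Qed.

End ApproximantGrowth.

(** * Real polynomials on complex circles, and classes of limits with bounded growth *)

Section ComplexEvaluation.
Context {R : realType}.
Implicit Types (p : {poly R}) (r t x : R) (H : R -> R).
Local Notation normc := (@Normc.normc R).

Lemma le_normcD (y z : R[i]) : normc (y + z) <= normc y + normc z.
Proof. by have := ler_normD y z; rewrite /Num.norm /= -rmorphD lecR. Qed.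

Lemma normcN (z : R[i]) : normc (- z) = normc z.
Proof. by case: z => a b; rewrite /Normc.normc /= !sqrrN. Qed.

Lemma normc_ge0 (z : R[i]) : 0 <= normc z.
Proof. by case: z => a b; exact: sqrtr_ge0. Qed.

Lemma normc_real (a : R) : normc (real_complex R a) = `|a|.
Proof. by rewrite /Normc.normc /= expr0n addr0 sqrtr_sqr. Qed.

Lemma normc_le (a b c : R) : 0 <= c -> a ^+ 2 + b ^+ 2 <= c ^+ 2 -> normc (Complex a b) <= c.
Proof.
by move=> c0 h; rewrite /Normc.normc /= -(ger0_norm c0) -sqrtr_sqr ler_sqrt ?sqr_ge0.
Qed.

Definition ceval p (z : R[i]) : R[i] := (map_poly (real_complex R) p).[z].

Lemma cevalD p1 p2 z : ceval (p1 + p2) z = ceval p1 z + ceval p2 z.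
Proof. by rewrite /ceval rmorphD hornerD. Qed.

Lemma cevalN p z : ceval (- p) z = - ceval p z.
Proof. by rewrite /ceval rmorphN hornerN. Qed.

Lemma cevalM p1 p2 z : ceval (p1 * p2) z = ceval p1 z * ceval p2 z.
Proof. by rewrite /ceval rmorphM hornerM. Qed.

Definition zc r t : R[i] := Complex (r ^+ 2 * cos (2 * t)) (r ^+ 2 * sin (2 * t)).

Lemma zc_expn r t i : zc r t ^+ i = Complex (rc r t i) (ic r t i).
Proof.
elim: i => [|i IH].
  by rewrite expr0 /rc /ic !mulr0n cos0 sin0 expr0 mulr1 mulr0.
by rewrite exprS IH rcS icS /zc; congr Complex; ring.
Qed.

Definition lpoly (F : nat -> nat -> R -> R) n x : {poly R} :=
  \sum_(k < n) \sum_(i < k.+1) F k i x *: 'X^i.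

Lemma complex_sum n (a b : 'I_n -> R) :
  \sum_(i < n) Complex (a i) (b i) = Complex (\sum_(i < n) a i) (\sum_(i < n) b i).
Proof.
elim: n a b => [|n IH] a b; first by rewrite !big_ord0.
by rewrite !big_ord_recr /= IH.
Qed.

Lemma ceval_lpoly F n x r t : ceval (lpoly F n x) (zc r t) =
  Complex (\sum_(k < n) level (F k) (rc r t) k x) (\sum_(k < n) level (F k) (ic r t) k x).
Proof.
rewrite /ceval /lpoly rmorph_sum horner_sum -complex_sum; apply: eq_bigr => k _.
rewrite rmorph_sum horner_sum -complex_sum; apply: eq_bigr => i _.
rewrite /= map_polyZ map_polyXn hornerZ hornerXn zc_expn.
by apply/eqP; rewrite eq_complex /=; apply/andP; split; apply/eqP; ring.
Qed.

Lemma horner_lpoly F n x lam :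
  (lpoly F n x).[lam] = \sum_(k < n) level (F k) (fun i => lam ^+ i) k x.
Proof.
rewrite /lpoly horner_sum; apply: eq_bigr => k _; rewrite horner_sum /level.
by apply: eq_bigr => i _; rewrite hornerZ hornerXn mulrC.
Qed.

(* [lam = r^2 e^(2it)] has square root [r e^(it)], so the weight is
   [e^(tau |Im (sqrt lam)|)]: [H] is a locally uniform limit on the real line of
   polynomials obeying the growth bound of an entire function of order 1/2. *)
Definition growth_class (k : nat) (tau : R) H := exists (p : nat -> {poly R}) (C : R),
  0 <= C /\ forall r, 1 <= r ->
  (\forall n \near \oo, forall t,
    normc (ceval (p n) (zc r t)) * r ^+ k <= C * expR (tau * `|r * sin t|)) /\
  (forall e, 0 < e -> \forall n \near \oo, forall x, `|x| <= r ^+ 2 ->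
    `|(p n).[x] - H x| <= e).

Lemma growth_class_eq k tau H1 H2 : H1 =1 H2 -> growth_class k tau H1 -> growth_class k tau H2.
Proof. by move=> /funext ->. Qed.

Lemma growth_class_weaken k k' tau tau' H : (k' <= k)%N -> tau <= tau' ->
  growth_class k tau H -> growth_class k' tau' H.
Proof.
move=> kk tt [p [C [C0 hp]]]; exists p, C; split => // r r1; have [h1 h2] := hp r r1.
split => //; apply: filterS h1 => n h t; apply: le_trans (le_trans (h t) _).
  by rewrite ler_wpM2l ?normc_ge0 // ler_weXn2l.
by rewrite ler_wpM2l // ler_expR ler_wpM2r.
Qed.

Lemma growth_classD k tau H1 H2 : growth_class k tau H1 -> growth_class k tau H2 ->
  growth_class k tau (fun x => H1 x + H2 x).
Proof.
move=> [p1 [C1 [C10 h1]]] [p2 [C2 [C20 h2]]].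
exists (fun n => p1 n + p2 n), (C1 + C2); split; first by rewrite addr_ge0.
move=> r r1; have [a1 b1] := h1 r r1; have [a2 b2] := h2 r r1; split.
  apply: filterS2 a1 a2 => n k1 k2 t; rewrite cevalD mulrDl.
  apply: le_trans (lerD (k1 t) (k2 t)); rewrite -mulrDl ler_wpM2r ?le_normcD //.
  by rewrite exprn_ge0 // (le_trans _ r1).
move=> e e0; have e2 : 0 < e / 2 by rewrite divr_gt0.
apply: filterS2 (b1 _ e2) (b2 _ e2) => n k1 k2 x xr; rewrite hornerD.
rewrite (_ : _ - _ = ((p1 n).[x] - H1 x) + ((p2 n).[x] - H2 x)); last by ring.
by apply: le_trans (ler_normD _ _) _; have := k1 x xr; have := k2 x xr; lra.
Qed.

Lemma horner_bounded p (a : R) : exists2 M : R, 0 <= M & forall x, `|x| <= a -> `|p.[x]| <= M.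
Proof.
have [a0|a0] := leP 0 a; last first.
  by exists 0 => // x /(le_trans (normr_ge0 x)); rewrite leNgt a0.
exists (\sum_(i < size p) `|p`_i| * a ^+ i).
  by apply: sumr_ge0 => i _; rewrite mulr_ge0 ?exprn_ge0.
move=> x xa; rewrite horner_coef; apply: le_trans (ler_norm_sum _ _ _) _.
by apply: ler_sum => i _; rewrite normrM normrX ler_wpM2l // lerXn2r ?nnegrE.
Qed.

Lemma growth_class_bounded k tau H r : 1 <= r -> growth_class k tau H ->
  exists2 M : R, 0 <= M & forall x, `|x| <= r ^+ 2 -> `|H x| <= M.
Proof.
move=> r1 [p [C [C0 h]]]; have [_ b] := h r r1; have [n _ Hn] := b 1 ltr01.
have [M M0 HM] := horner_bounded (p n) (r ^+ 2); exists (M + 1); first by rewrite addr_ge0.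
move=> x xr; have := Hn n (leqnn n) x xr; have := HM x xr; rewrite distrC.
have := ler_normD (H x - (p n).[x]) (p n).[x]; rewrite subrK; lra.
Qed.

Lemma growth_classM k1 k2 tau1 tau2 H1 H2 : growth_class k1 tau1 H1 -> growth_class k2 tau2 H2 ->
  growth_class (k1 + k2) (tau1 + tau2) (fun x => H1 x * H2 x).
Proof.
move=> g1 g2; have [p1 [C1 [C10 h1]]] := g1; have [p2 [C2 [C20 h2]]] := g2.
exists (fun n => p1 n * p2 n), (C1 * C2); split; first by rewrite mulr_ge0.
move=> r r1; have [a1 b1] := h1 r r1; have [a2 b2] := h2 r r1.
have r0 : 0 <= r by rewrite (le_trans _ r1).
split.
  apply: filterS2 a1 a2 => n e1 e2 t; rewrite cevalM Normc.normcM exprD mulrDl expRD.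
  by rewrite mulrACA [leRHS]mulrACA ler_pM // mulr_ge0 ?normc_ge0 ?exprn_ge0.
have [M1 M10 HM1] := growth_class_bounded r1 g1; have [M2 M20 HM2] := growth_class_bounded r1 g2.
(* The three error terms of a product are at most [d * d], [d * M2] and [M1 * d]; since [d <= 1],
   their sum is at most [d * (M1 + M2 + 1)]. *)
move=> e e0; pose d := Num.min 1 (e / (M1 + M2 + 1)).
have MM : 0 < M1 + M2 + 1 by lra.
have d0 : 0 < d by rewrite lt_min ltr01 divr_gt0.
apply: filterS2 (b1 _ d0) (b2 _ d0) => n k1' k2' x xr; rewrite hornerM.
have e1 := k1' x xr; have e2 := k2' x xr; have m1 := HM1 x xr; have m2 := HM2 x xr.
rewrite (_ : _ - _ = ((p1 n).[x] - H1 x) * ((p2 n).[x] - H2 x) +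
  ((p1 n).[x] - H1 x) * H2 x + H1 x * ((p2 n).[x] - H2 x)); last by ring.
apply: le_trans (ler_normD _ _) _; apply: le_trans (lerD (ler_normD _ _) (lexx _)) _.
rewrite !normrM; set a := `|_ - H1 x| in e1 *; set b := `|_ - H2 x| in e2 *.
have da : d <= 1 by rewrite ge_min lexx.
have de : d * (M1 + M2 + 1) <= e by rewrite -ler_pdivlMr // ge_min lexx orbT.
have a0 : 0 <= a by exact: normr_ge0.
have b0 : 0 <= b by exact: normr_ge0.
have h3 : a * b <= d * 1 by apply: ler_pM => //; exact: le_trans e2 da.
have h4 : a * `|H2 x| <= d * M2 by apply: ler_pM.
have h5 : `|H1 x| * b <= M1 * d by apply: ler_pM.
lra.
Qed.

End ComplexEvaluation.

(** * Growth of the solutions as functions of the spectral parameter *)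

Section SolutionGrowth.
Context {R : realType}.
Implicit Types (q : R -> R) (l x lam r t : R).

(** Since [1 <= C], the square root of [C] is at most [C], and one constant serves all bounds. *)
Lemma growth_of_energy (C r W u1 u2 v1 v2 : R) : 1 <= C -> 1 <= r -> 0 <= W ->
  energy (r ^+ 2) u1 u2 v1 v2 <= C * W ^+ 2 ->
  Normc.normc (Complex u1 u2) * r <= C * W /\ Normc.normc (Complex v1 v2) <= C * W.
Proof.
move=> C1 r1 W0; rewrite /energy -!expr2 => h.
have r0 : 0 < r by exact: lt_le_trans r1.
have CC : C * W ^+ 2 <= (C * W) ^+ 2.
  by rewrite exprMn ler_wpM2r ?sqr_ge0 // expr2 ler_peMl // (le_trans _ C1).
have CW : 0 <= C * W by rewrite mulr_ge0 // (le_trans _ C1).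
have := sqr_ge0 v1; have := sqr_ge0 v2 => h1 h2.
have h3 : 0 <= r ^+ 2 * (u1 ^+ 2 + u2 ^+ 2) by rewrite mulr_ge0 ?sqr_ge0 ?addr_ge0 ?sqr_ge0.
split; last by apply: normc_le => //; lra.
rewrite -ler_pdivlMr //; apply: normc_le; first by rewrite divr_ge0 // ltW.
by rewrite exprMn exprVn ler_pdivlMr ?exprn_gt0 // mulrC; lra.
Qed.

Lemma weight_sqr r t x : expR (2 * `|r * sin t| * x) = expR (x * `|r * sin t|) ^+ 2.
Proof. by rewrite expr2 -expRD; congr expR; ring. Qed.

Lemma lpoly_apx q n x lam : (lpoly (cf q) n x).[lam] = apx q (fun i => lam ^+ i) n x.
Proof. exact: horner_lpoly. Qed.

Lemma lpoly_dapx q n x lam : (lpoly (dcf q) n x).[lam] = dapx q (fun i => lam ^+ i) n x.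
Proof. exact: horner_lpoly. Qed.

Lemma phi_near q l x r e : 0 < l -> integ 0 l q -> 0 <= x <= l -> 0 < e ->
  \forall n \near \oo, forall lam, `|lam| <= r ^+ 2 ->
    `|(lpoly (cf q) n.+1 x).[lam] - phi q lam x| <= e.
Proof.
move=> l0 intq xl e0; have [C C0 HC] := phi_approx l0 intq (sqr_ge0 r).
apply: filterS (@half_expn_small R C e e0) => n hn lam hlam.
rewrite lpoly_apx distrC; apply: le_trans (HC lam n.+1 x hlam xl) _; apply: le_trans hn.
by rewrite exprS; have := half_expn_ge0 (R := R) n; nra.
Qed.

Lemma dphi_near q l x r e : 0 < l -> integ 0 l q -> 0 <= x <= l -> 0 < e ->
  \forall n \near \oo, forall lam, `|lam| <= r ^+ 2 ->
    `|(lpoly (dcf q) n.+1 x).[lam] - dphi q lam x| <= e.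
Proof.
move=> l0 intq xl e0; have [C C0 HC] := dphi_approx l0 intq (sqr_ge0 r).
apply: filterS (@half_expn_small R C e e0) => n hn lam hlam.
by rewrite lpoly_dapx distrC; apply: le_trans (HC lam n x hlam xl) _.
Qed.

Lemma growth_phi q l x : 0 < l -> integ 0 l q -> 0 <= x <= l ->
  growth_class 1 x (phi q ^~ x) /\ growth_class 0 x (dphi q ^~ x).
Proof.
move=> l0 intq xl; have [C C1 HC] := apx_growth l0 intq.
split; [exists (fun n => lpoly (cf q) n.+1 x)|exists (fun n => lpoly (dcf q) n.+1 x)];
  exists C; (split; first exact: le_trans C1); move=> r r1; (split; last first).
- by move=> e e0; exact: (phi_near r l0 intq xl e0).
- apply: filterS (HC r r1) => n h t; have := h t x xl; rewrite weight_sqr.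
  move=> /(growth_of_energy C1 r1 (expR_ge0 _))[+ _].
  by rewrite ceval_lpoly expr1.
- by move=> e e0; exact: (dphi_near r l0 intq xl e0).
- apply: filterS (HC r r1) => n h t; have := h t x xl; rewrite weight_sqr.
  move=> /(growth_of_energy C1 r1 (expR_ge0 _))[_ +].
  by rewrite ceval_lpoly expr0 mulr1.
Qed.

(** Both the solution and its derivative gain one power of [r] over the single-potential bounds;
    every later decay of order [1 / |lam|] is assembled from these gains. *)
Lemma growth_phi_diff q1 q2 l x : 0 < l -> integ 0 l q1 -> integ 0 l q2 -> 0 <= x <= l ->
  growth_class 2 x (fun lam => phi q1 lam x - phi q2 lam x) /\
  growth_class 1 x (fun lam => dphi q1 lam x - dphi q2 lam x).
Proof.
move=> l0 int1 int2 xl; have [C C1 HC] := apx_growth_diff l0 int1 int2.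
have key r : 1 <= r -> \forall n \near \oo, forall t,
   Normc.normc (ceval (lpoly (cf q1) n.+1 x - lpoly (cf q2) n.+1 x) (zc r t)) * r ^+ 2 <=
     C * expR (x * `|r * sin t|) /\
   Normc.normc (ceval (lpoly (dcf q1) n.+1 x - lpoly (dcf q2) n.+1 x) (zc r t)) * r ^+ 1 <=
     C * expR (x * `|r * sin t|).
  move=> r1; have r0 : 0 < r by exact: lt_le_trans r1.
  apply: filterS (HC r r1) => n h t; have := h t x xl; rewrite weight_sqr.
  set W := expR _; rewrite -ler_pdivlMr ?exprn_gt0 // -mulrA -expr_div_n.
  have W0 : 0 <= W / r by rewrite divr_ge0 ?expR_ge0 // ltW.
  move=> /(growth_of_energy C1 r1 W0).
  rewrite !cevalD !cevalN !ceval_lpoly -/(apx q1 _ _ _) => -[k1 k2].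
  by rewrite expr1 expr2 mulrA; split; [move: k1|move: k2]; rewrite mulrA ler_pdivlMr.
split; [exists (fun n => lpoly (cf q1) n.+1 x - lpoly (cf q2) n.+1 x)|
  exists (fun n => lpoly (dcf q1) n.+1 x - lpoly (dcf q2) n.+1 x)];
  exists C; (split; first exact: le_trans C1); move=> r r1; split.
- by apply: filterS (key r r1) => n h t; case: (h t).
- move=> e e0; have e2 : 0 < e / 2 by rewrite divr_gt0.
  apply: filterS2 (phi_near r l0 int1 xl e2) (phi_near r l0 int2 xl e2) => n h1 h2 lam hl.
  have := h1 lam hl; have := h2 lam hl; rewrite hornerD hornerN => k2 k1.
  rewrite (_ : _ - _ = ((lpoly (cf q1) n.+1 x).[lam] - phi q1 lam x) -
    ((lpoly (cf q2) n.+1 x).[lam] - phi q2 lam x)); last by ring.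
  by apply: le_trans (ler_normB _ _) _; lra.
- by apply: filterS (key r r1) => n h t; case: (h t).
- move=> e e0; have e2 : 0 < e / 2 by rewrite divr_gt0.
  apply: filterS2 (dphi_near r l0 int1 xl e2) (dphi_near r l0 int2 xl e2) => n h1 h2 lam hl.
  have := h1 lam hl; have := h2 lam hl; rewrite hornerD hornerN => k2 k1.
  rewrite (_ : _ - _ = ((lpoly (dcf q1) n.+1 x).[lam] - dphi q1 lam x) -
    ((lpoly (dcf q2) n.+1 x).[lam] - dphi q2 lam x)); last by ring.
  by apply: le_trans (ler_normB _ _) _; lra.
Qed.

End SolutionGrowth.

(** * The mean of [|sin|] and a bound of Stirling type *)

Section Trigonometry.
Context {R : realType}.
Implicit Types (s t x y : R).

Lemma sum_sin_telescope M x y :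
  2 * sin (y / 2) * \sum_(j < M) sin (x + y * j%:R) =
  cos (x - y / 2) - cos (x + y * M%:R - y / 2).
Proof.
elim: M => [|M IH]; first by rewrite big_ord0 mulr0 mulr0 addr0 subrr.
rewrite big_ord_recr /= mulrDr IH.
have e2 : x + y * M.+1%:R - y / 2 = (x + y * M%:R) + y / 2 by rewrite -natr1; field.
by rewrite e2 (cosB (x + y * M%:R)) (cosD (x + y * M%:R)); ring.
Qed.

Lemma sin_half_angle_gt0 M : (0 < M)%N -> 0 < sin (pi / M%:R / 2 : R).
Proof.
move=> M0; have M1 : 1 <= M%:R :> R by rewrite ler1n.
have p0 := pi_gt0 R; apply: sin_gt0_pi; rewrite !divr_gt0 //=; last lra.
rewrite ltr_pdivrMr // ltr_pdivrMr; last lra.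
nra.
Qed.

(** With step [d = pi / M] the sum has period [d] in [s]. For [0 <= s < d] all the arguments lie in
    [[0, pi]], the absolute values drop, and the sum telescopes. *)
Lemma sum_abs_sin M s : (0 < M)%N ->
  \sum_(j < M) `|sin (s + pi / M%:R * j%:R)| <= (sin (pi / M%:R / 2))^-1.
Proof.
move=> M0; have M1 : 1 <= M%:R :> R by rewrite ler1n.
have Mn : M%:R != 0 :> R by rewrite pnatr_eq0 -lt0n.
have p0 := pi_gt0 R; set d := pi / M%:R; pose S y := \sum_(j < M) `|sin (y + d * j%:R)|.
have d0 : 0 < d by rewrite divr_gt0 //; lra.
have dM : d * M%:R = pi by rewrite /d divfK.
have S1 y : S (y + d) = S y.
  have shift (f : nat -> R) n : f n = f 0%N -> \sum_(j < n) f j.+1 = \sum_(j < n) f j.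
    case: n => [|n] fn; first by rewrite !big_ord0.
    by rewrite big_ord_recr [RHS]big_ord_recl /= fn addrC.
  rewrite /S -(shift (fun j => `|sin (y + d * j%:R)|)).
    by apply: eq_bigr => j _; congr (`|sin _|); rewrite -natr1; ring.
  by rewrite dM sinDpi normrN mulr0 addr0.
have Sn n y : S (y + d * n%:R) = S y.
  elim: n => [|n IH]; first by rewrite mulr0 addr0.
  by rewrite -natr1 mulrDr mulr1 addrA S1.
have base y : 0 <= y < d -> S y <= (sin (d / 2))^-1.
  move=> /andP[y0 yd]; rewrite -[leRHS]mul1r ler_pdivlMr ?sin_half_angle_gt0 //.
  have -> : S y = \sum_(j < M) sin (y + d * j%:R).
    apply: eq_bigr => j _; rewrite ger0_norm //; apply: sin_ge0_pi.
    have j0 : 0 <= j%:R :> R by [].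
    have jM : j%:R + 1 <= M%:R :> R by rewrite natr1 ler_nat.
    by apply/andP; split; [rewrite addr_ge0 // mulr_ge0 // ltW|rewrite -dM; nra].
  have := sum_sin_telescope M y d; rewrite dM.
  have := cos_max (y - d / 2); have := cos_max (y + pi - d / 2).
  rewrite !ler_norml => /andP[h1 h2] /andP[h3 h4] h5; lra.
have [n Hn] : exists n : nat, 0 <= s + d * n%:R.
  exists (Num.bound (- s / d)).
  have := unstable.ltr_bound (- s / d); rewrite ltr_pdivrMr // mulrC; lra.
rewrite -/(S s) -(Sn n s); set y := s + _ in Hn *.
pose k := Num.truncn (y / d).
have /andP[k1 k2] : k%:R <= y / d < k.+1%:R by apply: truncn_itv; rewrite divr_ge0 // ltW.
rewrite -[y](subrK (d * k%:R)) Sn; apply: base.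
move: k1 k2; rewrite ler_pdivlMr // ltr_pdivrMr // -natr1 => k1 k2.
by apply/andP; split; nra.
Qed.

(** [M * sin (pi / M / 2)] tends to [pi / 2], so the discrete average of [|sin|] comes arbitrarily
    close to its mean [2 / pi]. *)
Lemma sin_quotient (e : R) : 0 < e -> exists2 M : nat, (0 < M)%N &
  (M%:R * sin (pi / M%:R / 2))^-1 <= 2 / pi + e :> R.
Proof.
move=> e0; have p0 := pi_gt0 R; have q0 : 0 < 2 / pi :> R by rewrite divr_gt0.
pose e1 := e / (2 / pi + e); have e10 : 0 < e1 by rewrite divr_gt0 // addr_gt0.
have [/cvg_ex[l hl] dl] := is_derive_sin (0 : R).
have l1 : l = 1 by rewrite -(cos0 R) -dl; apply/esym/cvg_lim.
move: hl; rewrite l1 => /cvgrPdist_le /(_ _ e10) [d /= d0 hd].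
pose M := (Num.bound (pi / d)).+1; exists M => //.
have M0 : 0 < M%:R :> R by rewrite ltr0n.
have pM : pi / M%:R / 2 < d.
  have := unstable.ltr_bound (pi / d); rewrite ltr_pdivrMr // => h.
  rewrite ltr_pdivrMr // ltr_pdivrMr // mulrAC /M -natr1.
  by have : 0 <= (Num.bound (pi / d))%:R :> R by []; nra.
set h := pi / M%:R / 2 in pM *.
have h0 : 0 < h by rewrite !divr_gt0.
have := hd h; rewrite /= sub0r normrN gtr0_norm // => /(_ pM (lt0r_neq0 h0)).
rewrite /GRing.scale /= addr0 mulr1 sin0 subr0 => /ler_normlW h1.
have h2 : (2 / pi) / (2 / pi + e) <= h^-1 * sin h.
  suff : (2 / pi) / (2 / pi + e) = 1 - e1 by lra.
  have E (a b : R) : 0 < a + b -> a / (a + b) = 1 - b / (a + b).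
    by move=> ab; field; rewrite gt_eqF.
  by apply: E; rewrite addr_gt0.
have MM : M%:R = (pi / 2) * h^-1.
  have E (p m : R) : 0 < p -> 0 < m -> m = p / 2 * (p / m / 2)^-1.
    by move=> a b; field; rewrite !gt_eqF.
  exact: E.
have h3 : (2 / pi + e)^-1 <= M%:R * sin h.
  rewrite MM -mulrA -(ler_pM2l q0); apply: le_trans h2 _.
  by rewrite [leRHS]mulrA (_ : 2 / pi * (pi / 2) = 1) ?mul1r // mulrA divfK ?gt_eqF // divff.
have h4 : 0 < (2 / pi + e)^-1 by rewrite invr_gt0 addr_gt0.
by rewrite -[leRHS]invrK lef_pV2 ?posrE // (lt_le_trans h4).
Qed.

(** For [y < 1] this says that [log ((1 + y) / (1 - y))] is at least [2 y]. *)
Lemma log_ratio_bound y : 0 <= y -> (1 - y) * expR (2 * y) <= 1 + y.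
Proof.
move=> y0; rewrite -subr_le0.
have h1 : acd 0 y (fun x : R => 1 - x) (fun=> - 1).
  by apply: acd_eq (acdB (acd_cst 0 y 1) (acd_id 0 y)) _ => x _; rewrite sub0r.
have h2 := acd_expR (acdZ 2 (acd_id 0 y)).
have h3 := acdB (acdM h1 h2) (acdD (acd_cst 0 y 1) (acd_id 0 y)).
have := acd_le y0 h3; rewrite !(mulr0, subr0, addr0, mulr1, expR0) subrr; apply.
apply: aaeW => x /andP[x0 _]; set e := expR _.
have : e * (1 - 2 * x) <= 1.
  rewrite /e -[leRHS](expR0 R) -(subrr (2 * x)) expRD ler_wpM2l ?expR_ge0 //.
  exact: expR_ge1Dx.
by have := expR_gt0 (2 * x); rewrite -/e => e0; lra.
Qed.

(** The square of an upper Stirling bound. The loss must be a single factor [N], since the decay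
    supplies only [N ^ (-2)] against it. The inductive step is [(1 + 1 / n) ^ (2n + 1) >= e^2]. *)
Lemma factorial_bound N : (0 < N)%N ->
  (N`!%:R) ^+ 2 * expR (2 * N%:R) <= expR 2 * N%:R * N%:R ^+ (2 * N) :> R.
Proof.
case: N => // N _; elim: N => [|N IH].
  by rewrite expr1n mul1r !mulr1.
set n := N.+1 in IH *; have n0 : 0 < n%:R :> R by rewrite ltr0n.
have key : expR 2 * n%:R ^+ (2 * n).+1 <= (n.+1%:R) ^+ (2 * n).+1 :> R.
  have n1 : n.+1%:R = n%:R + 1 :> R by rewrite natr1.
  have n2 : (2 * n).+1%:R = 2 * n%:R + 1 :> R by rewrite -natrM natr1.
  (* For this [y], [(1 + y) / (1 - y)] is [(n + 1) / n]. *)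
  pose y : R := (2 * n%:R + 1)^-1.
  have D0 : 0 < 2 * n%:R + 1 :> R by lra.
  have y0 : 0 < y by rewrite invr_gt0.
  have := log_ratio_bound (ltW y0).
  have -> : 1 - y = n%:R * (2 * y) by rewrite /y; field; lra.
  have -> : 1 + y = n.+1%:R * (2 * y) by rewrite n1 /y; field; lra.
  rewrite mulrAC ler_pM2r ?mulr_gt0 // => h.
  have <- : expR (2 * y) ^+ (2 * n).+1 = expR 2 :> R.
    rewrite -expRM_natl; congr expR; rewrite n2 /y; field; lra.
  rewrite mulrC -exprMn lerXn2r ?nnegrE // mulr_ge0 ?expR_ge0 //.
have -> : (n.+1`!%:R) ^+ 2 * expR (2 * n.+1%:R) =
    (n.+1%:R ^+ 2 * expR 2) * ((n`!%:R) ^+ 2 * expR (2 * n%:R)) :> R.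
  have -> : expR (2 * n.+1%:R) = expR (2 * n%:R) * expR 2 :> R.
    have n1 : n.+1%:R = n%:R + 1 :> R by rewrite natr1.
    by rewrite -expRD n1 mulrDr mulr1.
  by rewrite factS natrM exprMn; ring.
have h : 0 <= n.+1%:R ^+ 2 * expR 2 :> R by rewrite mulr_ge0 ?sqr_ge0 ?expR_ge0.
apply: le_trans (ler_wpM2l h IH) _.
have -> : n.+1%:R ^+ 2 * expR 2 * (expR 2 * n%:R * n%:R ^+ (2 * n)) =
   (n.+1%:R ^+ 2 * expR 2) * (expR 2 * n%:R ^+ (2 * n).+1) :> R by rewrite (exprS _ (2 * n)); ring.
apply: le_trans (ler_wpM2l h key) _; rewrite le_eqVlt; apply/orP; left; apply/eqP.
have -> : (2 * n.+1)%N = (2 * n).+2 by rewrite mulnS.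
by rewrite [_ ^+ (2 * n).+2]exprS; ring.
Qed.

End Trigonometry.

(** * Jensen's inequality for polynomials with prescribed real zeros *)

Section DiscreteJensen.
Context {R : realType}.
Implicit Types (p P Q : {poly R}) (r t a x : R) (H : R -> R).
Local Notation normc := (@Normc.normc R).

Definition cis a : R[i] := Complex (cos a) (sin a).

Lemma cisD a b : cis (a + b) = cis a * cis b.
Proof. by rewrite /cis cosD sinD; congr Complex; ring. Qed.

Lemma zc_cis r t : zc r t = real_complex R (r ^+ 2) * cis (2 * t).
Proof.
by rewrite /zc /cis; apply/eqP; rewrite eq_complex /=; apply/andP; split; apply/eqP; ring.
Qed.

Lemma normcMn2 (z : R[i]) : normc (z *+ 2) = normc z *+ 2.
Proof.
rewrite -mulr_natr -(rmorph_nat (real_complex R)) Normc.normcM normc_real ger0_norm //.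
by rewrite mulr_natr.
Qed.

(* Averaging over the two square roots of a point of the circle keeps the value at [0]
   and halves the degree. *)
Lemma max_principle n (P : {poly R[i]}) (rho B : R) : (size P <= n)%N ->
  (forall a, normc P.[real_complex R rho * cis a] <= B) -> normc P.[0] <= B.
Proof.
elim: n P rho => [|n IH] P rho.
  by rewrite leqn0 size_poly_eq0 => /eqP -> /(_ 0); rewrite !horner0.
have [P1|P1] := leqP (size P) 1.
  by move=> _ /(_ 0); rewrite (size1_polyC P1) !hornerC.
move=> Pn hB; have -> : P.[0] = (even_poly P).[0].
  by rewrite !horner_coef0 coef_even_poly.
apply: (IH _ (rho ^+ 2)).
  by apply: leq_trans (size_even_poly P) _; lia.
move=> a; pose z := real_complex R rho * cis (a / 2).
have ez : real_complex R (rho ^+ 2) * cis a = z ^+ 2.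
  rewrite /z exprMn -rmorphXn; congr (_ * _).
  by rewrite expr2 -cisD; congr cis; lra.
have ezN : - z = real_complex R rho * cis (a / 2 + pi).
  rewrite cisD /z -mulrN; congr (_ * _); rewrite /cis cospi sinpi.
  by apply/eqP; rewrite eq_complex /=; apply/andP; split; apply/eqP; ring.
have E : (even_poly P).[z ^+ 2] *+ 2 = P.[z] + P.[- z].
  rewrite -[in RHS](poly_even_odd P) !hornerD !hornerM !horner_comp !hornerXn !hornerX.
  by rewrite sqrrN mulrN mulr2n; ring.
rewrite ez -(ler_pMn2r (ltn0Sn 1)) -normcMn2 E mulr2n.
by apply: le_trans (le_normcD _ _) (lerD _ _); [exact: hB|rewrite ezN; exact: hB].
Qed.

Lemma normc_prod (I : Type) (s : seq I) (f : I -> R[i]) :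
  normc (\prod_(i <- s) f i) = \prod_(i <- s) normc (f i).
Proof.
elim: s => [|i s IH]; first by rewrite !big_nil Normc.normc1.
by rewrite !big_cons Normc.normcM IH.
Qed.

(** The Blaschke factor [r^2 - (z / r^2) lam] has the modulus of [lam - z] on the circle
    [|lam| = r^2], because [z] is real, while its value at [0] is [r^2]. *)
Lemma blaschke_norm r t (z : R) : 0 < r ->
  normc (ceval ((r ^+ 2)%:P - (z / r ^+ 2) *: 'X) (zc r t)) = normc (ceval ('X - z%:P) (zc r t)).
Proof.
move=> r0; have rn : r != 0 by rewrite gt_eqF.
rewrite !cevalD !cevalN /ceval map_polyZ !map_polyC map_polyX /= hornerZ !hornerC !hornerX.
rewrite /zc /Normc.normc /=; congr (Num.sqrt _).
have c2 : cos (2 * t) ^+ 2 = 1 - sin (2 * t) ^+ 2 by have := cos2Dsin2 (2 * t); lra.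
transitivity (r ^+ 4 + z ^+ 2 - 2 * z * r ^+ 2 * cos (2 * t)).
  transitivity (r ^+ 4 - 2 * z * r ^+ 2 * cos (2 * t) +
    z ^+ 2 * (cos (2 * t) ^+ 2 + sin (2 * t) ^+ 2)); first by field.
  by rewrite c2; ring.
transitivity (r ^+ 4 * (cos (2 * t) ^+ 2 + sin (2 * t) ^+ 2) -
    2 * z * r ^+ 2 * cos (2 * t) + z ^+ 2); last by ring.
by rewrite c2; ring.
Qed.

Lemma ceval_prod (I : Type) (s : seq I) (f : I -> {poly R}) z :
  ceval (\prod_(i <- s) f i) z = \prod_(i <- s) ceval (f i) z.
Proof. by rewrite /ceval rmorph_prod horner_prod. Qed.

(* Multiplying the rotations of [P] by [2 pi j / M] replaces the mean of [log |P|] over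
   the circle by an average of [M] values. *)
Lemma rotation_bound P r (D tau : R) M : 0 < r -> 0 <= tau -> 0 <= D -> (0 < M)%N ->
  (forall t, normc (ceval P (zc r t)) <= D * expR (tau * `|r * sin t|)) ->
  `|P.[0]| <= D * expR (tau * r * (M%:R * sin (pi / M%:R / 2))^-1).
Proof.
move=> r0 tau0 D0 M0 hP.
have M1 : 0 < M%:R :> R by rewrite ltr0n.
pose Pc := map_poly (real_complex R) P.
pose F := \prod_(j < M) (Pc \Po (cis (2 * (pi / M%:R * j%:R)) *: 'X)).
have F0 : normc F.[0] = `|P.[0]| ^+ M.
  rewrite /F horner_prod normc_prod.
  rewrite (eq_bigr (fun=> `|P.[0]|)); first by rewrite prodr_const card_ord.
  move=> j _; rewrite horner_comp hornerZ hornerX mulr0.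
  by rewrite -[0 in LHS](rmorph0 (real_complex R)) horner_map normc_real.
have hF : normc F.[0] <= (D * expR (tau * r * (M%:R * sin (pi / M%:R / 2))^-1)) ^+ M.
  apply: (@max_principle (size F) F (r ^+ 2)) => // a.
  rewrite /F horner_prod normc_prod.
  apply: (@le_trans _ _ (\prod_(j < M) (D * expR (tau * `|r * sin (a / 2 + pi / M%:R * j%:R)|)))).
    apply: ler_prod => j _; rewrite normc_ge0 /= horner_comp hornerZ hornerX.
    have -> : cis (2 * (pi / M%:R * j%:R)) * (real_complex R (r ^+ 2) * cis a) =
        zc r (a / 2 + pi / M%:R * j%:R).
      by rewrite zc_cis mulrCA -cisD; congr (_ * cis _); lra.
    exact: hP.
  rewrite big_split /= prodr_const card_ord exprMn ler_wpM2l ?exprn_ge0 //.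
  rewrite -expR_sum -expRM_natl ler_expR.
  have -> : \sum_(j < M) tau * `|r * sin (a / 2 + pi / M%:R * j%:R)| =
      tau * r * \sum_(j < M) `|sin (a / 2 + pi / M%:R * j%:R)|.
    by rewrite mulr_sumr; apply: eq_bigr => j _; rewrite normrM (gtr0_norm r0) mulrA.
  apply: le_trans (ler_wpM2l _ (sum_abs_sin (a / 2) M0)) _; first by rewrite mulr_ge0 // ltW.
  by rewrite invfM mulrCA [X in _ <= _ * X]mulrA divff ?mul1r // gt_eqF.
rewrite F0 in hF; rewrite -(@ler_pXn2r _ M) ?nnegrE //.
by rewrite mulr_ge0 ?expR_ge0.
Qed.

Lemma prod_const_seq (c : R) (zs : seq R) : \prod_(z <- zs) c = c ^+ size zs.
Proof. by elim: zs => [|z zs IH]; rewrite ?big_nil // big_cons IH -exprS. Qed.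

(** Replacing each root factor by its Blaschke factor keeps the modulus on the circle and changes
    the value at [0] from [|z|] to [r^2]. The identity of moduli holds for every real [z], so the
    zeros may lie inside or outside the circle. *)
Lemma jensen_exact P (zs : seq R) r (D tau : R) M : 0 < r -> 0 <= tau -> 0 <= D -> (0 < M)%N ->
  uniq zs -> all (root P) zs ->
  (forall t, normc (ceval P (zc r t)) <= D * expR (tau * `|r * sin t|)) ->
  `|P.[0]| * (r ^+ 2) ^+ size zs <=
    \prod_(z <- zs) `|z| * (D * expR (tau * r * (M%:R * sin (pi / M%:R / 2))^-1)).
Proof.
move=> r0 tau0 D0 M0 uz rz hP.
have [g Pg] := uniq_roots_prod_XsubC rz (etrans (uniq_rootsE zs) uz).
pose Q := g * \prod_(z <- zs) ((r ^+ 2)%:P - (z / r ^+ 2) *: 'X).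
have hQ t : normc (ceval Q (zc r t)) <= D * expR (tau * `|r * sin t|).
  apply: le_trans (hP t); rewrite Pg /Q !cevalM !Normc.normcM !ceval_prod !normc_prod.
  rewrite le_eqVlt; apply/orP; left; apply/eqP; congr (_ * _).
  by apply: eq_bigr => z _; exact: blaschke_norm.
have Q0 : Q.[0] = g.[0] * (r ^+ 2) ^+ size zs.
  rewrite /Q hornerM horner_prod; congr (_ * _).
  rewrite (eq_bigr (fun=> r ^+ 2)); first by rewrite prod_const_seq.
  by move=> z _; rewrite hornerD hornerN hornerZ hornerX hornerC mulr0 subr0.
have P0 : `|P.[0]| = `|g.[0]| * \prod_(z <- zs) `|z|.
  rewrite Pg hornerM horner_prod normrM normr_prod; congr (_ * _).
  by apply: eq_bigr => z _; rewrite hornerXsubC sub0r normrN.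
have := rotation_bound r0 tau0 D0 M0 hQ; rewrite Q0 P0 => h.
have rho0 : 0 <= (r ^+ 2) ^+ size zs by rewrite exprn_ge0 ?sqr_ge0.
rewrite normrM (ger0_norm rho0) in h.
by rewrite mulrAC mulrC; apply: ler_wpM2l h; apply: prodr_ge0.
Qed.

Lemma ceval_bounded p r : 0 <= r -> exists2 K : R, 0 <= K &
  forall t, normc (ceval p (zc r t)) <= K.
Proof.
move=> r0; exists (\sum_(i < size p) `|p`_i| * (r ^+ 2) ^+ i).
  by apply: sumr_ge0 => i _; rewrite mulr_ge0 ?exprn_ge0 ?sqr_ge0.
move=> t; rewrite /ceval horner_coef size_map_poly.
have : forall n (f : 'I_n -> R[i]), normc (\sum_(i < n) f i) <= \sum_(i < n) normc (f i).
  elim=> [|n IH] f; first by rewrite !big_ord0 Normc.normc0.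
  by rewrite !big_ord_recr /=; apply: le_trans (le_normcD _ _) _; rewrite lerD2r.
move=> h; apply: le_trans (h _ _) _; apply: ler_sum => i _.
rewrite Normc.normcM coef_map normc_real ler_wpM2l // zc_expn.
apply: normc_le; first by rewrite exprn_ge0 ?sqr_ge0.
by rewrite /rc /ic !exprMn -mulrDr cos2Dsin2 mulr1.
Qed.

Lemma ceval_sum_le n (f : 'I_n -> {poly R}) z (c : R) :
  (forall i, normc (ceval (f i) z) <= c) -> normc (ceval (\sum_(i < n) f i) z) <= n%:R * c.
Proof.
elim: n f => [|n IH] f hf.
  by rewrite big_ord0 /ceval rmorph0 horner0 Normc.normc0 mul0r.
rewrite big_ord_recr cevalD /= -natr1 mulrDl mul1r.
by apply: le_trans (le_normcD _ _) (lerD (IH _ _) (hf _)).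
Qed.

(** The approximating polynomial is only small at the zeros of [H]. Subtracting its Lagrange
    interpolant makes it vanish there exactly; the correction is small on the circle and at [0],
    because the Lagrange basis is bounded there by a constant [K] fixed before the approximation. *)
Lemma jensen_approx H r (D tau : R) M N (z : nat -> R) :
  0 < r -> 0 <= tau -> 0 < D -> (0 < M)%N -> injective z -> (forall n, H (z n) = 0) ->
  (forall e a, 0 < e -> exists2 p, forall t, normc (ceval p (zc r t)) <= D * expR (tau * `|r * sin t|) &
     forall x, `|x| <= a -> `|p.[x] - H x| <= e) ->
  `|H 0| * (r ^+ 2) ^+ N <=
    \prod_(n < N) `|z n| * (2 * D * expR (tau * r * (M%:R * sin (pi / M%:R / 2))^-1)).
Proof.
move=> r0 tau0 D0 M0 zinj Hz hp.
have [lag lagE] : exists lag : 'I_N -> {poly R}, forall i j : 'I_N, (lag i).[z j] = (i == j)%:R.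
  case: N => [|N]; first by exists (fun=> 0) => -[].
  by exists (fun i => tnth (N.+1.-lagrange z) i) => i j; exact: lagrange_sample.
have [K K0 HK] : exists2 K : R, 0 <= K & forall i, (forall t, normc (ceval (lag i) (zc r t)) <= K) /\
    `|(lag i).[0]| <= K.
  have k i := cid2 (ceval_bounded (lag i) (ltW r0)).
  have k0 i : 0 <= s2val (k i) by case: (k i).
  exists (\sum_(i < N) (s2val (k i) + `|(lag i).[0]|)).
    by apply: sumr_ge0 => i _; rewrite addr_ge0.
  move=> i; have ki : s2val (k i) + `|(lag i).[0]| <=
      \sum_(i < N) (s2val (k i) + `|(lag i).[0]|).
    by rewrite (bigD1 i) //= lerDl; apply: sumr_ge0 => j _; rewrite addr_ge0.
  split=> [t|]; apply: le_trans ki; last by rewrite lerDr.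
  by apply: le_trans (_ : _ <= s2val (k i)) _; [case: (k i)|rewrite lerDl].
apply/ler_addgt0Pr => eta eta0.
have rN : 0 < (r ^+ 2) ^+ N by rewrite !exprn_gt0.
(* The total correction [e1] has to fit into a second [D] on the circle, and to cost at most [eta]
   once multiplied by the power of [r] at [0]. *)
pose e1 := Num.min D (eta / (r ^+ 2) ^+ N).
have e10 : 0 < e1 by rewrite lt_min D0 divr_gt0.
have NK : 0 < 1 + N%:R * K by rewrite ltr_pwDl // mulr_ge0.
pose e := e1 / (1 + N%:R * K); have e0 : 0 < e by rewrite divr_gt0.
have eK : e + N%:R * (e * K) = e1.
  have E (n : R) : 0 < 1 + n * K -> e1 / (1 + n * K) + n * (e1 / (1 + n * K) * K) = e1.
    by move=> h; field; rewrite gt_eqF.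
  exact: E.
have [p hp1 hp2] := hp e (\sum_(i < N) `|z i|) e0.
have za (i : 'I_N) : `|z i| <= \sum_(i < N) `|z i|.
  by rewrite (bigD1 i) //= lerDl; apply: sumr_ge0.
have pz (i : 'I_N) : `|p.[z i]| <= e by rewrite -[_.[_]]subr0 -(Hz i); apply: hp2.
pose P := p - \sum_(i < N) p.[z i] *: lag i.
have rP : all (root P) [seq z i | i <- iota 0 N].
  apply/allP => _ /mapP[j jN ->]; rewrite mem_iota /= add0n in jN.
  rewrite /root /P hornerD hornerN horner_sum (bigD1 (Ordinal jN)) //= hornerZ.
  rewrite (lagE (Ordinal jN) (Ordinal jN)) eqxx mulr1 big1 ?addr0 ?subrr // => i ij.
  by rewrite hornerZ (lagE i (Ordinal jN)) (negbTE ij) mulr0.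
have uz : uniq [seq z i | i <- iota 0 N] by rewrite map_inj_uniq ?iota_uniq.
have hP t : normc (ceval P (zc r t)) <= 2 * D * expR (tau * `|r * sin t|).
  rewrite /P cevalD cevalN; apply: le_trans (le_normcD _ _) _; rewrite normcN.
  have W1 : 1 <= expR (tau * `|r * sin t|) by rewrite -expR0 ler_expR mulr_ge0.
  have h : normc (ceval (\sum_(i < N) p.[z i] *: lag i) (zc r t)) <= N%:R * (e * K).
    apply: ceval_sum_le => i; rewrite /ceval map_polyZ hornerZ Normc.normcM normc_real.
    by apply: ler_pM; rewrite ?normc_ge0 //; have [h1 _] := HK i; exact: h1.
  have := hp1 t; have De : e1 <= D by rewrite ge_min lexx.
  have Ne : N%:R * (e * K) <= D * expR (tau * `|r * sin t|).
    by apply: (@le_trans _ _ D); [lra|rewrite ler_peMr // ltW].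
  lra.
have D2 : 0 <= 2 * D by lra.
have := jensen_exact r0 tau0 D2 M0 uz rP hP.
rewrite size_map size_iota.
have -> : \prod_(w <- [seq z i | i <- iota 0 N]) `|w| = \prod_(n < N) `|z n|.
  by rewrite -(big_mkord xpredT (fun n => `|z n|)) /index_iota subn0 big_map.
move=> h.
have P0 : `|H 0| <= `|P.[0]| + e1.
  have h1 : `|p.[0] - H 0| <= e by apply: hp2; rewrite normr0; apply: sumr_ge0.
  have h2 : `|\sum_(i < N) p.[z i] * (lag i).[0]| <= N%:R * (e * K).
    apply: le_trans (ler_norm_sum _ _ _) _; have -> : N%:R * (e * K) = \sum_(i < N) (e * K).
      by rewrite sumr_const card_ord mulr_natl.
    by apply: ler_sum => i _; rewrite normrM ler_pM //; case: (HK i).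
  have -> : H 0 = P.[0] + \sum_(i < N) p.[z i] * (lag i).[0] - (p.[0] - H 0).
    rewrite /P hornerD hornerN horner_sum.
    by under eq_bigr do rewrite hornerZ; ring.
  apply: le_trans (ler_normB _ _) _; apply: le_trans (lerD (ler_normD _ _) (lexx _)) _; lra.
apply: le_trans (ler_wpM2r (ltW rN) P0) _; rewrite mulrDl lerD //.
by rewrite -ler_pdivlMr // ge_min lexx orbT.
Qed.

End DiscreteJensen.

(** * Functions with too many zeros for their growth vanish *)

Section ZeroCounting.
Context {R : realType}.
Implicit Types (H : R -> R) (beta : R) (z a : nat -> R).

Lemma growth_class_jensen H beta z : 0 < beta -> growth_class 2 (2 * beta) H ->
  injective z -> (forall n, H (z n) = 0) ->
  exists2 C : R, 0 < C & forall r N, 1 <= r ->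
    `|H 0| * (r ^+ 2) ^+ N <= \prod_(n < N) `|z n| *
      (C / r ^+ 2 * expR (2 * (2 * beta * r / pi) + 1)).
Proof.
move=> b0 [p [C [C0 hp]]] zinj Hz; exists (2 * (C + 1)); first by rewrite mulr_gt0 // ltr_wpDl.
move=> r N r1; have r0 : 0 < r by exact: lt_le_trans r1.
have r2 : 0 < r ^+ 2 by rewrite exprn_gt0.
have b2 : 0 < 2 * beta by rewrite mulr_gt0.
have tr : 0 < 2 * beta * r by rewrite mulr_gt0.
(* The number of rotations depends on [r]: the excess over [2 / pi] is multiplied by [2 * beta * r]
   in the exponent and must stay below [1]. *)
have [M M0 hM] := sin_quotient (divr_gt0 ltr01 tr).
have D0 : 0 < (C + 1) / r ^+ 2 by rewrite divr_gt0 // ltr_wpDl.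
(* The growth bound is taken on the circle attached to [r], the closeness on a real segment of
   half-length [c], which may be far longer; one index [n] is large enough for both. *)
have happ e c : 0 < e -> exists2 P, forall t, Normc.normc (ceval P (zc r t)) <=
    (C + 1) / r ^+ 2 * expR (2 * beta * `|r * sin t|) &
    forall x, `|x| <= c -> `|P.[x] - H x| <= e.
  move=> e0; have r1' : 1 <= 1 + `|c| by rewrite lerDl.
  have [h1 _] := hp r r1; have [_ h2] := hp (1 + `|c|) r1'.
  have [n [k1 k2]] := filter_ex (filterI h1 (h2 e e0)); exists (p n).
    move=> t; rewrite mulrAC ler_pdivlMr //; apply: le_trans (k1 t) _.
    by rewrite ler_wpM2r ?expR_ge0 // lerDl.
  move=> x xc; apply: k2; apply: le_trans xc _; apply: le_trans (ler_norm _) _.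
  by rewrite expr2; have := normr_ge0 c; nra.
have := jensen_approx N r0 (ltW b2) D0 M0 zinj Hz happ.
move=> h; apply: le_trans h _; rewrite ler_wpM2l ?prodr_ge0 //.
rewrite (mulrA 2) ler_wpM2l //; first by rewrite divr_ge0 ?mulr_ge0 ?addr_ge0 // ltW.
rewrite ler_expR; apply: le_trans (ler_wpM2l (ltW tr) hM) _.
by rewrite mulrDr mul1r mulfV ?gt_eqF // lerD2r mulrCA mulrA.
Qed.

Lemma growth_class_zero_at0 H beta z a (S : R) : 0 < beta -> growth_class 2 (2 * beta) H ->
  injective z -> (forall n, H (z n) = 0) ->
  (forall n, `|z n| <= (pi * n.+1%:R / (2 * beta)) ^+ 2 * expR (a n)) ->
  (forall N, \sum_(n < N) a n <= S) -> H 0 = 0.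
Proof.
move=> b0 gH zinj Hz hz hS; have [C C0 hC] := growth_class_jensen b0 gH zinj Hz.
have p0 := pi_gt0 R; pose c : R := pi / (2 * beta).
have b2 : 0 < 2 * beta by rewrite mulr_gt0.
have c0 : 0 < c by rewrite divr_gt0.
(* The summand [3] in the exponent is the [1] lost to the discrete average plus the [2] lost in the
   factorial bound. *)
pose K := C / c ^+ 2 * expR (S + 3).
(* The radius is [r = c * N]; the growth then contributes exactly [expR (2 * N)]. *)
have key N : (0 < N)%N -> 1 <= c * N%:R -> `|H 0| * N%:R <= K.
  move=> N0 r1; have Nr : 0 < N%:R :> R by rewrite ltr0n.
  have hP : \prod_(n < N) `|z n| <= (c ^+ 2) ^+ N * (N`!%:R) ^+ 2 * expR S.
    apply: (@le_trans _ _ (\prod_(n < N) ((c ^+ 2 * n.+1%:R ^+ 2) * expR (a n)))).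
      apply: ler_prod => n _; rewrite normr_ge0 /=; apply: le_trans (hz n) _.
      by rewrite -exprMn /c (mulrAC pi (2 * beta)^-1).
    rewrite big_split /= big_split /= prodr_const card_ord -expR_sum.
    have -> : \prod_(n < N) n.+1%:R ^+ 2 = (N`!%:R) ^+ 2 :> R.
      rewrite prodrXl -natr_prod; congr (_%:R ^+ 2).
      by elim: (N) => [|k IH]; rewrite ?big_ord0 // big_ord_recr /= IH factS mulnC.
    apply: ler_wpM2l; last by rewrite ler_expR; exact: hS.
    by apply: mulr_ge0; rewrite ?sqr_ge0 // exprn_ge0 // sqr_ge0.
  have := hC (c * N%:R) N r1.
  have -> : 2 * (2 * beta * (c * N%:R) / pi) = 2 * N%:R.
    have E (b k : R) : 0 < b -> 0 < k -> 2 * (b * (k / b * N%:R) / k) = 2 * N%:R.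
      by move=> b' k'; field; rewrite (lt0r_neq0 b') (lt0r_neq0 k').
    exact: E.
  set B := C / _ * _ => h.
  have B0 : 0 <= B by rewrite mulr_ge0 ?expR_ge0 // divr_ge0 ?sqr_ge0 // ltW.
  have {}h := le_trans h (ler_wpM2r B0 hP).
  have cN : 0 < (c ^+ 2) ^+ N by rewrite !exprn_gt0.
  have h2 : `|H 0| * N%:R ^+ (2 * N) <= (N`!%:R) ^+ 2 * expR S * B.
    rewrite -(ler_pM2l cN); apply: le_trans (_ : _ <= `|H 0| * ((c * N%:R) ^+ 2) ^+ N) _.
      have -> : ((c * N%:R) ^+ 2) ^+ N = (c ^+ 2) ^+ N * N%:R ^+ (2 * N).
        by rewrite [(c * N%:R) ^+ 2]exprMn exprMn (exprM N%:R).
      by rewrite mulrCA.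
    by apply: le_trans h _; rewrite !mulrA.
  have NN : 0 < N%:R ^+ (2 * N) :> R by rewrite exprn_gt0.
  have fb := @factorial_bound R N N0.
  rewrite -(ler_pM2r NN) mulrAC.
  apply: (@le_trans _ _ ((N`!%:R) ^+ 2 * expR S * B * N%:R)); first by rewrite ler_wpM2r // ltW.
  have -> : N`!%:R ^+ 2 * expR S * B * N%:R = (N`!%:R ^+ 2 * expR (2 * N%:R)) *
      (expR S * expR 1 * (C / c ^+ 2 / N%:R)).
    rewrite /B expRD; have E (f e1 e2 e3 k n : R) : n != 0 -> k != 0 ->
      f * e1 * (C / (k * n) ^+ 2 * (e2 * e3)) * n = f * e2 * (e1 * e3 * (C / k ^+ 2 / n)).
      by move=> n0 k0; field; rewrite ?k0 ?n0.
    by apply: E; rewrite gt_eqF.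
  have W0 : 0 <= expR S * expR 1 * (C / c ^+ 2 / N%:R).
    by rewrite !mulr_ge0 ?expR_ge0 ?invr_ge0 ?sqr_ge0 // ltW.
  apply: le_trans (ler_wpM2r W0 fb) _.
  rewrite /K; have -> : expR (S + 3) = expR S * expR 1 * expR 2.
    by rewrite -!expRD; congr expR; ring.
  have E (e1 e2 e3 k n m : R) : n != 0 -> k != 0 ->
    e2 * n * m * (e1 * e3 * (C / k ^+ 2 / n)) = C / k ^+ 2 * (e1 * e3 * e2) * m.
    by move=> n0 k0; field; rewrite ?k0 ?n0.
  by rewrite E // gt_eqF.
apply/eqP; rewrite -normr_le0 leNgt; apply/negP => H0.
(* Large enough both to violate the bound [K] and to make the radius at least [1]. *)
pose N := (Num.bound (K / `|H 0|) + Num.bound c^-1).+1.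
have := unstable.ltr_bound (K / `|H 0|); have := unstable.ltr_bound (c^-1).
rewrite ltr_pdivrMr // => h1 h2.
have NE : N%:R = (Num.bound (K / `|H 0|))%:R + (Num.bound c^-1)%:R + 1 :> R.
  by rewrite /N -natr1 natrD.
have n1 : 0 <= (Num.bound (K / `|H 0|))%:R :> R by [].
have n2 : 0 <= (Num.bound c^-1)%:R :> R by [].
have h3 : 1 <= c * N%:R.
  rewrite mulrC -ler_pdivrMr // div1r NE; lra.
have := key N (ltn0Sn _) h3; rewrite NE.
by rewrite leNgt => /negP; apply; nra.
Qed.

Lemma sum_inv_sqr N : \sum_(n < N) (n.+1%:R ^+ 2)^-1 <= 2 :> R.
Proof.
case: N => [|N]; first by rewrite big_ord0.
suff h : \sum_(n < N.+1) (n.+1%:R ^+ 2)^-1 <= 2 - N.+1%:R^-1 :> R.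
  by apply: le_trans h _; rewrite lerBlDr lerDl invr_ge0.
elim: N => [|N IH]; first by rewrite big_ord1 expr1n invr1; lra.
rewrite big_ord_recr /=; apply: le_trans (lerD IH (lexx _)) _.
have n0 : 0 < N.+1%:R :> R by rewrite ltr0n.
have -> : N.+2%:R = N.+1%:R + 1 :> R by rewrite natr1.
move: n0; move: (N.+1%:R : R) => x x0.
have y0 : 0 < x * (x + 1) ^+ 2 by rewrite mulr_gt0 ?exprn_gt0 ?addr_gt0.
rewrite -subr_ge0 (_ : _ - _ = (x * (x + 1) ^+ 2)^-1); first by rewrite invr_ge0 ltW.
by field; rewrite !gt_eqF ?addr_gt0.
Qed.

(** Jensen's inequality reaches the value at [0] alone; stability under translation carries the
    conclusion to every point. *)
Definition growth_class_all k tau (H : R -> R) :=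
  forall c, growth_class k tau (fun x => H (x + c)).

(* A bounded perturbation of the zeros costs a summable factor [1 + O(1/n^2)], so
   the zeros of all the translates of [H] are covered at once. *)
Lemma growth_class_eq0 H beta z al (S C0 : R) : 0 < beta -> growth_class_all 2 (2 * beta) H ->
  injective z -> (forall n, H (z n) = 0) ->
  (forall n, 0 <= al n) ->
  (forall n, `|z n| <= (pi * n.+1%:R / (2 * beta)) ^+ 2 * expR (al n) + C0) ->
  (forall N, \sum_(n < N) al n <= S) -> forall c, H c = 0.
Proof.
move=> b0 gH zinj Hz al0 hz hS c.
have p0 := pi_gt0 R; pose k : R := pi / (2 * beta).
have b2 : 0 < 2 * beta by rewrite mulr_gt0.
have k0 : 0 < k by rewrite divr_gt0.
pose D := `|C0| + `|c|; have D0 : 0 <= D by rewrite addr_ge0.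
have := @growth_class_zero_at0 (fun x => H (x + c)) beta (fun n => z n - c)
  (fun n => al n + D / k ^+ 2 * (n.+1%:R ^+ 2)^-1) (S + D / k ^+ 2 * 2) b0 (gH c).
rewrite add0r; apply.
- by move=> i j /addIr /zinj.
- by move=> n; rewrite subrK.
- move=> n; have n0 : 0 < n.+1%:R :> R by rewrite ltr0n.
  have E : pi * n.+1%:R / (2 * beta) = k * n.+1%:R by rewrite /k mulrAC.
  move: (hz n); rewrite E => h.
  apply: le_trans (ler_normB _ _) _; apply: le_trans (lerD h (lexx _)) _.
  set x := k * n.+1%:R; have x0 : 0 < x ^+ 2 by rewrite exprn_gt0 // mulr_gt0.
  have -> : D / k ^+ 2 * (n.+1%:R ^+ 2)^-1 = D / x ^+ 2.
    have E' (a d m : R) : 0 < a -> 0 < m -> d / a ^+ 2 * (m ^+ 2)^-1 = d / (a * m) ^+ 2.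
      by move=> a0 m0; field; rewrite (lt0r_neq0 a0) (lt0r_neq0 m0).
    exact: E'.
  rewrite expRD mulrA.
  have h1 : 1 <= expR (al n) by rewrite -expR0 ler_expR.
  have h2 : 1 + D / x ^+ 2 <= expR (D / x ^+ 2) by exact: expR_ge1Dx.
  have h3 : x ^+ 2 * expR (al n) * (1 + D / x ^+ 2) <=
      x ^+ 2 * expR (al n) * expR (D / x ^+ 2).
    by rewrite ler_wpM2l // mulr_ge0 ?expR_ge0 // ltW.
  apply: le_trans h3.
  have -> : x ^+ 2 * expR (al n) * (1 + D / x ^+ 2) = x ^+ 2 * expR (al n) + expR (al n) * D.
    have E' (u e d : R) : 0 < u -> u * e * (1 + d / u) = u * e + e * d.
      by move=> u0; field; rewrite (lt0r_neq0 u0).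
    exact: E'.
  rewrite -addrA lerD2l; apply: (@le_trans _ _ D); last by rewrite ler_peMl.
  by rewrite /D lerD2r ler_norm.
- move=> N; rewrite big_split /= -mulr_sumr; apply: lerD; first exact: hS.
  by apply: ler_wpM2l (sum_inv_sqr N); rewrite divr_ge0 // sqr_ge0.
Qed.

End ZeroCounting.

(** * The Pruefer angle with scale [K] *)

Section Pruefer.
Context {R : realType}.
Implicit Types (F G f g q u v : R -> R) (l x y lam : R).

Lemma within_mul a c F G : {within `[a, c], continuous F} -> {within `[a, c], continuous G} ->
  {within `[a, c], continuous (fun x => F x * G x)}.
Proof.
move=> /subspace_continuousP cF /subspace_continuousP cG; apply/subspace_continuousP => x xac.
by apply: cvgM; [exact: cF|exact: cG].
Qed.

Lemma within_inv a c F : {within `[a, c], continuous F} -> (forall x, a <= x <= c -> F x != 0) ->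
  {within `[a, c], continuous (fun x => (F x)^-1)}.
Proof.
move=> /subspace_continuousP cF F0; apply/subspace_continuousP => x xac.
by apply: cvgV; [apply: F0; move: xac; rewrite /= in_itv|exact: cF].
Qed.

Lemma cos_sqrE (a : R) : cos a ^+ 2 = 1 - sin a ^+ 2.
Proof. by apply/eqP; rewrite eq_sym subr_eq eq_sym cos2Dsin2. Qed.

Lemma sin_sqr_lipschitz (a b : R) : `|sin a ^+ 2 - sin b ^+ 2| <= 2 * `|a - b|.
Proof.
have h : `|sin a - sin b| <= 1 * `|a - b|.
  by apply: (@derive_lipschitz _ sin cos b a 1) => z _; exact: cos_max.
rewrite subr_sqr normrM mulrC ler_pM //; last by rewrite mul1r in h.
by apply: le_trans (ler_normD _ _) _; have := sin_max a; have := sin_max b; lra.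
Qed.

(** The rate is Lipschitz in the angle and in [lam]; Young's inequality separates the two
    contributions in the form that Gronwall's inequality for the squared difference of two angles
    uses. *)
Lemma pruefer_rate_diff (K B Q lam mu a b : R) : 0 < K -> `|lam| <= B -> `|mu| <= B ->
  2 * ((a - b) * (K * cos a ^+ 2 - (Q - lam) / K * sin a ^+ 2 -
     (K * cos b ^+ 2 - (Q - mu) / K * sin b ^+ 2))) <=
  (4 * (K + (`|Q| + B) / K) + 1) * ((a - b) * (a - b)) + (lam - mu) ^+ 2 / K ^+ 2.
Proof.
move=> K0 hl hm; have := sin_sqr_lipschitz a b; rewrite !cos_sqrE.
have : sin b ^+ 2 <= 1 by have := sqr_ge0 (cos b); rewrite cos_sqrE subr_ge0.
have := sqr_ge0 (sin b).
move: (sin a ^+ 2) (sin b ^+ 2) (a - b) => s t w t0 t1 hs.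
set D := - (K + (Q - lam) / K) * (s - t).
have -> : K * (1 - s) - (Q - lam) / K * s - (K * (1 - t) - (Q - mu) / K * t) =
    D + (lam - mu) / K * t by rewrite /D; field; rewrite gt_eqF.
have h1 : 2 * (w * D) <= 4 * (K + (`|Q| + B) / K) * (w * w).
  have e1 : `|- (K + (Q - lam) / K)| <= K + (`|Q| + B) / K.
    rewrite normrN; apply: le_trans (ler_normD _ _) _; rewrite gtr0_norm // lerD2l.
    rewrite normrM (ger0_norm (x := K^-1)) ?invr_ge0 ?(ltW K0) // ler_wpM2r ?invr_ge0 ?(ltW K0) //.
    by apply: le_trans (ler_normB _ _) _; rewrite lerD2l.
  have e2 : `|D| <= (K + (`|Q| + B) / K) * (2 * `|w|) by rewrite /D normrM ler_pM.
  apply: le_trans (ler_norm _) _; rewrite normrM [`|w * D|]normrM (ger0_norm (x := 2)) //.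
  have -> : w * w = `|w| * `|w| by rewrite -normrM ger0_norm // -expr2 sqr_ge0.
  have := ler_wpM2l (normr_ge0 w) e2; lra.
have h2 : 2 * (w * ((lam - mu) / K * t)) <= w * w + (lam - mu) ^+ 2 / K ^+ 2.
  have -> : (lam - mu) ^+ 2 / K ^+ 2 = ((lam - mu) / K) ^+ 2 by rewrite expr_div_n.
  set k := (lam - mu) / K.
  have t2 : k ^+ 2 * t ^+ 2 <= k ^+ 2 by rewrite ler_piMr ?sqr_ge0 // expr_le1.
  have := sqr_ge0 (w - k * t); nra.
lra.
Qed.

Section Solution.
Context q l (l0 : 0 < l) (intq : integ 0 l q).
Notation u lam := (phi q lam).
Notation v lam := (dphi q lam).

(** Gronwall's inequality applied to [- (v ^ 2 + u ^ 2)] with a negative rate: starting from [1],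
    the sum of squares decays at most exponentially. *)
Lemma csol_nonzero lam x : 0 <= x <= l -> 0 < v lam x * v lam x + u lam x * u lam x.
Proof.
move=> /andP[x0 xl]; have [hu hv] := @csol_phi _ q l lam l0 intq.
pose g y := `|q y| + (1 + `|lam|).
have intg : integ 0 l g by apply: integD (integ_norm intq) (integ_cst _ _ _).
have hS := acdN (acdD (acdM hv hv) (acdM hu hu)).
have := acd_gronwall x0 (acd_sub (lexx 0) xl hS) (acd_sub (lexx 0) xl (acdN (acd_prim intg))).
rewrite /= phi0 dphi0 prim0 oppr0 oppr0 expR0 !mulr1 mulr0 addr0 opprK => h.
have {}h : - (v lam x * v lam x + u lam x * u lam x) * expR (prim 0 g x) <= - 1.
  apply: h; apply: aaeW => y _.
  have h1 := ler_norm (q y); have h2 := ler_norm (- q y).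
  have h3 := ler_norm lam; have h4 := ler_norm (- lam).
  rewrite !normrN in h2 h4.
  set U := u lam y; set V := v lam y; rewrite /g.
  have : - (1 + q y - lam) * (2 * (U * V)) <= (`|q y| + (1 + `|lam|)) * (V * V + U * U).
    set P := 2 * (U * V); set S := V * V + U * U.
    have k3 : `|P| <= S.
      rewrite ler_norml /P /S; have := sqr_ge0 (U + V); have := sqr_ge0 (U - V).
      by rewrite !expr2 => *; apply/andP; split; nra.
    apply: le_trans (ler_norm _) _; rewrite normrM ler_pM //.
    by rewrite ler_norml; apply/andP; split; lra.
  lra.
have e0 := expR_gt0 (prim 0 g x).
by rewrite ltNge; apply/negP => h5; nra.
Qed.

(** Only the primitive [P] of [q] is bounded, so [u'] is replaced by the quasi-derivative
    [g = v - P u]. Then [u g] has derivative [g^2 + (kappa^2 - P^2) u^2 >= 0]; being positive near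
    [0], it stays positive, and [u] cannot vanish. *)
Lemma phi_gt0 kappa x : (forall y, 0 <= y <= l -> `|prim 0 q y| <= kappa) ->
  0 < x <= l -> 0 < u (- kappa ^+ 2) x.
Proof.
move=> hk; set lam := - kappa ^+ 2; have [hu hv] := @csol_phi _ q l lam l0 intq.
pose P := prim 0 q; have hP := acd_prim intq.
pose g y := v lam y - P y * u lam y.
have hg : acd 0 l g (fun y => kappa ^+ 2 * u lam y - P y * v lam y).
  by apply: acd_eq (acdB hv (acdM hP hu)) _ => y _; rewrite /lam /P; ring.
have mono y z : 0 <= y -> y <= z -> z <= l -> u lam y * g y <= u lam z * g z.
  move=> y0 yz zl; rewrite -lerN2; apply: (acd_le yz (acdN (acd_sub y0 zl (acdM hu hg)))).
  apply: aaeW => w /andP[yw wz]; rewrite oppr_le0.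
  have Pk : `|P w| <= kappa by apply: hk; apply/andP; split; lra.
  have k2 : P w ^+ 2 <= kappa ^+ 2.
    move: Pk; rewrite ler_norml => /andP[p1 p2].
    by rewrite -subr_ge0 subr_sqr mulr_ge0 //; lra.
  rewrite (_ : _ + _ = g w ^+ 2 + (kappa ^+ 2 - P w ^+ 2) * u lam w ^+ 2).
    by rewrite addr_ge0 ?sqr_ge0 // mulr_ge0 ?sqr_ge0 // subr_ge0.
  by rewrite /g; ring.
have h2 : 0 < 2^-1 :> R by rewrite invr_gt0.
have [d1 d10 H1] := absolutely_continuous_unif (proj1 hv) h2.
have [d2 d20 H2] := absolutely_continuous_unif (proj1 hg) h2.
(* On [[0, d]] both [v] and [g] stay within [1/2] of their initial value [1]. *)
pose d := Num.min l (Num.min d1 d2 / 2).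
have d0 : 0 < d by rewrite !lt_min l0 divr_gt0 // lt_min d10.
have dl : d <= l by rewrite ge_min lexx.
have dd1 : d < d1.
  have m1 : Num.min d1 d2 <= d1 by rewrite ge_min lexx.
  have : d <= Num.min d1 d2 / 2 by rewrite ge_min lexx orbT.
  lra.
have dd2 : d < d2.
  have m1 : Num.min d1 d2 <= d2 by rewrite ge_min lexx orbT.
  have : d <= Num.min d1 d2 / 2 by rewrite ge_min lexx orbT.
  lra.
have l00 : (0 : R) <= 0 <= l by rewrite lexx ltW.
have small y : 0 < y <= d -> 0 < u lam y /\ 0 < g y.
  move=> /andP[y0 yd]; have yl : y <= l := le_trans yd dl.
  have vy z : 0 <= z <= y -> 2^-1 <= v lam z.
    move=> /andP[z0 zy]; have zl : 0 <= z <= l by apply/andP; split; lra.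
    have : `|z - 0| < d1 by rewrite subr0 ger0_norm //; lra.
    by move=> /(H1 z 0 zl l00); rewrite dphi0 ltr_norml => /andP[h _]; lra.
  split.
    have hu' := acdB (acdZ 2^-1 (acd_id 0 y)) (acd_sub (lexx 0) yl hu).
    have := acd_le (ltW y0) hu'; rewrite phi0 mulr0 subr0 => h.
    have {}h : 2^-1 * y - u lam y <= 0.
      apply: h; apply: aaeW => z /andP[z0 zy].
      by rewrite mulr1 subr_le0; apply: vy; rewrite !ltW.
    have : 0 < 2^-1 * y by rewrite mulr_gt0.
    lra.
  have yl' : 0 <= y <= l by apply/andP; split; lra.
  have : `|y - 0| < d2 by rewrite subr0 gtr0_norm //; lra.
  move=> /(H2 y 0 yl' l00); rewrite /g dphi0 phi0 mulr0 subr0 ltr_norml => /andP[h _]; lra.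
have nz y : 0 < y <= l -> u lam y != 0.
  move=> /andP[y0 yl]; apply/eqP => uy.
  pose z := Num.min y d.
  have z0 : 0 < z by rewrite lt_min y0.
  have [h3 h4] : 0 < u lam z /\ 0 < g z by apply: small; rewrite z0 ge_min lexx orbT.
  have := mono z y (ltW z0); rewrite ge_min lexx uy mul0r => /(_ isT yl).
  by rewrite leNgt mulr_gt0.
move=> /andP[x0 xl]; rewrite ltNge; apply/negP => ux.
pose z := Num.min x d.
have z0 : 0 < z by rewrite lt_min x0.
have zx : z <= x by rewrite ge_min lexx.
have [h3 _] : 0 < u lam z /\ 0 < g z by apply: small; rewrite z0 ge_min lexx orbT.
have cu : {within `[z, x], continuous (u lam)}.
  exact: acd_within (acd_sub (ltW z0) xl hu).
have [|w] := IVT zx cu (v := 0).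
  by rewrite ge_min ux orbT le_max (ltW h3).
rewrite in_itv /= => /andP[zw wx] /eqP; apply/negP; apply: nz.
by rewrite (lt_le_trans z0 zw) (le_trans wx xl).
Qed.

Section Angle.
Context (K : R) (K0 : 0 < K).

Definition pruefer_norm lam x := v lam x * v lam x + K ^+ 2 * (u lam x * u lam x).

(** The derivative of the angle [theta] with [tan theta = K u / v], computed from [u] and [v]. The
    angle is then defined by integration, without solving a nonlinear equation or choosing branches,
    and its relation to [u] and [v] becomes a lemma. *)
Definition pruefer_rate lam x :=
  K * (v lam x * v lam x - (q x - lam) * (u lam x * u lam x)) * (pruefer_norm lam x)^-1.

Definition pruefer lam := prim 0 (pruefer_rate lam).

Lemma pruefer_norm_gt0 lam x : 0 <= x <= l -> 0 < pruefer_norm lam x.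
Proof.
move=> xl; have := csol_nonzero lam xl; rewrite /pruefer_norm.
set U := u lam x; set V := v lam x => h.
have K2 : 0 < K ^+ 2 by rewrite exprn_gt0.
have U0 : 0 <= U * U by rewrite -expr2 sqr_ge0.
have V0 : 0 <= V * V by rewrite -expr2 sqr_ge0.
have [U1|U1] := eqVneq (U * U) 0; first by move: h; rewrite U1 mulr0.
by rewrite ltr_wpDl // mulr_gt0 // lt_neqAle eq_sym U1.
Qed.

Lemma pruefer_norm_within lam : {within `[0, l], continuous (pruefer_norm lam)}.
Proof.
have [hu hv] := @csol_phi _ q l lam l0 intq.
exact: acd_within (acdD (acdM hv hv) (acdZ _ (acdM hu hu))).
Qed.

Lemma pruefer_inv_within lam : {within `[0, l], continuous (fun x => (pruefer_norm lam x)^-1)}.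
Proof.
apply: within_inv; first exact: pruefer_norm_within.
by move=> x xl; rewrite gt_eqF // pruefer_norm_gt0.
Qed.

Lemma integ_pruefer_rate lam : integ 0 l (pruefer_rate lam).
Proof.
have [hu hv] := @csol_phi _ q l lam l0 intq.
apply: (@integM_within _ 0 l
  (fun x => K * (v lam x * v lam x - (q x - lam) * (u lam x * u lam x)))
  (fun x => (pruefer_norm lam x)^-1)); last exact: pruefer_inv_within.
rewrite (_ : (fun x => _) = (fun x => K * (v lam x * v lam x) - (q x - lam) * (K * (u lam x * u lam x)))).
  apply: integB; first exact: integ_within (acd_within (acdZ _ (acdM hv hv))).
  by apply: integM_within (acd_within (acdZ _ (acdM hu hu))); apply: integB => //; exact: integ_cst.
by apply/funext => x; ring.
Qed.

Lemma acd_pruefer lam : acd 0 l (pruefer lam) (pruefer_rate lam).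
Proof. exact: acd_prim (integ_pruefer_rate lam). Qed.

(** The defect [K u cos theta - v sin theta] solves a linear homogeneous equation with coefficient
    [h] and vanishes at [0]; Gronwall's inequality for its square shows that it is zero. *)
Lemma pruefer_relation lam x : 0 <= x <= l ->
  K * u lam x * cos (pruefer lam x) = v lam x * sin (pruefer lam x).
Proof.
move=> /andP[x0 xl]; have [hu hv] := @csol_phi _ q l lam l0 intq.
have hth := acd_pruefer lam.
pose th := pruefer lam; pose S := pruefer_norm lam.
pose h y := (q y - lam + K ^+ 2) * (u lam y * v lam y * (S y)^-1).
have inth : integ 0 l h.
  apply: integM_within; first by apply: integD (integ_cst _ _ _); apply: integB => //; exact: integ_cst.
  by apply: within_mul; [exact: (acd_within (acdM hu hv))|exact: pruefer_inv_within].
pose D y := K * u lam y * cos (th y) - v lam y * sin (th y).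
have hD : acd 0 l D (fun y => h y * D y).
  apply: acd_eq (acdB (acdM (acdZ K hu) (acd_cos hth)) (acdM hv (acd_sin hth))) _.
  move=> y /andP[y0 yl].
  have S0 : 0 < S y by apply: pruefer_norm_gt0; apply/andP; split; exact: ltW.
  rewrite /h /D /pruefer_rate -/th -/(S y); move: S0.
  rewrite /S /pruefer_norm; set U := u lam y; set V := v lam y; set c := cos _; set s := sin _.
  by move=> S0; field; rewrite gt_eqF.
have hDD := acdM hD hD.
have := acd_gronwall x0 (acd_sub (lexx 0) xl hDD) (acd_sub (lexx 0) xl (acdZ 2 (acd_prim inth))).
have D0 : D 0 = 0.
  by rewrite /D phi0 /th /pruefer prim0 sin0 !mulr0 mul0r subrr.
rewrite /= D0 !mul0r => H; have {}H : D x * D x <= 0.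
  rewrite -(pmulr_lle0 _ (expR_gt0 (- (2 * prim 0 h x)))); apply: H.
  by apply: aaeW => y _; rewrite le_eqVlt; apply/orP; left; apply/eqP; ring.
have : D x ^+ 2 = 0 by apply/le_anti; rewrite sqr_ge0 expr2 H.
by move/eqP; rewrite sqrf_eq0 subr_eq0 => /eqP.
Qed.

Lemma pruefer_rateE lam x : 0 <= x <= l ->
  pruefer_rate lam x = K * cos (pruefer lam x) ^+ 2 - (q x - lam) / K * sin (pruefer lam x) ^+ 2.
Proof.
move=> xl; have S0 := pruefer_norm_gt0 lam xl; have E := pruefer_relation lam xl.
rewrite /pruefer_rate; move: S0 E; rewrite /pruefer_norm.
set U := u lam x; set V := v lam x; set c := cos _; set s := sin _ => S0 E.
have c2 : c ^+ 2 = 1 - s ^+ 2 by exact: cos_sqrE.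
(* [W] is the signed radius: [(K U, V)] is [W] times [(s, c)]. *)
pose W := K * U * s + V * c.
have eU : K * U = W * s.
  have -> : W * s = K * U * (1 - c ^+ 2) + V * s * c by rewrite c2 /W; ring.
  by rewrite -E; ring.
have eV : V = W * c.
  have -> : W * c = V * (1 - s ^+ 2) + K * U * c * s by rewrite -c2 /W; ring.
  by rewrite E; ring.
have eS : V * V + K ^+ 2 * (U * U) = W ^+ 2.
  have -> : K ^+ 2 * (U * U) = (K * U) ^+ 2 by ring.
  rewrite eU {1 2}eV (_ : W * c * (W * c) = W ^+ 2 * c ^+ 2); last ring.
  by rewrite c2; ring.
rewrite eS in S0 *; have W0 : W != 0 by apply/eqP => W0; rewrite W0 expr0n ltxx in S0.
have -> : U = W * s / K by rewrite -eU mulrAC divff ?mul1r // gt_eqF.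
rewrite {1 2}eV; field; rewrite W0 gt_eqF //.
Qed.

(** At [lam = K ^+ 2] the rate is [K - q sin^2 / K], so the free angle [K l] is missed by at most
    the norm of [q] over [K]. *)
Lemma pruefer_lower : K * l - prim 0 (fun y => `|q y|) l / K <= pruefer (K ^+ 2) l.
Proof.
have hF := acdB (acdB (acdZ K (acd_id 0 l)) (acdZ K^-1 (acd_prim (integ_norm intq))))
  (acd_pruefer (K ^+ 2)).
have := acd_le (ltW l0) hF; rewrite /= /pruefer !prim0 !mulr0 !subr0 -/(pruefer _ _) => h.
have {}h := h _; rewrite mulrC [X in _ - X]mulrC -subr_le0 [l * K]mulrC; apply: h.
apply: aaeW => y /andP[y0 yl]; rewrite mulr1 pruefer_rateE; last by rewrite !ltW.
set c := cos _; set s := sin _.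
have c2 : c ^+ 2 = 1 - s ^+ 2 by exact: cos_sqrE.
rewrite c2 (_ : _ - _ = K^-1 * (q y * s ^+ 2 - `|q y|)); last by field; rewrite gt_eqF.
rewrite pmulr_rle0 ?invr_gt0 // subr_le0; apply: le_trans (ler_norm _) _.
rewrite normrM ler_piMr // ger0_norm ?sqr_ge0 //.
by have := sqr_ge0 c; rewrite c2; lra.
Qed.

(** Continuity of the final angle in [lam], which allows the intermediate value theorem to be
    applied in the spectral parameter. *)
Lemma pruefer_lipschitz B : 0 <= B -> exists2 C : R, 0 <= C &
  forall lam mu, `|lam| <= B -> `|mu| <= B ->
  `|pruefer lam l - pruefer mu l| <= C * `|lam - mu|.
Proof.
move=> B0; pose h y := 4 * (K + (`|q y| + B) / K) + 1.
have inth : integ 0 l h.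
  apply: integD (integ_cst _ _ _); rewrite (_ : (fun x => _) = fun x => (`|q x| + (B + K * K)) * (4 / K)).
    by apply: integM_within (acd_within (acd_cst _ _ _)); apply: integD (integ_norm intq) (integ_cst _ _ _).
  by apply/funext => y; field; rewrite gt_eqF.
have h0 y : 0 <= h y by rewrite addr_ge0 // mulr_ge0 // addr_ge0 ?(ltW K0) // divr_ge0 ?addr_ge0 // ltW.
have hA := acd_prim inth; pose A := prim 0 h.
have A0 y : 0 <= y <= l -> 0 <= A y by move=> /andP[y0 yl]; exact: (prim_ge0 inth).
pose C2 := expR (A l) * l / K ^+ 2.
have C20 : 0 <= C2 by rewrite divr_ge0 ?sqr_ge0 // mulr_ge0 ?expR_ge0 // ltW.
exists (Num.sqrt C2); first exact: sqrtr_ge0.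
move=> lam mu hl hm; pose w y := pruefer lam y - pruefer mu y.
pose X := (lam - mu) ^+ 2 / K ^+ 2; have X0 : 0 <= X by rewrite divr_ge0 ?sqr_ge0.
have hw := acdB (acd_pruefer lam) (acd_pruefer mu).
have hF := acdB (acdM (acdM hw hw) (acd_expR (acdN hA))) (acdZ X (acd_id 0 l)).
have H : w l * w l * expR (- A l) - X * l <= w 0 * w 0 * expR (- A 0) - X * 0.
  apply: (acd_le (ltW l0) hF); apply: aaeW => y /andP[y0 yl].
  have yl' : 0 <= y <= l by rewrite !ltW.
  have := pruefer_rate_diff (q y) (pruefer lam y) (pruefer mu y) K0 hl hm.
  rewrite -!pruefer_rateE // -/(h y) -/X; have := A0 y yl'; rewrite /A.
  move: (pruefer_rate lam y) (pruefer_rate mu y) (pruefer lam y) (pruefer mu y) => r1 r2 a b.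
  move: (h y) (prim 0 h y) => hy Ay Ay0 bd.
  have e0 := expR_gt0 (- Ay); have e1 : expR (- Ay) <= 1 by rewrite -expR0 ler_expR oppr_le0.
  move: (expR (- Ay)) e0 e1 => e e0 e1.
  rewrite (_ : _ - _ = e * (2 * ((a - b) * (r1 - r2)) - hy * ((a - b) * (a - b))) - X); last by ring.
  rewrite subr_le0; apply: (@le_trans _ _ (e * X)); last by rewrite ler_piMl.
  by rewrite ler_pM2l // lerBlDl.
have w0 : w 0 = 0 by rewrite /w /pruefer !prim0 subrr.
rewrite w0 !mul0r mulr0 subrr subr_le0 in H.
have {}H : w l ^+ 2 <= C2 * (lam - mu) ^+ 2.
  have -> : C2 * (lam - mu) ^+ 2 = (X * l) * expR (A l) by rewrite /C2 /X; ring.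
  by rewrite -ler_pdivrMr ?expR_gt0 // -expRN expr2.
by have := ler_wsqrtr H; rewrite sqrtr_sqr sqrtrM // sqrtr_sqr.
Qed.

End Angle.

End Solution.

End Pruefer.

(** * Number and size of the Dirichlet zeros *)

Section DirichletZeros.
Context {R : realType}.
Implicit Types (q : R -> R) (l x y lam : R).

Lemma sin_natpi n : sin (pi * n%:R) = 0 :> R.
Proof.
elim: n => [|n IH]; first by rewrite mulr0 sin0.
by rewrite -natr1 mulrDr mulr1 sinDpi IH oppr0.
Qed.

Lemma cos_natpi_neq0 n : cos (pi * n%:R) != 0 :> R.
Proof.
elim: n => [|n IH]; first by rewrite mulr0 cos0 oner_eq0.
by rewrite -natr1 mulrDr mulr1 cosDpi oppr_eq0.
Qed.

Lemma lipschitz_within (f : R -> R) (a c C : R) : 0 <= C ->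
  (forall x y, a <= x <= c -> a <= y <= c -> `|f x - f y| <= C * `|x - y|) ->
  {within `[a, c], continuous f}.
Proof.
move=> C0 hf; apply/subspace_continuousP => x /=; rewrite in_itv /= => xac.
apply/cvgrPdist_lt => e e0; have C1 : 0 < C + 1 by lra.
exists (e / (C + 1)) => /=; first by rewrite divr_gt0.
move=> y /= xy; rewrite in_itv /= => yac; apply: le_lt_trans (hf x y xac yac) _.
by move: xy; rewrite /ball /= ltr_pdivlMr //; have := normr_ge0 (x - y); nra.
Qed.

Lemma phi_zero_of_angle q l K lam n : 0 < l -> integ 0 l q -> 0 < K ->
  pruefer q K lam l = pi * n%:R -> phi q lam l = 0.
Proof.
move=> l0 intq K0 E; have ll : 0 <= l <= l by rewrite lexx ltW.
have := pruefer_relation l0 intq K0 lam ll; rewrite E sin_natpi mulr0 => /eqP.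
rewrite !mulf_eq0 (negbTE (cos_natpi_neq0 n)) orbF gt_eqF //= => /eqP; exact.
Qed.

(** An angle starting at [0] would have to pass through [pi] at some positive point, where the
    solution would vanish against its positivity. *)
Lemma pruefer_lt_pi q l K kappa : 0 < l -> integ 0 l q -> 0 < K ->
  (forall y, 0 <= y <= l -> `|prim 0 q y| <= kappa) -> pruefer q K (- kappa ^+ 2) l < pi.
Proof.
move=> l0 intq K0 hk; rewrite ltNge; apply/negP => hpi.
have cth := acd_within (acd_pruefer l0 intq K0 (- kappa ^+ 2)).
have p0 : pruefer q K (- kappa ^+ 2) 0 = 0 by exact: prim0.
have [|x] := IVT (ltW l0) cth (v := pi).
  by rewrite p0 ge_min (ltW (pi_gt0 R)) /= le_max hpi orbT.
rewrite in_itv /= => /andP[x0 xl] hx.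
have xl' : 0 <= x <= l by rewrite x0.
have x0' : 0 < x.
  rewrite lt_neqAle x0 andbT; apply/eqP => E; move: hx; rewrite -E p0 => /eqP.
  by rewrite lt_eqF ?pi_gt0.
have := pruefer_relation l0 intq K0 (- kappa ^+ 2) xl'.
rewrite hx cospi sinpi mulr0 mulrN1 => /eqP; rewrite oppr_eq0 mulf_eq0 gt_eqF //=.
by rewrite gt_eqF //; apply: (phi_gt0 l0 intq hk); rewrite x0'.
Qed.

Lemma prim_norm_le q l y : integ 0 l q -> 0 <= y <= l ->
  `|prim 0 q y| <= prim 0 (fun x => `|q x|) l.
Proof.
move=> intq /andP[y0 yl]; have intn := integ_norm intq.
apply: (@le_trans _ _ (prim 0 (fun x => `|q x|) y)); last exact: (prim_le intn).
apply: (acd_norm_le y0 (acd_sub (lexx 0) yl (acd_prim intq)) (acd_sub (lexx 0) yl (acd_prim intn))).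
  by rewrite !prim0 normr0.
exact: aaeW.
Qed.

(** Between [lam = - Q ^+ 2] and [lam = K ^+ 2] the final angle passes from below [pi] to at least
    [pi * n.+1], and each multiple of [pi] on the way gives a zero. The scale [K] depends on [n], so
    each [n] has its own list, with no relation claimed between the lists. *)
Lemma dirichlet_zeros q l : 0 < l -> integ 0 l q -> exists C : R, forall n,
  exists s : seq R, [/\ uniq s, size s = n.+1 &
    forall z, z \in s -> phi q z l = 0 /\ `|z| <= (pi * n.+1%:R / l) ^+ 2 + C].
Proof.
move=> l0 intq; pose Q := prim 0 (fun x => `|q x|) l.
have Q0 : 0 <= Q by apply: (prim_ge0 (integ_norm intq)) => //; exact: ltW.
(* With [K^2 = a^2 + c], the inequality [2 a K <= a^2 + K^2] gives [a l <= K l - Q / K], so the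
   lower bound for the angle reaches [pi * n.+1]. *)
pose c := 2 * Q / l; have c0 : 0 <= c by rewrite divr_ge0 ?mulr_ge0 // ltW.
exists (c + Q ^+ 2) => n; pose a : R := pi * n.+1%:R / l.
have pi0 := pi_gt0 R.
have a0 : 0 < a by rewrite divr_gt0 // mulr_gt0.
pose K := Num.sqrt (a ^+ 2 + c).
have ac : 0 < a ^+ 2 + c by rewrite ltr_wpDr // exprn_gt0.
have K0 : 0 < K by rewrite sqrtr_gt0.
have K2 : K ^+ 2 = a ^+ 2 + c by rewrite sqr_sqrtr // ltW.
have hk y : 0 <= y <= l -> `|prim 0 q y| <= Q by exact: prim_norm_le.
pose T lam := pruefer q K lam l.
have T1 : T (- Q ^+ 2) < pi by exact: (pruefer_lt_pi l0 intq K0 hk).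
have T2 : pi * n.+1%:R <= T (K ^+ 2).
  apply: le_trans (pruefer_lower l0 intq K0); rewrite -/Q.
  have aK : a <= K.
    rewrite -(@ler_pXn2r _ 2) ?nnegrE ?(ltW a0) ?(ltW K0) // K2; lra.
  have -> : pi * n.+1%:R = a * l by rewrite /a divfK // gt_eqF.
  have cl : c * l = 2 * Q by rewrite /c divfK // gt_eqF.
  rewrite lerBrDr -lerBrDl ler_pdivrMr //.
  have h1 : 0 <= (K - a) ^+ 2 * l by rewrite mulr_ge0 ?sqr_ge0 // ltW.
  have h2 : K ^+ 2 * l = a ^+ 2 * l + 2 * Q by rewrite K2 mulrDl cl.
  nra.
have hT z j : T z = pi * j%:R -> phi q z l = 0 by exact: phi_zero_of_angle.
have hlip B : 0 <= B -> exists2 C : R, 0 <= C & forall lam mu, `|lam| <= B -> `|mu| <= B ->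
    `|T lam - T mu| <= C * `|lam - mu| by exact: pruefer_lipschitz.
rewrite -/a; clearbody T K c a Q => {hk}.
pose B := Q ^+ 2 + K ^+ 2.
have Q2 : 0 <= Q ^+ 2 by exact: sqr_ge0.
have K20 : 0 <= K ^+ 2 by exact: sqr_ge0.
have BE (z : R) : - Q ^+ 2 <= z <= K ^+ 2 -> `|z| <= B.
  by move=> /andP[z1 z2]; rewrite ler_norml /B; apply/andP; split; lra.
have [C C0 HC] := hlip B (addr_ge0 Q2 K20).
have cT : {within `[- Q ^+ 2, K ^+ 2], continuous T}.
  by apply: (lipschitz_within C0) => x y hx hy; apply: HC; exact: BE.
have hz j : (0 < j <= n.+1)%N -> exists2 z : R, - Q ^+ 2 <= z <= K ^+ 2 & T z = pi * j%:R.
  move=> /andP[j0 jn].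
  have h1 : pi <= pi * j%:R :> R by rewrite ler_peMr ?ler1n // ltW.
  have h2 : pi * j%:R <= pi * n.+1%:R :> R by rewrite ler_wpM2l ?ler_nat // ltW.
  have QK : - Q ^+ 2 <= K ^+ 2 by lra.
  have [|z] := IVT QK cT (v := pi * j%:R).
    by rewrite ge_min le_max (le_trans h2 T2) orbT (ltW (lt_le_trans T1 h1)).
  by rewrite in_itv /= => zz E; exists z.
have [z hzz] : exists z : nat -> R, forall j, (0 < j <= n.+1)%N ->
    - Q ^+ 2 <= z j <= K ^+ 2 /\ T (z j) = pi * j%:R.
  have k (j : nat) : {z : R | (0 < j <= n.+1)%N -> - Q ^+ 2 <= z <= K ^+ 2 /\ T z = pi * j%:R}.
    apply: cid; case: (boolP (0 < j <= n.+1)%N) => [/hz[z h1 h2]|_]; last by exists 0.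
    by exists z.
  by exists (fun j => projT1 (k j)) => j; exact: (projT2 (k j)).
exists [seq z j | j <- iota 1 n.+1]; split.
- rewrite map_inj_in_uniq ?iota_uniq // => i j; rewrite !mem_iota => hi hj E.
  have hi' : (0 < i <= n.+1)%N by move: hi; rewrite add1n ltnS.
  have hj' : (0 < j <= n.+1)%N by move: hj; rewrite add1n ltnS.
  have [_ e1] := hzz i hi'; have [_ e2] := hzz j hj'.
  by move: e1; rewrite E e2 => /(mulfI (lt0r_neq0 pi0)) /eqP; rewrite eqr_nat => /eqP.
- by rewrite size_map size_iota.
- move=> _ /mapP[j + ->]; rewrite mem_iota add1n ltnS => hj.
  have [h1 h2] := hzz j hj; split; first exact: hT h2.
  by apply: le_trans (BE _ h1) _; rewrite /B K2 [leLHS]addrC addrA.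
Qed.

(** At stage [n] only [n] values have been used, so one of the [n.+1] candidates is new. *)
Lemma greedy_choice (P : nat -> R -> Prop) :
  (forall n, exists s : seq R, [/\ uniq s, size s = n.+1 & forall z, z \in s -> P n z]) ->
  exists z : nat -> R, injective z /\ forall n, P n (z n).
Proof.
move=> h; have [s hs] := choice h.
pose pick (L : seq R) := head 0 [seq x <- s (size L) | x \notin L].
pose zl := fix zl n : seq R := if n is n'.+1 then rcons (zl n') (pick (zl n')) else [::].
have szl n : size (zl n) = n by elim: n => //= n IH; rewrite size_rcons IH.
have hp n : pick (zl n) \in s n /\ pick (zl n) \notin zl n.
  have [us ss _] := hs n; have : has (fun x => x \notin zl n) (s n).
    apply/negPn/negP => /hasPn hall.
    have /(uniq_leq_size us) : {subset s n <= zl n} by move=> x /hall; rewrite negbK.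
    by rewrite ss szl ltnn.
  rewrite has_filter /pick szl; case E : [seq _ <- _ | _] => [//|x t] _ /=.
  have : x \in [seq x <- s n | x \notin zl n] by rewrite E mem_head.
  by rewrite mem_filter => /andP[].
have sub m n : (m < n)%N -> pick (zl m) \in zl n.
  elim: n => // n IH; rewrite ltnS leq_eqVlt => /predU1P[->|/IH h'] /=.
    by rewrite mem_rcons mem_head.
  by rewrite mem_rcons inE h' orbT.
exists (fun n => pick (zl n)); split; last first.
  by move=> n; have [_ _] := hs n; apply; case: (hp n).
move=> i j E; have [ij|ji|//] := ltngtP i j.
  by have [_] := hp j; rewrite -E sub.
by have [_] := hp i; rewrite E sub.
Qed.

Lemma dirichlet_zero_sequence q l : 0 < l -> integ 0 l q -> exists (C : R) (z : nat -> R),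
  injective z /\ forall n, phi q (z n) l = 0 /\ `|z n| <= (pi * n.+1%:R / l) ^+ 2 + C.
Proof.
move=> l0 intq; have [C hC] := dirichlet_zeros l0 intq.
have [z hz] := greedy_choice hC.
by exists C, z.
Qed.

End DirichletZeros.

(** * Dirichlet eigenvalues as zeros of [phi], and symmetries of the solutions *)

Section DirichletProblem.
Context {R : realType}.
Implicit Types (q u v : R -> R) (l x y lam c : R).
Notation mu := (@lebesgue_measure R).

Lemma phi_prim q l lam x : 0 < l -> integ 0 l q -> 0 <= x <= l ->
  phi q lam x = prim 0 (dphi q lam) x.
Proof.
move=> l0 intq /andP[x0 xl]; have [hu hv] := @csol_phi _ q l lam l0 intq.
have hP := acd_prim (integ_within (acd_within hv)).
have := acd_const x0 (acd_sub (lexx 0) xl (acdB hu hP)).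
rewrite phi0 prim0 subrr => h; apply/eqP; rewrite -subr_eq0; apply/eqP; apply: h.
by apply: aaeW => y _; rewrite subrr.
Qed.

(** Continuity of [dphi] upgrades differentiability from almost every point to every interior point,
    as the notion of a solution demands. *)
Lemma phi_is_derive q l lam x : 0 < l -> integ 0 l q -> 0 < x < l ->
  is_derive x 1 (phi q lam) (dphi q lam x).
Proof.
move=> l0 intq xl; have [hu hv] := @csol_phi _ q l lam l0 intq.
apply: near_eq_is_derive (prim_derive xl (acd_within hv)).
case/andP: xl => x0 xl; near=> y; apply/esym/(phi_prim _ l0 intq).
by apply/andP; split; apply: ltW; near: y; [exact: lt_nbhsr|exact: lt_nbhsl].
Unshelve. all: by end_near. Qed.

Lemma schrodinger_csol q lam u : schrodinger_solution q lam u -> exists v, csol q lam 1 u v.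
Proof.
move=> [v [cu du acv aev]]; exists v; split.
  have [M _ HM] := absolutely_continuous_bounded acv.
  by apply: acd_C1 => //; exists M => x /andP[x0 x1]; apply: HM; rewrite (ltW x0) (ltW x1).
split => //; apply: aae_imply (aev : aae 0 1 _) _ => x _ [dv E].
by split => //; lra.
Qed.

Lemma eigenvalue_phi q lam : integ 0 1 q -> dirichlet_eigenvalue q lam -> phi q lam 1 = 0.
Proof.
move=> intq [u [su u0 u1 [x xl ux]]]; have [v hv] := schrodinger_csol su.
have h := csol_unique (ltr01 : 0 < 1 :> R) intq hv u0.
have [E _] := h x xl; have l1 : (0 : R) <= (1 : R) <= (1 : R) by rewrite ler01 lexx.
have [/eqP] := h 1 l1; rewrite u1 eq_sym mulf_eq0 => /orP[/eqP v0|/eqP->//].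
by move: ux; rewrite E v0 mul0r eqxx.
Qed.

Lemma phi_eigenvalue q lam : integ 0 1 q -> phi q lam 1 = 0 -> dirichlet_eigenvalue q lam.
Proof.
move=> intq phi1; have l0 : 0 < 1 :> R by [].
have [hu hv] := @csol_phi _ q 1 lam l0 intq.
exists (phi q lam); split => //; first last.
(* If [phi] were trivial, [dphi] would be constantly [1], forcing [phi] to be [1] at the right
   end. *)
- apply: contrapT => hn.
  have uz x : 0 <= x <= 1 -> phi q lam x = 0.
    by move=> xl; apply/eqP/negP => ux; apply: hn; exists x => //; exact/negP.
  have dv1 x : 0 <= x <= 1 -> dphi q lam x = 1.
    move=> /andP[x0 xl]; have := acd_const x0 (acd_sub (lexx 0) xl hv); rewrite dphi0; apply.
    by apply: aaeW => y /andP[y0 yx]; rewrite uz ?mulr0 // ltW //= (le_trans (ltW yx)).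
  have := acd_const ler01 (acdB hu (acd_id 0 1)); rewrite phi0 phi1 !sub0r => h.
  have /eqP : - 1 = - 0 :> R.
    by apply: h; apply: aaeW => y /andP[y0 y1]; rewrite dv1 ?subrr // !ltW.
  by rewrite oppr0 oppr_eq0 oner_eq0.
- exact: phi0.
exists (dphi q lam); split.
- exact: acd_within hu.
- by move=> x xl; exact: (phi_is_derive lam l0 intq).
- by case: hv.
- case: hv => _; apply: negligibleS => x /= h h'; apply: h => x01.
  by have [dv E] := h' x01; split => //; rewrite E; ring.
Qed.

Lemma pigeonhole_nat n (f : nat -> nat) : (0 < n)%N ->
  (forall k, (0 < f k)%N) -> injective f -> exists2 k, (k < n)%N & (n <= f k)%N.
Proof.
move=> n0 f0 finj; apply: contrapT => h.
have hf k : (k < n)%N -> (f k < n)%N.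
  by move=> kn; rewrite ltnNge; apply/negP => nf; apply: h; exists k.
have us : uniq [seq f k | k <- iota 0 n] by rewrite map_inj_uniq ?iota_uniq.
have ss : {subset [seq f k | k <- iota 0 n] <= iota 1 n.-1}.
  move=> _ /mapP[k + ->]; rewrite !mem_iota /= add0n => /hf; rewrite f0 /=.
  by rewrite add1n prednK.
have := uniq_leq_size us ss.
by rewrite size_map !size_iota leqNgt prednK // leqnn.
Qed.

(** The zeros found by the angle are eigenvalues with distinct positive indices. Among the first [n]
    of them some index is at least [n], so [lambda n] lies below a zero of controlled size;
    [lambda 1] bounds it from below. *)
Lemma spectrum_bound q lambda : integ 0 1 q -> dirichlet_spectrum q lambda ->
  exists C : R, forall n, (0 < n)%N -> `|lambda n| <= (pi * n%:R) ^+ 2 + C.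
Proof.
move=> intq [mono hsp]; have [C [z [zinj hz]]] := dirichlet_zero_sequence ltr01 intq.
have hk k : exists i, (0 < i)%N /\ z k = lambda i.
  have [hz0 _] := hz k.
  by have [i i0 E] := (iffLR (hsp (z k)) (phi_eigenvalue intq hz0)); exists i.
have [f hf] := choice hk.
have finj : injective f.
  by move=> i j E; apply: zinj; have [_ ->] := hf i; have [_ ->] := hf j; rewrite E.
have ple i j : (0 < i <= j)%N -> lambda i <= lambda j.
  move=> /andP[i0]; rewrite leq_eqVlt => /predU1P[->//|ij].
  by apply/ltW/mono; rewrite i0.
exists (`|C| + `|lambda 1%N|) => n n0.
have [k kn nf] := pigeonhole_nat n0 (fun k => proj1 (hf k)) finj.
have h1 : lambda n <= lambda (f k) by apply: ple; rewrite n0.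
have h2 : lambda 1%N <= lambda n by apply: ple.
have [_ Ek] := hf k; have [_ hzk] := hz k; rewrite divr1 in hzk.
have h3 : (pi * k.+1%:R) ^+ 2 <= (pi * n%:R) ^+ 2 :> R.
  have p0 := pi_ge0 R.
  by rewrite lerXn2r ?nnegrE ?mulr_ge0 // ler_wpM2l // ler_nat.
have h4 := ler_norm (z k); rewrite Ek in h4 hzk.
have h5 := ler_norm C; have h6 := normr_ge0 (lambda 1%N); have h7 := normr_ge0 C.
have h8 : - `|lambda 1%N| <= lambda 1%N by rewrite lerNl -normrN ler_norm.
have h9 : 0 <= (pi * n%:R) ^+ 2 :> R by exact: sqr_ge0.
rewrite ler_norml; apply/andP; split; lra.
Qed.

Lemma integ_shift q l c : integ 0 l q -> integ 0 l (fun x => q x - c).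
Proof. by move=> intq; apply: integB => //; exact: integ_cst. Qed.

Lemma phi_shift q l lam c x : 0 < l -> integ 0 l q -> 0 <= x <= l ->
  phi q (lam + c) x = phi (fun y => q y - c) lam x /\
  dphi q (lam + c) x = dphi (fun y => q y - c) lam x.
Proof.
move=> l0 intq xl; have [hu hv] := @csol_phi _ q l (lam + c) l0 intq.
have hs : csol (fun y => q y - c) lam l (phi q (lam + c)) (dphi q (lam + c)).
  by split => //; apply: acd_eq hv _ => y _; ring.
have := csol_unique l0 (integ_shift c intq) hs (phi0 q (lam + c)) xl.
by rewrite dphi0 !mul1r.
Qed.

(** At a Dirichlet zero the solution started at [0] and the one started at [l] are proportional, and
    the derivative at [l] fixes the factor. *)
Lemma phi_reflection q l lam x : 0 < l -> integ 0 l q -> phi q lam l = 0 -> 0 <= x <= l ->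
  phi q lam x = - dphi q lam l * phi (fun y => q (l - y)) lam (l - x).
Proof.
move=> l0 intq hl xl; have [hu hv] := @csol_phi _ q l lam l0 intq.
have hs : csol (fun y => q (l - y)) lam l (fun y => phi q lam (l - y))
    (fun y => - dphi q lam (l - y)).
  split; first exact: acd_reflection.
  by apply: acd_eq (acdN (acd_reflection hv)) _ => y _; rewrite opprK.
have lx : 0 <= l - x <= l by case/andP: xl => ? ?; apply/andP; split; lra.
have := csol_unique l0 (integ_reflection intq) hs _ lx.
by rewrite !subr0 => /(_ hl)[]; rewrite opprB addrC subrK.
Qed.

Lemma acd_zero_derive a c (F f : R -> R) : (forall x, a < x < c -> F x = 0) -> acd a c F f ->
  aae a c (fun x => f x = 0).
Proof.
move=> F0 [_ dF]; apply: aae_imply dF _ => x /andP[ax xc] [_ <-].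
rewrite (@near_eq_derive _ _ _ F (fun=> 0)) ?derive_cst //; near=> y; apply: F0.
by apply/andP; split; near: y; [exact: lt_nbhsr|exact: lt_nbhsl].
Unshelve. all: by end_near. Qed.

End DirichletProblem.

(** * From a vanishing Wronskian to equality of the potentials *)

Section Uniqueness.
Context {R : realType}.
Implicit Types (q : R -> R) (l x y lam tau : R) (H : R -> R).
Notation mu := (@lebesgue_measure R).

Lemma growth_class_allM k1 k2 tau1 tau2 H1 H2 :
  growth_class_all k1 tau1 H1 -> growth_class_all k2 tau2 H2 ->
  growth_class_all (k1 + k2) (tau1 + tau2) (fun x => H1 x * H2 x).
Proof. by move=> h1 h2 c; exact: growth_classM. Qed.

Lemma growth_class_allD k tau H1 H2 : growth_class_all k tau H1 -> growth_class_all k tau H2 ->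
  growth_class_all k tau (fun x => H1 x + H2 x).
Proof. by move=> h1 h2 c; exact: growth_classD. Qed.

Lemma growth_class_all_weaken k k' tau tau' H : (k' <= k)%N -> tau <= tau' ->
  growth_class_all k tau H -> growth_class_all k' tau' H.
Proof. by move=> h1 h2 h3 c; exact: growth_class_weaken (h3 c). Qed.

Lemma growth_class_all_phi q l x : 0 < l -> integ 0 l q -> 0 <= x <= l ->
  growth_class_all 1 x (phi q ^~ x) /\ growth_class_all 0 x (dphi q ^~ x).
Proof.
move=> l0 intq xl; split=> c; have [h1 h2] := growth_phi l0 (integ_shift c intq) xl.
  by apply: growth_class_eq h1 => lam; have [] := phi_shift lam c l0 intq xl.
by apply: growth_class_eq h2 => lam; have [] := phi_shift lam c l0 intq xl.
Qed.

Lemma growth_class_all_diff q1 q2 l x : 0 < l -> integ 0 l q1 -> integ 0 l q2 -> 0 <= x <= l ->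
  growth_class_all 2 x (fun lam => phi q1 lam x - phi q2 lam x) /\
  growth_class_all 1 x (fun lam => dphi q1 lam x - dphi q2 lam x).
Proof.
move=> l0 i1 i2 xl; split=> c;
  have [h1 h2] := growth_phi_diff l0 (integ_shift c i1) (integ_shift c i2) xl.
- apply: growth_class_eq h1 => lam.
  by have [-> _] := phi_shift lam c l0 i1 xl; have [-> _] := phi_shift lam c l0 i2 xl.
- apply: growth_class_eq h2 => lam.
  by have [_ ->] := phi_shift lam c l0 i1 xl; have [_ ->] := phi_shift lam c l0 i2 xl.
Qed.

(** An identity theorem: infinitely many zeros in [[-1, 1]] are covered by the additive constant of
    the zero bound. *)
Lemma growth_class_bounded_zeros beta H (z : nat -> R) : 0 < beta ->
  growth_class_all 2 (2 * beta) H -> injective z -> (forall n, H (z n) = 0) ->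
  (forall n, `|z n| <= 1) -> forall c, H c = 0.
Proof.
move=> b0 gH zinj Hz z1.
apply: (@growth_class_eq0 R H beta z (fun=> 0) 0 1) => // n.
  by apply: le_trans (z1 n) _; rewrite lerDr mulr_ge0 ?sqr_ge0 ?expR_ge0.
by rewrite big1.
Qed.

(* One of two functions whose product vanishes has infinitely many zeros [1 / (n + 1)]. *)
Lemma growth_class_integral beta H1 H2 : 0 < beta ->
  growth_class_all 2 (2 * beta) (fun x => H1 x * H1 x) ->
  growth_class_all 2 (2 * beta) (fun x => H2 x * H2 x) ->
  (forall x, H1 x * H2 x = 0) -> (exists x, H1 x != 0) -> forall x, H2 x = 0.
Proof.
move=> b0 g1 g2 h12 [c0 hc0].
pose P H n := exists s : seq R, [/\ uniq s, size s = n.+1 &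
  forall z, z \in s -> H z = 0 /\ `|z| <= 1].
have all0 H : growth_class_all 2 (2 * beta) (fun x => H x * H x) -> (forall n, P H n) ->
    forall x, H x = 0.
  move=> gH hP; have [z [zinj hz]] := greedy_choice hP.
  have hz0 n : H (z n) * H (z n) = 0 by have [-> _] := hz n; rewrite mulr0.
  have hz1 n : `|z n| <= 1 by case: (hz n).
  move=> x; have := growth_class_bounded_zeros b0 gH zinj hz0 hz1 x.
  by move=> /eqP; rewrite mulf_eq0 orbb => /eqP.
have [hP|/existsNP[n0 hn0]] := pselect (forall n, P H1 n).
  by move: hc0; rewrite (all0 H1 g1 hP) eqxx.
apply: (all0 H2 g2) => n.
pose x_ (i : nat) : R := (i.+1%:R)^-1.
have xinj : injective x_.
  by move=> i j /invr_inj /eqP; rewrite eqr_nat eqSS => /eqP.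
have x1 i : `|x_ i| <= 1.
  by rewrite ger0_norm ?invr_ge0 // invf_le1 ?ltr0n // ler1n.
pose L := [seq x_ i | i <- iota 0 (n.+1 + n0.+1)]; pose p z := H1 z == 0.
have uL : uniq L by rewrite map_inj_uniq ?iota_uniq.
have L1 z : z \in L -> `|z| <= 1 by move=> /mapP[i _ ->].
have small : (size (seq.filter p L) <= n0)%N.
  rewrite leqNgt; apply/negP => h; apply: hn0; exists (take n0.+1 (seq.filter p L)); split.
  - by rewrite take_uniq // filter_uniq.
  - by rewrite size_takel.
  - move=> z /mem_take; rewrite mem_filter => /andP[/eqP hz zL]; split => //; exact: L1.
have big : (n.+1 <= size (seq.filter (predC p) L))%N.
  have := count_predC p L; rewrite -!size_filter /L size_map size_iota -/L.
  by move=> E; move: small; lia.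
exists (take n.+1 (seq.filter (predC p) L)); split.
- by rewrite take_uniq // filter_uniq.
- by rewrite size_takel.
- move=> z /mem_take; rewrite mem_filter => /andP[hz zL]; split; last exact: L1.
  by have /eqP := h12 z; rewrite mulf_eq0 => /orP[h|/eqP//]; rewrite /= /p h in hz.
Qed.

Section TwoPotentials.
Context (b : R) (b0 : 0 < b) (q1 q2 : R -> R) (int1 : integ 0 b q1) (int2 : integ 0 b q2).

Let bb : 0 <= b <= b.
Proof. by rewrite lexx ltW. Qed.

(** The Wronskian equals [phi_1 (phi_2' - phi_1') + phi_1' (phi_1 - phi_2)]. The powers of [r]
    gained by the factors are [1 + 1] and [0 + 2], which gives the decay [1 / r^2] in both terms. *)
Lemma growth_class_wronskian :
  growth_class_all 2 (2 * b) (fun lam => phi q1 lam b * dphi q2 lam b - dphi q1 lam b * phi q2 lam b).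
Proof.
have [g1 g1'] := growth_class_all_phi b0 int1 bb.
have [g2 g2'] := growth_class_all_diff b0 int2 int1 bb.
have [g3 _] := growth_class_all_diff b0 int1 int2 bb.
have h := growth_class_allD (growth_class_allM g1 g2') (growth_class_allM g1' g3).
move=> c; have {}h := h c; rewrite (_ : 2 * b = b + b); last by ring.
by apply: growth_class_eq h => lam /=; ring.
Qed.

Lemma positive_parameter : exists lam, forall x, 0 < x <= b -> 0 < phi q1 lam x /\ 0 < phi q2 lam x.
Proof.
pose kappa := prim 0 (fun x => `|q1 x|) b + prim 0 (fun x => `|q2 x|) b.
have Q1 : 0 <= prim 0 (fun x => `|q1 x|) b.
  by apply: (prim_ge0 (integ_norm int1)) => //; exact: ltW.
have Q2 : 0 <= prim 0 (fun x => `|q2 x|) b.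
  by apply: (prim_ge0 (integ_norm int2)) => //; exact: ltW.
exists (- kappa ^+ 2) => x xb; split.
  by apply: (phi_gt0 b0 int1) xb => y yb; apply: le_trans (prim_norm_le int1 yb) _; rewrite lerDl.
by apply: (phi_gt0 b0 int2) xb => y yb; apply: le_trans (prim_norm_le int2 yb) _; rewrite lerDr.
Qed.

Section EqualWronskian.
Context (W0 : forall lam, phi q1 lam b * dphi q2 lam b - dphi q1 lam b * phi q2 lam b = 0).

Let zeros : exists (C : R) (z : nat -> R), injective z /\
  forall n, phi q1 (z n) b = 0 /\ `|z n| <= (pi * n.+1%:R / b) ^+ 2 + C.
Proof. exact: dirichlet_zero_sequence. Qed.

(** Type [b] is [2 * (b / 2)], for which zeros near [(pi n / b)^2] are critical; their bounded
    deviation goes into the additive constant. *)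
Lemma eq0_of_dirichlet_zeros H : growth_class_all 2 b H ->
  (forall lam, phi q1 lam b = 0 -> H lam = 0) -> forall lam, H lam = 0.
Proof.
move=> gH hH; have [C [z [zinj hz]]] := zeros.
have b2 : 0 < b / 2 by rewrite divr_gt0.
have E : 2 * (b / 2) = b by field.
apply: (@growth_class_eq0 R H (b / 2) z (fun=> 0) 0 C) => //.
- by rewrite E.
- by move=> n; apply: hH; case: (hz n).
- by move=> n; rewrite expR0 mulr1 E; case: (hz n).
- by move=> N; rewrite big1.
Qed.

Lemma dphi_neq0 q lam : integ 0 b q -> phi q lam b = 0 -> dphi q lam b != 0.
Proof.
move=> intq h; have := csol_nonzero b0 intq lam bb; rewrite h mulr0 addr0 => h2.
by apply/eqP => h3; rewrite h3 mulr0 ltxx in h2.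
Qed.

Lemma phi_common_zero lam : phi q1 lam b = 0 -> phi q2 lam b = 0.
Proof.
move=> h; have := W0 lam; rewrite h mul0r sub0r => /eqP; rewrite oppr_eq0 mulf_eq0.
by rewrite (negbTE (dphi_neq0 int1 h)) => /eqP.
Qed.

Lemma phi_endpoint_eq lam : phi q1 lam b = phi q2 lam b.
Proof.
apply/eqP; rewrite -subr_eq0; apply/eqP; move: lam; apply: eq0_of_dirichlet_zeros.
  by have [] := growth_class_all_diff b0 int1 int2 bb.
by move=> lam h; rewrite h (phi_common_zero h) subrr.
Qed.

(** Once the endpoint values agree, the Wronskian factors as [phi_1] times the difference of
    derivatives. That difference gains only one power of [r]; its square has gain [2] and type
    [2 * b], which the cancellation of a factor uses. *)
Lemma dphi_endpoint_eq lam : dphi q1 lam b = dphi q2 lam b.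
Proof.
apply/eqP; rewrite -subr_eq0; apply/eqP; move: lam.
have [g1 _] := growth_class_all_phi b0 int1 bb.
have [_ g2] := growth_class_all_diff b0 int1 int2 bb.
apply: (@growth_class_integral b (phi q1 ^~ b)) => //.
- by move=> c; have := growth_class_allM g1 g1 c; rewrite (_ : 2 * b = b + b) //; ring.
- by move=> c; have := growth_class_allM g2 g2 c; rewrite (_ : 2 * b = b + b) //; ring.
- by move=> lam; have := W0 lam; rewrite -(phi_endpoint_eq lam) => h; lra.
- have [lam hl] := positive_parameter; exists lam; rewrite gt_eqF //.
  by have [] := hl b; rewrite // b0 lexx.
Qed.

(** As a function of [x], [phi r1 lam (b - x)] solves the equation for [q1] with value [0] and
    derivative [-1] at [b]; likewise for [r2]. *)
Let r1 := fun y => q1 (b - y).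
Let r2 := fun y => q2 (b - y).

(** The difference is [(phi_1 - phi_2) chi_2 + phi_2 (chi_2 - chi_1)], of type [x + (b - x) = b]
    with sufficient decay. At a common Dirichlet zero, [phi_1] and [phi_2] are multiples of [chi_1]
    and [chi_2] by the same factor, since the endpoint derivatives agree. *)
Lemma phi_cross_eq x lam : 0 <= x <= b ->
  phi q1 lam x * phi r2 lam (b - x) = phi q2 lam x * phi r1 lam (b - x).
Proof.
move=> xb; have xb' : 0 <= b - x <= b by case/andP: xb => ? ?; apply/andP; split; lra.
have ir1 : integ 0 b r1 by exact: integ_reflection.
have ir2 : integ 0 b r2 by exact: integ_reflection.
apply/eqP; rewrite -subr_eq0; apply/eqP; move: lam; apply: eq0_of_dirichlet_zeros.
  have [g1 _] := growth_class_all_diff b0 int1 int2 xb.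
  have [g2 _] := growth_class_all_phi b0 int2 xb.
  have [g3 _] := growth_class_all_phi b0 ir2 xb'.
  have [g4 _] := growth_class_all_diff b0 ir2 ir1 xb'.
  have h := growth_class_allD (growth_class_allM g1 g3) (growth_class_allM g2 g4).
  have hb : x + (b - x) <= b by lra.
  move=> c; have {}h := growth_class_all_weaken (leqnSn 2) hb h c.
  by apply: growth_class_eq h => lam /=; ring.
move=> lam h1; have h2 := phi_common_zero h1.
rewrite (phi_reflection b0 int1 h1 xb) (phi_reflection b0 int2 h2 xb) -/r1 -/r2.
by rewrite dphi_endpoint_eq; ring.
Qed.

Lemma potentials_eq : aae 0 b (fun x => q1 x = q2 x).
Proof.
have [lam hpos] := positive_parameter.
have ir1 : integ 0 b r1 by exact: integ_reflection.
have ir2 : integ 0 b r2 by exact: integ_reflection.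
have [hu1 hv1] := @csol_phi _ q1 b lam b0 int1.
have [hu2 hv2] := @csol_phi _ q2 b lam b0 int2.
have dref (r : R -> R) x : integ 0 b r -> 0 < x < b ->
    is_derive x 1 (fun y => phi r lam (b - y)) (- dphi r lam (b - x)).
  move=> ir /andP[x0 xb]; have xb' : 0 < b - x < b by apply/andP; split; lra.
  have h' : is_derive x 1 (fun y : R => b - y) (-1).
    by apply: (is_derive_eq (is_deriveB (is_derive_cst b x 1) (is_derive_id x 1))); ring.
  have := @is_derive1_comp R (phi r lam) (fun y => b - y) x _ _ (phi_is_derive lam b0 ir xb') h'.
  by rewrite mulrN1.
(* The Wronskian of [phi] with the solution started at [b] is constant; its value at [b] is that of
   [phi], the same for both potentials. *)
have wr q (r := fun y => q (b - y)) x : integ 0 b q -> 0 <= x <= b ->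
    phi q lam x * dphi r lam (b - x) + dphi q lam x * phi r lam (b - x) = phi q lam b.
  move=> iq /andP[x0 xb]; have ir : integ 0 b r by exact: integ_reflection.
  have [hu hv] := @csol_phi _ q b lam b0 iq; have [hru hrv] := @csol_phi _ r b lam b0 ir.
  have h := acdD (acdM hu (acd_reflection hrv)) (acdM hv (acd_reflection hru)).
  have := acd_const xb (acd_sub x0 (lexx b) h).
  rewrite /= subrr phi0 dphi0 mulr1 mulr0 addr0 => ->//.
  by apply: aaeW => y _; rewrite /r (_ : b - (b - y) = y); last ring; ring.
have eqphi x : 0 < x < b -> phi q1 lam x = phi q2 lam x.
  move=> xb; have /andP[x0 xb'] := xb.
  have xb2 : 0 <= x <= b by rewrite !ltW.
  have d1 := is_deriveM (phi_is_derive lam b0 int1 xb) (dref r2 x ir2 xb).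
  have d2 := is_deriveM (phi_is_derive lam b0 int2 xb) (dref r1 x ir1 xb).
  have E1 := phi_cross_eq lam xb2.
  have E2 : phi q1 lam x * - dphi r2 lam (b - x) + phi r2 lam (b - x) * dphi q1 lam x =
      phi q2 lam x * - dphi r1 lam (b - x) + phi r1 lam (b - x) * dphi q2 lam x.
    case: d1 => _ <-; case: d2 => _ <-; apply: near_eq_derive; near=> y.
    by apply: phi_cross_eq; apply/andP; split; apply: ltW; near: y;
      [exact: lt_nbhsr|exact: lt_nbhsl].
  have [p1 p2] : 0 < phi q1 lam x /\ 0 < phi q2 lam x by apply: hpos; rewrite x0 ltW.
  have [om _] : 0 < phi q1 lam b /\ 0 < phi q2 lam b by apply: hpos; rewrite b0 lexx.
  have w1 := wr q1 x int1 xb2; have w2 := wr q2 x int2 xb2.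
  rewrite -(phi_endpoint_eq lam) in w2; rewrite -/r1 in w1; rewrite -/r2 in w2.
  move: E1 E2 w1 w2 p1 p2 om.
  move: (phi q1 lam x) (phi q2 lam x) (dphi q1 lam x) (dphi q2 lam x) (phi q1 lam b).
  move: (phi r1 lam (b - x)) (phi r2 lam (b - x)) (dphi r1 lam (b - x)) (dphi r2 lam (b - x)).
  move=> c1 c2 e1 e2 f1 f2 g1 g2 om E1 E2 w1 w2 p1 p2 om0.
  (* Each side is expanded by the Wronskian relation of the other potential; the cross identity and
     its derivative in [x] match the results. *)
  have E : f1 ^+ 2 * om = f2 ^+ 2 * om.
    have -> : f1 ^+ 2 * om = f1 * (f1 * (f2 * e2 + g2 * c2)) by rewrite w2; ring.
    have -> : f2 ^+ 2 * om = f2 * (f2 * (f1 * e1 + g1 * c1)) by rewrite w1; ring.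
    have k1 : f1 * f2 * (f1 * - e2 + c2 * g1) = f1 * f2 * (f2 * - e1 + c1 * g2) by rewrite E2.
    have k2 : f1 * g2 * (f1 * c2) = f1 * g2 * (f2 * c1) by rewrite E1.
    have k3 : f2 * g1 * (f1 * c2) = f2 * g1 * (f2 * c1) by rewrite E1.
    lra.
  move: E => /(mulIf (lt0r_neq0 om0)) /eqP; rewrite eqrXn2 ?ltW // => /eqP; exact.
have eqd x : 0 < x < b -> dphi q1 lam x = dphi q2 lam x.
  move=> xb; have /andP[x0 xb'] := xb.
  have [_ <-] := phi_is_derive lam b0 int1 xb; have [_ <-] := phi_is_derive lam b0 int2 xb.
  apply: near_eq_derive; near=> y; apply: eqphi.
  by apply/andP; split; near: y; [exact: lt_nbhsr|exact: lt_nbhsl].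
have := acd_zero_derive _ (acdB hv1 hv2) => /(_ _)/wrap[x xb|].
  by rewrite eqd // subrr.
move=> h; apply: aae_imply h _ => x xb; rewrite eqphi // -mulrBl => /eqP.
have [_ p2] : 0 < phi q1 lam x /\ 0 < phi q2 lam x.
  by case/andP: xb => x0 xb; apply: hpos; rewrite x0 ltW.
rewrite mulf_eq0 (gt_eqF p2) orbF => /eqP; lra.
Unshelve. all: by end_near. Qed.

End EqualWronskian.

End TwoPotentials.

End Uniqueness.

(** * Reduction of the inverse problem to a bound on the indices *)

Section Recovery.
Context {R : realType}.
Implicit Types (q : R -> R).
Notation mu := (@lebesgue_measure R).

(** On [[b, 1]] the two equations coincide, so the Wronskian is constant there, and the Dirichlet
    condition makes it vanish at [1]. *)
Lemma wronskian_zero q1 q2 b (lam : R) : 0 < b < 1 -> integ 0 1 q1 -> integ 0 1 q2 ->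
  aae b 1 (fun x => q1 x = q2 x) -> phi q1 lam 1 = 0 -> phi q2 lam 1 = 0 ->
  phi q1 lam b * dphi q2 lam b - dphi q1 lam b * phi q2 lam b = 0.
Proof.
move=> /andP[b0 b1] i1 i2 hq h1 h2; have l0 : (0 : R) < 1 by [].
have [hu1 hv1] := @csol_phi _ q1 1 lam l0 i1; have [hu2 hv2] := @csol_phi _ q2 1 lam l0 i2.
have h := acdB (acdM hu1 hv2) (acdM hv1 hu2).
have := acd_const (ltW b1) (acd_sub (ltW b0) (lexx 1) h).
rewrite /= h1 h2 mul0r mulr0 subrr => <- //.
by apply: aae_imply hq _ => x _ ->; ring.
Qed.

(** Common form of the two density cases: [al] takes the summable relative deviation of the indices,
    [C0] a bounded additive error. *)
Lemma data_determine_of_growth (b : R) (m : nat -> nat) (al : nat -> R) (S C0 : R) :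
  0 < b < 1 -> (forall n, (0 < n)%N -> (0 < m n)%N) ->
  (forall i j, (0 < i)%N -> (0 < j)%N -> m i = m j -> i = j) ->
  (forall n, 0 <= al n) -> (forall N, \sum_(n < N) al n <= S) ->
  (forall n, (pi * (m n.+1)%:R) ^+ 2 <= (pi * n.+1%:R / (2 * b)) ^+ 2 * expR (al n) + C0) ->
  data_determine_potential b m.
Proof.
move=> b01 m_pos m_inj al0 hS hm q1 q2 l1 l2 i1 i2 sp1 sp2 hq hl.
have /andP[b0 b1] := b01.
have {}hq : aae b 1 (fun x => q1 x = q2 x).
  apply: negligibleS hq => x /= h h'; apply: h => /andP[bx x1]; apply: h'.
  by rewrite /= in_itv /= !ltW.
have j1 : integ 0 b q1 by apply: integ_sub i1 => //; exact: ltW.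
have j2 : integ 0 b q2 by apply: integ_sub i2 => //; exact: ltW.
have l1inj i j : (0 < i)%N -> (0 < j)%N -> l1 i = l1 j -> i = j.
  move=> i0 j0 E; have [mono _] := sp1.
  have [ij|ji|//] := ltngtP i j.
    by have := mono i j; rewrite i0 ij E ltxx => /(_ isT).
  by have := mono j i; rewrite j0 ji E ltxx => /(_ isT).
pose z n := l1 (m n.+1).
have zinj : injective z.
  move=> i j E; apply: succn_inj; apply: m_inj => //.
  by apply: l1inj E; exact: m_pos.
have z1 n : phi q1 (z n) 1 = 0.
  by apply: (eigenvalue_phi i1); apply/(proj2 sp1); exists (m n.+1) => //; exact: m_pos.
have z2 n : phi q2 (z n) 1 = 0.
  apply: (eigenvalue_phi i2); apply/(proj2 sp2); exists (m n.+1); first exact: m_pos.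
  exact: hl.
have [C hC] := spectrum_bound i1 sp1.
have W0 : forall lam, phi q1 lam b * dphi q2 lam b - dphi q1 lam b * phi q2 lam b = 0.
  apply: (@growth_class_eq0 R _ b z al S (C0 + C) b0 (growth_class_wronskian b0 j1 j2) zinj) => //.
    by move=> n; exact: (wronskian_zero b01 i1 i2).
  by move=> n; apply: le_trans (hC _ (m_pos _ (ltn0Sn n))) _; rewrite addrA lerD2r.
have := potentials_eq b0 j1 j2 W0 => hpot.
have null (a : R) : mu.-negligible [set a].
  by apply/negligibleP => //; exact: lebesgue_measure_set1.
have := negligibleU hpot (negligibleU (null 0) (null b)).
apply: negligibleS => x /= h.
have [->|x0] := eqVneq x 0; first by right; left.
have [->|xb] := eqVneq x b; first by right; right.
left => h'; apply: h; rewrite /= in_itv /= => /andP[hx0 hxb]; apply: h'.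
by rewrite !lt_neqAle eq_sym x0 hx0 xb hxb.
Qed.

End Recovery.


(** * Consequences of the density hypotheses *)

Section Density.
Context {R : realType}.
Implicit Types (b sigma : R) (m : nat -> nat) (eps : nat -> R).

Lemma index_le_of_density b sigma m eps : 0 < b -> 2 * b < sigma -> 
  (forall n, (0 < n)%N -> (m n)%:R / n%:R = sigma^-1 * (1 + eps n)) ->
  eps @ \oo --> (0 : R) ->
  exists C : R, forall n, (pi * (m n.+1)%:R) ^+ 2 <=
    (pi * n.+1%:R / (2 * b)) ^+ 2 * expR 0 + C :> R.
Proof.
move=> b0 bs hm heps; have b2 : 0 < 2 * b by rewrite mulr_gt0.
have s0 : 0 < sigma := lt_trans b2 bs.
(* As soon as [eps n <= d], the ratio [m n / n] is at most [1 / (2b)]. *)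
pose d := sigma / (2 * b) - 1.
have d0 : 0 < d by rewrite subr_gt0 ltr_pdivlMr // mul1r.
have [N _ HN] := (iffLR (cvgrPdist_le _ _) heps) d d0.
(* The finitely many earlier indices are absorbed by the additive constant. *)
pose C : R := \sum_(i < N) (pi * (m i.+1)%:R) ^+ 2.
have C0 : 0 <= C by apply: sumr_ge0 => i _; exact: sqr_ge0.
exists C => n; rewrite expR0 mulr1; have [nN|Nn] := ltnP n N.
  apply: (@le_trans _ _ C); last by rewrite lerDr sqr_ge0.
  by rewrite /C (bigD1 (Ordinal nN)) //= lerDl; apply: sumr_ge0 => i _; exact: sqr_ge0.
have := HN n.+1 (leqW Nn); rewrite /= sub0r normrN => /(le_trans (ler_norm _)) he.
apply: ler_wpDr => //; rewrite lerXn2r ?nnegrE ?divr_ge0 ?mulr_ge0 ?pi_ge0 ?(ltW b0) //.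
rewrite -mulrA ler_wpM2l ?pi_ge0 //.
have n0 : 0 < n.+1%:R :> R by rewrite ltr0n.
rewrite mulrC -ler_pdivrMr // hm // ler_pdivrMl //.
by move: he; rewrite /d; lra.
Qed.

(** The bound [1 + eps <= expR |eps|], squared because eigenvalues grow like the squares of their
    indices; hence the factor [2] in the exponent. *)
Lemma index_le_of_critical_density b m eps : 0 < b ->
  (forall n, (0 < n)%N -> (m n)%:R / n%:R = (2 * b)^-1 * (1 + eps n)) ->
  forall n, (pi * (m n.+1)%:R) ^+ 2 <=
    (pi * n.+1%:R / (2 * b)) ^+ 2 * expR (2 * `|eps n.+1|) + 0 :> R.
Proof.
move=> b0 hm n; have b2 : 0 < 2 * b by rewrite mulr_gt0.
have n0 : 0 < n.+1%:R :> R by rewrite ltr0n.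
rewrite addr0 expRM_natl -exprMn lerXn2r ?nnegrE //.
- by rewrite mulr_ge0 ?pi_ge0.
- by rewrite mulr_ge0 ?expR_ge0 // divr_ge0 ?mulr_ge0 ?pi_ge0 // ltW.
have h1 : (m n.+1)%:R = n.+1%:R * ((2 * b)^-1 * (1 + eps n.+1)).
  by rewrite -hm // mulrC divfK // gt_eqF.
have h2 : 1 + eps n.+1 <= expR `|eps n.+1|.
  by apply: le_trans (expR_ge1Dx _); rewrite lerD2l ler_norm.
rewrite h1 -!mulrA ler_wpM2l ?pi_ge0 // ler_wpM2l // ler_wpM2l //.
by rewrite invr_ge0 ltW.
Qed.

Lemma partial_sums_le eps : (\sum_(1 <= n <oo) `|eps n|%:E < +oo)%E ->
  exists S : R, forall N, \sum_(n < N) (2 * `|eps n.+1|) <= S.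
Proof.
move=> hS; set T := (\sum_(1 <= n <oo) _)%E in hS.
have T0 : (0 <= T)%E by apply: nneseries_ge0 => n _ _; rewrite lee_fin.
have fT : T \is a fin_num by rewrite ge0_fin_numE.
exists (2 * fine T) => N; rewrite -mulr_sumr ler_wpM2l //.
rewrite -lee_fin fineK // -sumEFin.
have : (\sum_(1 <= n < N.+1) `|eps n|%:E <= T)%E.
  by apply: nneseries_lim_ge => n _ _; rewrite lee_fin.
by rewrite big_add1 /= big_mkord.
Qed.

End Density.

Theorem theorem3p1 (R : realType) (b sigma : R) (m : nat -> nat) (eps : nat -> R)
    (hb : 0 < b < 1) (hsigma : 0 < sigma)
    (m_pos : forall n : nat, (0 < n)%N -> (0 < m n)%N)
    (m_inj : forall i j : nat, (0 < i)%N -> (0 < j)%N -> m i = m j -> i = j)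
    (hm : forall n : nat, (0 < n)%N -> (m n)%:R / n%:R = sigma^-1 * (1 + eps n))
    (heps : eps @ \oo --> (0 : R)) :
  (2 * b < sigma -> data_determine_potential b m) /\
  (sigma = 2 * b -> (\sum_(1 <= n <oo) `|eps n|%:E < +oo)%E ->
   data_determine_potential b m).
Proof.
have /andP[b0 b1] := hb; split=> [bs|sE hS].
  have [C hC] := index_le_of_density b0 bs hm heps.
  apply: (@data_determine_of_growth R b m (fun=> 0) 0 C) => // N.
  by rewrite big1.
have [S hS'] := partial_sums_le hS.
rewrite sE in hm.
apply: (data_determine_of_growth hb m_pos m_inj _ hS' (index_le_of_critical_density b0 hm)).
by move=> n; rewrite mulr_ge0.
Qed.
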